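(* Suppose that $\mathrm{SVT}(B,J)$ holds for every ramified regular local ring $B$ of mixed characteristic and every proper ideal $J$ of $B$. Then $\mathrm{SVT}(A,I)$ holds for every unramified regular local ring $A$ of mixed characteristic and every proper ideal $I$ of $A$.
   Context: For a ring $A$ and ideal $I$, $\mathrm{cd}(A,I)=\sup\{i \mid \exists\, M\in \mathrm{Mod}(A),\ H^i_I(M)\neq 0\}$, where $H^i_I$ is local cohomology. For a local ring $A$, $A^{\dagger}$ denotes the completion of the strict henselization of the completion of $A$. For a regular local ring $A$ and a proper ideal $I$, ''$\mathrm{SVT}(A,I)$ holds'' (the Second Vanishing Theorem holds for $(A,I)$) means that the following are equivalent: (1) $\mathrm{cd}(A,I)\leq \dim A-2$; (2) $\dim A/I\geq 2$ and $\operatorname{Spec}(A^{\dagger}/IA^{\dagger})$ minus its closed point is connected. A regular local ring $(A,\mathfrak m)$ of mixed characteristic $(0,p)$ is ramified if $p\in\mathfrak m^2$ and unramified if $p\notin\mathfrak m^2$. *)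

(* Defs.v *)
From HB Require Import structures.
From mathcomp Require Import all_boot all_order all_algebra.
From mathcomp Require Import generic_quotient ring_quotient separable.
From mathcomp Require Import all_classical all_reals topology.

Set Implicit Arguments.
Unset Strict Implicit.
Unset Printing Implicit Defensive.

Import Order.TTheory GRing.Theory Num.Theory.
Local Open Scope classical_set_scope.
Local Open Scope quotient_scope.
Local Open Scope ring_scope.

(* Conventions.  Rings are commutative with 1 != 0.  A proper ideal of R is an
   [idealr R] and a prime ideal a [prime_idealr R], as in ring_quotient; a
   possibly non-proper ideal is a [set R] satisfying [is_ideal]. *)

Section Ideals.
Variable R : comNzRingType.

Definition is_ideal (J : set R) : Prop :=
  J 0 /\ forall a u v, J u -> J v -> J (a * u + v).

Definition ideal_span (S : set R) : set R := smallest is_ideal S.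

Definition ideal_mul (I J : set R) : set R :=
  ideal_span [set x * y | x in I & y in J].

Definition ideal_exp (I : set R) (n : nat) : set R := iter n (ideal_mul I) setT.

Lemma is_ideal_span S : is_ideal (ideal_span S).
Proof.
split=> [J [[J0 _] _]//|a u v hu hv J hJ].
by have [[_ Jl] _] := hJ; apply: Jl; [exact: hu|exact: hv].
Qed.

Lemma is_ideal_exp I n : is_ideal (ideal_exp I n).
Proof. by case: n => [|n]; [split|exact: is_ideal_span]. Qed.

Lemma ideal_exp1_sub (I : idealr R) : ideal_exp [set` I] 1 `<=` [set` I].
Proof.
apply: smallest_sub; first split=> /=; first exact: rpred0.
  by move=> a u v uI vI /=; rewrite rpredD// idealMr.
by move=> _ [x xI] [y _] <- /=; rewrite mulrC idealMr.
Qed.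

Definition noetherian : Prop :=
  forall J : set R, is_ideal J -> exists s : seq R, J = ideal_span [set` s].

Definition spec : Type := prime_idealr R.

HB.instance Definition _ := gen_eqMixin spec.
HB.instance Definition _ := gen_choiceMixin spec.

Definition zero_locus (S : set R) : set spec := [set p | S `<=` [set` p]].

Definition zariski_open : set_system spec :=
  [set U | exists S : set R, U = ~` zero_locus S].

Lemma zariski_openT : zariski_open setT.
Proof.
exists setT; apply/esym/seteqP; split=> // p _ /(_ 1 I) /=.
by rewrite idealr1.
Qed.

Lemma zariski_openI : setI_closed zariski_open.
Proof.
move=> _ _ [S ->] [T ->]; exists [set x * y | x in S & y in T].
rewrite -setCU; congr (~` _); apply/seteqP; split=> p.
  by case=> h _ [x Sx] [y Ty] <- /=; rewrite prime_idealrM;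
    [rewrite (h x Sx)|rewrite (h y Ty) orbT].
move=> h; case: (pselect (zero_locus S p)) => [|nS]; [by left|right=> y Ty].
apply: contrapT => /negP yp; apply: nS => x Sx.
have /h /= : [set x * y | x in S & y in T] (x * y) by exists x => //; exists y.
by rewrite prime_idealrM (negbTE yp) orbF.
Qed.

Lemma zariski_open_bigcup (I : Type) (f : I -> set spec) :
  (forall i, zariski_open (f i)) -> zariski_open (\bigcup_i f i).
Proof.
move=> /choice [S hS]; exists (\bigcup_i S i); apply/seteqP; split=> p.
  by case=> i _; rewrite hS => nS h; apply: nS => x Sx; apply: h; exists i.
move=> nS; apply: contrapT => h; apply: nS => x [i _ Six].
have hp : zero_locus (S i) p.
  by apply: contrapT => nSi; apply: h; exists i => //; rewrite hS.
exact: hp.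
Qed.

HB.instance Definition _ := isOpenTopological.Build spec
  zariski_openT zariski_openI zariski_open_bigcup.

(* The supremum of the lengths n of chains p_0 < ... < p_n of primes, in
   {-oo} U Z U {+oo}. *)
Definition krull_dim : \bar int :=
  supremum -oo%E [set (n%:Z)%:E%E | n in [set n : nat |
    exists p : nat -> spec, forall i, (i < n)%N ->
      [set` p i] `<` [set` p i.+1]]].

End Ideals.

Section LocalCohomology.
Variables (A : comNzRingType) (I : idealr A).

(* Gamma_I(M), the I-power torsion elements. *)
Definition torsion (M : lmodType A) : set M :=
  [set x | exists n, forall a, ideal_exp [set` I] n a -> a *: x = 0].
Arguments torsion M : clear implicits.

Definition injective_module (E : lmodType A) : Prop :=
  forall (M N : lmodType A) (f : {linear M -> N}) (g : {linear M -> E}),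
    injective f -> exists h : {linear N -> E}, h \o f =1 g.

Record injective_resolution (M : lmodType A) := InjectiveResolution {
  ires_obj :> nat -> lmodType A;
  ires_aug : {linear M -> ires_obj 0};
  ires_diff : forall n, {linear ires_obj n -> ires_obj n.+1};
  _ : forall n, injective_module (ires_obj n);
  _ : injective ires_aug;
  _ : forall x, ires_diff 0 x = 0 <-> exists y, ires_aug y = x;
  _ : forall n x, ires_diff n.+1 x = 0 <-> exists y, ires_diff n y = x
}.

Section Cohomology.
Variables (M : lmodType A) (E : injective_resolution M) (i : nat).

Definition cocycle : {pred E i} :=
  fun x => x \in torsion (E i) `&` [set x | ires_diff E i x = 0].

(* The image of Gamma_I(E^(i-1)), which is zero for i = 0. *)
Definition coboundary_set : set (E i) :=
  match i return set (E i) with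
  | 0 => [set 0]
  | j.+1 => ires_diff E j @` torsion (E j)
  end.

Lemma torsion_sub (N : lmodType A) (x y : N) :
  torsion N x -> torsion N y -> torsion N (x - y).
Proof.
have sub n k a : ideal_exp [set` I] (k + n)%N a -> ideal_exp [set` I] n a.
  elim: k a => [//|k IHk] a; rewrite addSn /= => h.
  apply: IHk; move: a h; apply: smallest_sub; first exact: is_ideal_exp.
  move=> _ [b _] [c hc] <-; have [h0 hl] := is_ideal_exp [set` I] (k + n).
  by rewrite -[b * c]addr0; apply: hl.
move=> [n hn] [k hk]; exists (n + k)%N => a ha.
by rewrite scalerBr hk ?hn ?subr0//; [apply: (sub _ k); rewrite addnC|
  exact: (sub _ n)].
Qed.

Lemma cocycle_zmod_closed : zmod_closed cocycle.
Proof.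
split=> [|x y]; first by apply/mem_set; split; [exists 0 => a _|];
  rewrite /= ?scaler0 ?raddf0.
move=> /set_mem[tx dx] /set_mem[ty dy]; apply/mem_set; split.
  exact: torsion_sub.
by rewrite /= linearB -[RHS](subrr 0) -{1}dx -dy.
Qed.
HB.instance Definition _ :=
  GRing.isZmodClosed.Build (E i) cocycle cocycle_zmod_closed.

Record cocycles := Cocycle { cocycle_val : E i; _ : cocycle_val \in cocycle }.
HB.instance Definition _ := [isSub for cocycle_val].
HB.instance Definition _ := [Choice of cocycles by <:].
HB.instance Definition _ := [SubChoice_isSubZmodule of cocycles by <:].

Definition coboundary : {pred cocycles} :=
  fun x => cocycle_val x \in coboundary_set.

Lemma coboundary_zmod_closed : zmod_closed coboundary.
Proof.
rewrite /coboundary; split=> [|x y] /=.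
  apply/mem_set; rewrite [cocycle_val _](raddf0 (\val : cocycles -> _)).
  rewrite /coboundary_set; case: (i) => [//|j].
  by exists 0; [exists 0 => a _; rewrite scaler0|rewrite raddf0].
move=> /set_mem hx /set_mem hy; apply/mem_set.
rewrite [cocycle_val _](raddfB (\val : cocycles -> _)) /=.
move: (cocycle_val x) (cocycle_val y) hx hy.
rewrite /coboundary_set; case: (i) => [|j] u v /=.
  by move=> -> ->; rewrite subr0.
move=> [a ta <-] [b tb <-]; exists (a - b); last by rewrite raddfB.
exact: torsion_sub.
Qed.
HB.instance Definition _ :=
  GRing.isZmodClosed.Build cocycles coboundary coboundary_zmod_closed.

(* H^i_I(M), as the i-th cohomology of Gamma_I applied to the resolution E;
   its A-module structure is not needed and only the group is formed. *)
Definition local_cohomology : zmodType := Quotient.quot coboundary.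

End Cohomology.

(* Whether H^i_I(M) vanishes does not depend on the injective resolution. *)
Definition cd : \bar int :=
  supremum -oo%E [set (i%:Z)%:E%E | i in [set i : nat |
    exists (M : lmodType A) (E : injective_resolution M)
      (h : local_cohomology E i), h != 0]].

End LocalCohomology.

(* A ring with a proper ideal [maxid] whose complement consists of units: then
   [maxid] is the unique maximal ideal. *)
HB.mixin Record isLocal R of GRing.ComNzRing R := {
  maxid_pred : {pred R};
  maxid_closed : idealr_closed maxid_pred;
  maxid_unit : forall x : R, x \notin maxid_pred -> exists y, x * y = 1
}.

#[short(type="localRingType")]
HB.structure Definition LocalRing := {R of GRing.ComNzRing R & isLocal R}.

Definition maxid (R : localRingType) : {pred R} := @maxid_pred R.
Arguments maxid R _ : clear implicits.
HB.instance Definition _ (R : localRingType) :=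
  isIdealr.Build R (maxid R) (@maxid_closed R).

Lemma sub_maxid (R : localRingType) (I : idealr R) : {subset I <= maxid R}.
Proof.
move=> x xI; apply: contraT => /maxid_unit[y xy].
by have := idealr1 I; rewrite -xy mulrC idealMr.
Qed.

HB.mixin Record isLocalHom (A B : localRingType) (f : A -> B) := {
  local_hom_maxid : forall x, x \in maxid A -> f x \in maxid B
}.

#[short(type="localHom")]
HB.structure Definition LocalHom (A B : localRingType) :=
  {f of @GRing.RMorphism A B f & isLocalHom A B f}.

HB.instance Definition _ (A B C : localRingType)
    (g : localHom B C) (f : localHom A B) :=
  isLocalHom.Build A C (g \o f)
    (fun x xA => local_hom_maxid (s := g) _ (local_hom_maxid (s := f) x xA)).

Section ExtendedIdeal.
Variables (A B : localRingType) (f : localHom A B) (I : idealr A).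

Definition extended_ideal : {pred B} := fun x => x \in ideal_span (f @` [set` I]).

Lemma extended_ideal_closed : idealr_closed extended_ideal.
Proof.
have [h0 hl] := is_ideal_span (f @` [set` I]).
split; [exact/asboolP| |]; last first.
  by move=> a u v /asboolP hu /asboolP hv; apply/asboolP; apply: hl.
apply/negP => /asboolP h.
suff : [set` maxid B] 1 by rewrite /= idealr1.
move: h; apply: smallest_sub; first split=> /=; first exact: idealr0.
  by move=> a u v uI vI /=; rewrite rpredD// idealMr.
by move=> _ [x /= xI <-]; apply: local_hom_maxid; apply: sub_maxid xI.
Qed.
HB.instance Definition _ := isIdealr.Build B extended_ideal extended_ideal_closed.

End ExtendedIdeal.

Section LocalQuotient.
Variables (R : localRingType) (I : idealr R).
Notation Q := {ideal_quot I}.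

Definition quot_maxid : {pred Q} := fun x => repr x \in maxid R.

Lemma quot_maxidE (x : R) : (\pi_Q x \in quot_maxid) = (x \in maxid R).
Proof.
have h : repr (\pi_Q x) - x \in maxid R.
  by apply: (@sub_maxid R I); rewrite Quotient.idealrBE reprK.
rewrite -[LHS]/(repr (\pi_Q x) \in maxid R); apply/idP/idP => hx; last first.
  by rewrite -[repr (\pi_Q x)](subrK x) rpredD.
by rewrite -[x](subKr (repr (\pi_Q x))) rpredB.
Qed.

Lemma quot_maxid_closed : idealr_closed quot_maxid.
Proof.
split.
- by rewrite -(rmorph0 (\pi_Q : R -> Q)) quot_maxidE rpred0.
- by rewrite -(rmorph1 (\pi_Q : R -> Q)) quot_maxidE idealr1.
move=> a u v; rewrite -[a]reprK -[u]reprK -[v]reprK.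
by rewrite -rmorphM -rmorphD !quot_maxidE => hu hv; rewrite rpredD// idealMr.
Qed.

Lemma quot_maxid_unit (x : Q) : x \notin quot_maxid -> exists y, x * y = 1.
Proof.
rewrite -[x]reprK quot_maxidE => /maxid_unit[y xy].
by exists (\pi_Q y); rewrite -rmorphM xy rmorph1.
Qed.
HB.instance Definition _ := isLocal.Build Q quot_maxid_closed quot_maxid_unit.

End LocalQuotient.

Section Residue.
Variable R : localRingType.

Definition residue : Type := {ideal_quot (maxid R)}.
HB.instance Definition _ := GRing.ComNzRing.on residue.

Definition res : R -> residue := \pi_{ideal_quot (maxid R)}.
HB.instance Definition _ := GRing.RMorphism.on res.

Lemma res_eq0 x : (res x == 0) = (x \in maxid R).
Proof. by rewrite -(rmorph0 res) -[x in RHS]subr0 Quotient.idealrBE. Qed.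

Lemma res_surj x : res (repr x) = x.
Proof. exact: reprK. Qed.

Definition residue_inv (x : residue) : residue :=
  if x == 0 then 0 else xget 0 [set y | y * x = 1].

Lemma residue_mulVf x : x != 0 -> residue_inv x * x = 1.
Proof.
rewrite /residue_inv => x0; rewrite (negbTE x0).
rewrite -[x]res_surj; have : repr x \notin maxid R by rewrite -res_eq0 res_surj.
by move=> /maxid_unit[y xy]; case: xgetP => [? -> //|/(_ (res y))[]];
  rewrite /= mulrC -rmorphM xy rmorph1.
Qed.

Lemma residue_inv0 : residue_inv 0 = 0.
Proof. by rewrite /residue_inv eqxx. Qed.
HB.instance Definition _ :=
  GRing.ComNzRing_isField.Build residue residue_mulVf residue_inv0.

Definition punctured_spec : set (spec R) := [set p | ~ (p : pred R) =i maxid R].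

End Residue.

(* The m-adic completion lim_n R/m^(n+1): a point of the inverse limit is
   represented by a sequence a, with a n a lift of its component in R/m^(n+1);
   two sequences are identified when they agree modulo m^(n+1) for every n. *)
Section Completion.
Variable R : localRingType.
Notation mpow n := (ideal_exp [set` maxid R] n).

Definition coherent : {pred nat -> R} :=
  fun a => `[< forall n, mpow n.+1 (a n.+1 - a n) >].

Lemma mpow_mull n a x : mpow n x -> mpow n (a * x).
Proof.
have [h0 hl] := is_ideal_exp [set` maxid R] n.
by move=> hx; rewrite -[a * x]addr0; apply: hl.
Qed.

Lemma mpowD n x y : mpow n x -> mpow n y -> mpow n (x + y).
Proof.
have [h0 hl] := is_ideal_exp [set` maxid R] n.
by move=> hx hy; rewrite -[x]mul1r; apply: hl.
Qed.

Lemma mpowN n x : mpow n x -> mpow n (- x).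
Proof. by rewrite -mulN1r; apply: mpow_mull. Qed.

Lemma mpow0 n : mpow n 0.
Proof. by have [] := is_ideal_exp [set` maxid R] n. Qed.

Lemma mpow_maxid n x : mpow n.+1 x -> x \in maxid R.
Proof.
suff : mpow n.+1 `<=` [set` maxid R] by apply.
apply: smallest_sub; first split=> /=; first exact: idealr0.
  by move=> a u v uI vI /=; rewrite rpredD// idealMr.
by move=> _ [y yI] [z _] <- /=; rewrite mulrC idealMr.
Qed.

Lemma coherent_subring_closed : subring_closed coherent.
Proof.
split=> [|a b /asboolP ha /asboolP hb|a b /asboolP ha /asboolP hb];
  apply/asboolP => n.
- by rewrite subrr; exact: mpow0.
- have -> : (a - b) n.+1 - (a - b) n
      = (a n.+1 - a n) + - (b n.+1 - b n).
    rewrite -[LHS]/(a n.+1 - b n.+1 - (a n - b n)) !opprB.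
    by rewrite [b n - a n]addrC addrACA [- b n.+1 + _]addrC.
  by apply: mpowD; [exact: ha|apply: mpowN; exact: hb].
- have -> : (a * b) n.+1 - (a * b) n
      = a n.+1 * (b n.+1 - b n) + b n * (a n.+1 - a n).
    by rewrite mulrBr mulrBr addrA [b n * _]mulrC subrK [b n * _]mulrC.
  by apply: mpowD; apply: mpow_mull.
Qed.
HB.instance Definition _ :=
  GRing.isSubringClosed.Build (nat -> R) coherent coherent_subring_closed.

Record coherent_seq := CoherentSeq {
  seq_val :> nat -> R; _ : seq_val \in coherent }.
HB.instance Definition _ := [isSub for seq_val].
HB.instance Definition _ := [Choice of coherent_seq by <:].
HB.instance Definition _ := [SubChoice_isSubComNzRing of coherent_seq by <:].

Lemma coherent_seqP (a : coherent_seq) n : mpow n.+1 (a n.+1 - a n).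
Proof. by case: a => a /= /asboolP; apply. Qed.

Lemma coherent_maxid (a : coherent_seq) n : (a n \in maxid R) = (a 0 \in maxid R).
Proof.
elim: n => // n <-; have h := mpow_maxid (@coherent_seqP a n).
apply/idP/idP => ha; last by rewrite -[a n.+1](subrK (a n)) rpredD.
by rewrite -[a n](subKr (a n.+1)) rpredB.
Qed.

Definition seq_maxid : {pred coherent_seq} := fun a => a 0 \in maxid R.

Lemma seq_maxid_closed : idealr_closed seq_maxid.
Proof.
split; [exact: idealr0|by apply/negP; rewrite unfold_in /= idealr1|].
move=> a u v hu hv; suff: a 0 * u 0 + v 0 \in maxid R by [].
by rewrite rpredD// idealMr.
Qed.

Lemma seq_maxid_unit (a : coherent_seq) :
  a \notin seq_maxid -> exists b, a * b = 1.
Proof.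
move=> a0; have /choice[b hb] n : exists y, a n * y = 1.
  by apply: maxid_unit; rewrite [_ \in _]coherent_maxid.
have bP : b \in coherent.
  apply/asboolP => n.
  have -> : b n.+1 - b n = - (b n.+1 * b n) * (a n.+1 - a n).
    rewrite mulNr mulrBr mulrAC [b _ * a _]mulrC hb mul1r.
    by rewrite -mulrA [b n * _]mulrC hb mulr1 opprB.
  by apply: mpow_mull; exact: coherent_seqP.
by exists (CoherentSeq bP); apply/val_inj/funext => n /=; exact: hb.
Qed.
HB.instance Definition _ :=
  isLocal.Build coherent_seq seq_maxid_closed seq_maxid_unit.

Definition null_seq : {pred coherent_seq} :=
  fun a => `[< forall n, mpow n.+1 (a n) >].

Lemma null_seq_closed : idealr_closed null_seq.
Proof.
split; first by apply/asboolP => n; exact: mpow0.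
  apply/negP => /asboolP /(_ 0) /mpow_maxid.
  by rewrite /= idealr1.
move=> a u v /asboolP hu /asboolP hv; apply/asboolP => n.
by apply: mpowD; [apply: mpow_mull; exact: hu|exact: hv].
Qed.
HB.instance Definition _ := isIdealr.Build coherent_seq null_seq null_seq_closed.

Definition completion : Type := {ideal_quot null_seq}.
HB.instance Definition _ := LocalRing.on completion.

Lemma const_coherent (x : R) : (fun=> x) \in coherent.
Proof. by apply/asboolP => n; rewrite subrr; exact: mpow0. Qed.

Definition to_completion (x : R) : completion :=
  \pi_{ideal_quot null_seq} (CoherentSeq (const_coherent x)).

Lemma to_completion_zmod : zmod_morphism to_completion.
Proof.
move=> x y; rewrite /to_completion -rmorphB; congr (\pi _).
exact/val_inj.
Qed.

Lemma to_completion_monoid : monoid_morphism to_completion.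
Proof.
split; first by rewrite /to_completion -(rmorph1 \pi_{ideal_quot null_seq});
  congr (\pi _); exact/val_inj.
move=> x y; rewrite /to_completion -rmorphM; congr (\pi _).
exact/val_inj.
Qed.

Lemma to_completion_maxid x :
  x \in maxid R -> to_completion x \in maxid completion.
Proof. by move=> xm; rewrite [_ \in _]quot_maxidE. Qed.

HB.instance Definition _ :=
  GRing.isZmodMorphism.Build R completion to_completion to_completion_zmod.
HB.instance Definition _ :=
  GRing.isMonoidMorphism.Build R completion to_completion to_completion_monoid.
HB.instance Definition _ :=
  isLocalHom.Build R completion to_completion to_completion_maxid.

End Completion.

Section ResidueMap.
Variables (A B : localRingType) (f : localHom A B).

Definition residue_map (x : residue A) : residue B := res (f (repr x)).

Lemma residue_mapE (a : A) : residue_map (res a) = res (f a).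
Proof.
apply/eqP; rewrite -subr_eq0 -!rmorphB res_eq0 local_hom_maxid//.
by rewrite -res_eq0 rmorphB subr_eq0; apply/eqP; exact: res_surj.
Qed.

Lemma residue_map_zmod : zmod_morphism residue_map.
Proof.
by move=> x y; rewrite -[x]res_surj -[y]res_surj -rmorphB !residue_mapE !rmorphB.
Qed.

Lemma residue_map_monoid : monoid_morphism residue_map.
Proof.
split; first by rewrite -(rmorph1 (@res A)) residue_mapE !rmorph1.
by move=> x y; rewrite -[x]res_surj -[y]res_surj -rmorphM !residue_mapE !rmorphM.
Qed.

HB.instance Definition _ := GRing.isZmodMorphism.Build (residue A) (residue B)
  residue_map residue_map_zmod.
HB.instance Definition _ := GRing.isMonoidMorphism.Build (residue A) (residue B)
  residue_map residue_map_monoid.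

End ResidueMap.

Definition henselian (R : localRingType) : Prop :=
  forall (f : {poly R}) (a : residue R), f \is monic ->
    root (map_poly (@res R) f) a -> ~~ root (map_poly (@res R) f)^`() a ->
    exists2 x : R, root f x & res x = a.

Definition separably_closed (K : fieldType) : Prop :=
  forall p : {poly K}, separable_poly p -> (1 < size p)%N ->
    exists x, root p x.

Definition strictly_henselian (R : localRingType) : Prop :=
  henselian R /\ separably_closed (residue R).

Definition separable_algebraic (K L : fieldType) (i : {rmorphism K -> L}) : Prop :=
  forall x : L, exists2 p : {poly K},
    separable_poly p & root (map_poly i p) x.

(* The strict henselization of A with respect to the separable closure
   [residue S] of [residue A], by its universal property. *)
Definition is_strict_henselization (A S : localRingType) (f : localHom A S) : Prop :=
  [/\ strictly_henselian S,
      separable_algebraic (residue_map f)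
    & forall (R : localRingType) (g : localHom A R)
        (alpha : {rmorphism residue S -> residue R}),
        strictly_henselian R -> alpha \o residue_map f =1 residue_map g ->
        exists h : localHom S R,
          (h \o f =1 g /\ residue_map h =1 alpha) /\
          forall h' : localHom S R,
            h' \o f =1 g -> residue_map h' =1 alpha -> h' =1 h].

Definition regular_local (A : localRingType) : Prop :=
  noetherian A /\
  exists s : seq A, [set` maxid A] = ideal_span [set` s] /\
    krull_dim A = ((size s)%:Z)%:E%E.

Definition mixed_char (A : localRingType) (p : nat) : Prop :=
  [/\ prime p, forall n, n.+1%:R != 0 :> A & p%:R \in maxid A].

Definition ramified (A : localRingType) (p : nat) : Prop :=
  ideal_exp [set` maxid A] 2 p%:R.

(* Spec(A^dagger/I A^dagger) minus its closed point is connected, where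
   A^dagger = completion S for a strict henselization S of completion A; it is
   unique up to an isomorphism over A. *)
Definition dagger_punctured_connected (A : localRingType) (I : idealr A) : Prop :=
  exists (S : localRingType) (f : localHom (completion A) S),
    is_strict_henselization f /\
    connected (@punctured_spec {ideal_quot
      (extended_ideal (@to_completion S \o (f \o @to_completion A)) I)}).

Definition SVT (A : localRingType) (I : idealr A) : Prop :=
  (cd I <= krull_dim A - 2%:E)%E <->
  ((2%:E <= krull_dim {ideal_quot I})%E /\ dagger_punctured_connected I).

(* Main.v *)
(* The ring B = A[x]/(x^2 - p) is free of rank 2 over A. Since p is part of a
   regular system of parameters of A, B is a regular local ring of the same
   dimension, and it is ramified because p = x^2; so SVT(B, IB) holds by
   assumption. Restriction of scalars and coinduction preserve injective
   resolutions, whence cd(A, I) = cd(B, IB), and dim A/I = dim B/IB by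
   integrality. It remains to compare the two connectedness conditions when
   dim A/I >= 2. By uniqueness of strict henselizations, the dagger ring T' of B
   is T[x]/(x^2 - p), where T is that of A. The map from the punctured spectrum
   of T'/IT' to that of T/IT is continuous, open, closed and surjective, and it
   is injective over V(p); so connectedness descends, and it ascends as soon as
   V(p) meets the punctured spectrum of T/IT. If V(p) did not, some power of the
   maximal ideal of A would lie in (I, p)T, hence in (I, p), which Krull's
   principal ideal theorem excludes. *)
From Stdlib Require BinNums BinInt Zbool Ring_theory Ring_polynom InitialRing.
From HB Require Import structures.
From mathcomp Require Import all_boot all_order all_algebra.
From mathcomp Require Import generic_quotient ring_quotient separable.
From mathcomp Require Import all_classical all_reals topology.
Require Import Defs.

Set Implicit Arguments.
Unset Strict Implicit.
Unset Printing Implicit Defensive.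

Import Order.TTheory GRing.Theory Num.Theory.
Local Open Scope classical_set_scope.
Local Open Scope quotient_scope.
Local Open Scope ring_scope.

Section CommutativeRingTactic.
Variable R : comNzRingType.

Let phi := InitialRing.gen_phiZ (0 : R) 1 +%R *%R -%R.

Definition cring_eval (l : seq R) (e : Ring_polynom.PExpr BinNums.Z) : R :=
  Ring_polynom.PEeval 0 1 +%R *%R (fun x y => x - y) -%R phi
    (fun n : BinNums.N => n) (Ring_theory.pow_N 1 *%R) l e.

Lemma cring_correct l e1 e2 :
  Ring_polynom.Peq Zbool.Zeq_bool
    (Ring_polynom.norm_subst BinNums.Z0 (BinNums.Zpos BinNums.xH)
       BinInt.Z.add BinInt.Z.mul BinInt.Z.sub BinInt.Z.opp Zbool.Zeq_bool
       BinInt.Z.quotrem 0 [::] e1)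
    (Ring_polynom.norm_subst BinNums.Z0 (BinNums.Zpos BinNums.xH)
       BinInt.Z.add BinInt.Z.mul BinInt.Z.sub BinInt.Z.opp Zbool.Zeq_bool
       BinInt.Z.quotrem 0 [::] e2) ->
  cring_eval l e1 = cring_eval l e2.
Proof.
have Rth : Ring_theory.ring_theory (0 : R) 1 +%R *%R (fun x y => x - y) -%R eq.
  split=> //; [exact: add0r|exact: addrC|exact: addrA|exact: mul1r|
    exact: mulrC|exact: mulrA|exact: mulrDl|exact: subrr].
have ext : Ring_theory.ring_eq_ext (+%R : R -> R -> R) *%R -%R eq.
  by split=> // ? ? -> // ? ? ->.
have st : RelationClasses.Equivalence (@eq R) := RelationClasses.eq_equivalence.
exact: (@Ring_polynom.ring_correct _ _ _ _ _ _ _ _ st ext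
  (Ring_theory.Rth_ARth st ext Rth) _ _ _ _ _ _ _ _ _
  (InitialRing.gen_phiZ_morph st ext Rth) _ _ _ (Ring_theory.pow_N_th _ _ st)
  _ (InitialRing.Ztriv_div_th st _) 0 l [::] e1 e2 I).
Qed.

End CommutativeRingTactic.

(* Atoms are compared up to conversion: morphisms may be applied through
   different coercion paths. *)
Ltac cring_conv x y :=
  match goal with
  | _ => let u := match goal with _ => unify x y end in constr:(true)
  | _ => constr:(false)
  end.

Ltac cring_mem x l :=
  lazymatch l with
  | nil => constr:(false)
  | ?y :: ?l' =>
      let b := cring_conv x y in
      lazymatch b with true => constr:(true) | false => cring_mem x l' end
  end.

Ltac cring_literal n :=
  lazymatch n with
  | 0%N => constr:(true)
  | S ?m => cring_literal m
  | _ => constr:(false)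
  end.

Ltac cring_atom t l :=
  let b := cring_mem t l in
  lazymatch b with true => l | false => constr:(t :: l) end.

Ltac cring_atoms t l :=
  lazymatch t with
  | @GRing.zero _ => l
  | @GRing.one _ => l
  | @GRing.add _ ?a ?b => let l' := cring_atoms a l in cring_atoms b l'
  | @GRing.mul _ ?a ?b => let l' := cring_atoms a l in cring_atoms b l'
  | @GRing.opp _ ?a => cring_atoms a l
  | @GRing.natmul _ ?a _ => cring_atoms a l
  | @GRing.exp _ ?a ?n =>
      let b := cring_literal n in
      lazymatch b with true => cring_atoms a l | false => cring_atom t l end
  | _ => cring_atom t l
  end.

Ltac cring_index x l :=
  lazymatch l with
  | ?y :: ?l' =>
      let b := cring_conv x y in
      lazymatch b with
      | true => constr:(BinNums.xH)
      | false => let i := cring_index x l' in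
                 let j := eval compute in (BinPos.Pos.succ i) in constr:(j)
      end
  end.

Ltac cring_reify t l :=
  lazymatch t with
  | @GRing.zero _ => constr:(Ring_polynom.PEc BinNums.Z0)
  | @GRing.one _ => constr:(Ring_polynom.PEc (BinNums.Zpos BinNums.xH))
  | @GRing.add _ ?a ?b =>
      let a' := cring_reify a l in let b' := cring_reify b l in
      constr:(Ring_polynom.PEadd a' b')
  | @GRing.mul _ ?a ?b =>
      let a' := cring_reify a l in let b' := cring_reify b l in
      constr:(Ring_polynom.PEmul a' b')
  | @GRing.opp _ ?a =>
      let a' := cring_reify a l in constr:(Ring_polynom.PEopp a')
  | @GRing.natmul _ ?a ?n =>
      let a' := cring_reify a l in
      let z := constr:(Ring_polynom.PEc BinNums.Z0) in
      eval cbv [iterop iteri] in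
        (iterop n (@Ring_polynom.PEadd BinNums.Z) a' z)
  | @GRing.exp _ ?a ?n =>
      let b := cring_literal n in
      lazymatch b with
      | true =>
          let a' := cring_reify a l in
          let u := constr:(Ring_polynom.PEc (BinNums.Zpos BinNums.xH)) in
          eval cbv [iterop iteri] in
            (iterop n (@Ring_polynom.PEmul BinNums.Z) a' u)
      | false =>
          let i := cring_index t l in constr:(Ring_polynom.PEX BinNums.Z i)
      end
  | _ => let i := cring_index t l in constr:(Ring_polynom.PEX BinNums.Z i)
  end.

Ltac ring :=
  lazymatch goal with
  | |- @eq ?T ?a ?b =>
      let l0 := cring_atoms a (@nil T) in
      let l := cring_atoms b l0 in
      let ea := cring_reify a l in
      let eb := cring_reify b l in
      let H := fresh in
      have H := @cring_correct _ l ea eb isT;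
      cbv [cring_eval Ring_polynom.PEeval BinList.nth BinList.jump
           InitialRing.gen_phiZ InitialRing.gen_phiPOS List.tl List.hd List.nth] in H;
      exact H
  end.


(** * Ideals and prime spectra *)

Section IdealTheory.
Variable R : comNzRingType.
Implicit Types (I J K S : set R) (s : seq R).

Section Closure.
Variables (J : set R) (hJ : is_ideal J).

Lemma ideal_0 : J 0. Proof. by case: hJ. Qed.

Lemma ideal_D x y : J x -> J y -> J (x + y).
Proof. by case: hJ => _ h Jx Jy; rewrite -[x]mul1r; apply: h. Qed.

Lemma ideal_Ml a x : J x -> J (a * x).
Proof. by case: hJ => h0 h Jx; rewrite -[_ * _]addr0; apply: h. Qed.

Lemma ideal_Mr a x : J x -> J (x * a).
Proof. by rewrite mulrC; apply: ideal_Ml. Qed.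

Lemma ideal_N x : J x -> J (- x).
Proof. by rewrite -mulN1r; apply: ideal_Ml. Qed.

Lemma ideal_B x y : J x -> J y -> J (x - y).
Proof. by move=> Jx Jy; apply: ideal_D => //; apply: ideal_N. Qed.

Lemma ideal_sum (T : Type) (r : seq T) (P : pred T) (F : T -> R) :
  (forall i, P i -> J (F i)) -> J (\sum_(i <- r | P i) F i).
Proof. by move=> h; elim/big_rec: _ => [|i x Pi]; [exact: ideal_0|apply: ideal_D;
  apply: h]. Qed.

Lemma ideal_subl x y : J (x - y) -> J y -> J x.
Proof. by move=> h /(ideal_D h); rewrite subrK. Qed.

End Closure.

Lemma is_ideal_idealr (I : idealr R) : is_ideal [set` I].
Proof.
split=> /=; first exact: idealr0.
by move=> a u v uI vI /=; rewrite rpredD// idealMr.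
Qed.

Definition ideal_add J K : set R := [set x | exists2 y, J y & K (x - y)].

Lemma is_ideal_add J K : is_ideal J -> is_ideal K -> is_ideal (ideal_add J K).
Proof.
move=> hJ hK; split=> [|a u v [y Jy Ky] [z Jz Kz]].
  by exists 0; rewrite ?subr0; apply: ideal_0.
exists (a * y + z); first by apply: ideal_D => //; apply: ideal_Ml.
have -> : a * u + v - (a * y + z) = a * (u - y) + (v - z) by ring.
by apply: ideal_D => //; apply: ideal_Ml.
Qed.

Lemma ideal_addl J K : is_ideal K -> J `<=` ideal_add J K.
Proof. by move=> hK x Jx; exists x => //; rewrite subrr; apply: ideal_0. Qed.

Lemma ideal_addr J K : is_ideal J -> K `<=` ideal_add J K.
Proof. by move=> hJ x Kx; exists 0; rewrite ?subr0//; apply: ideal_0. Qed.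

Lemma ideal_add_min J K L : is_ideal L -> J `<=` L -> K `<=` L ->
  ideal_add J K `<=` L.
Proof.
by move=> hL JL KL x [y /JL Ly /KL Lxy]; apply: (ideal_subl hL Lxy).
Qed.

Definition principal (a : R) : set R := [set a * b | b in setT].

Lemma is_ideal_principal a : is_ideal (principal a).
Proof.
split=> [|c u v [b _ <-] [d _ <-]]; first by exists 0; rewrite ?mulr0.
by exists (c * b + d) => //; ring.
Qed.

Lemma mem_principal a : principal a a. Proof. by exists 1; rewrite ?mulr1. Qed.

Lemma principal_sub a J : is_ideal J -> J a -> principal a `<=` J.
Proof. by move=> hJ Ja _ [b _ <-]; apply: ideal_Mr. Qed.

Lemma sub_ideal_span S : S `<=` ideal_span S.
Proof. exact: sub_smallest. Qed.

Lemma ideal_span_min S J : is_ideal J -> S `<=` J -> ideal_span S `<=` J.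
Proof. by move=> hJ SJ; apply: smallest_sub. Qed.

Lemma ideal_span_mono S T : S `<=` T -> ideal_span S `<=` ideal_span T.
Proof.
move=> ST; apply: ideal_span_min; first exact: is_ideal_span.
by apply: subset_trans ST _; exact: sub_ideal_span.
Qed.

Lemma is_ideal_mul I J : is_ideal (ideal_mul I J).
Proof. exact: is_ideal_span. Qed.

Lemma ideal_mul_in I J x y : I x -> J y -> ideal_mul I J (x * y).
Proof. by move=> Ix Jy; apply: sub_ideal_span; exists x => //; exists y. Qed.

Lemma ideal_mul_min I J K : is_ideal K ->
  (forall x y, I x -> J y -> K (x * y)) -> ideal_mul I J `<=` K.
Proof. by move=> hK h; apply: ideal_span_min => // _ [x Ix [y Jy <-]]; apply: h. Qed.

Lemma is_ideal_colon J a : is_ideal J -> is_ideal [set b | J (a * b)].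
Proof.
move=> hJ; split=> /= [|c u v Ju Jv]; first by rewrite mulr0; apply: ideal_0.
by rewrite mulrDr mulrCA; apply: ideal_D => //; apply: ideal_Ml.
Qed.

Lemma is_ideal_colonr J a : is_ideal J -> is_ideal [set b | J (b * a)].
Proof.
move=> /(@is_ideal_colon _ a); congr is_ideal.
by apply/seteqP; split=> b /=; rewrite mulrC.
Qed.

Lemma ideal_expD I j k :
  ideal_exp I (j + k) `<=` ideal_mul (ideal_exp I j) (ideal_exp I k).
Proof.
elim: j => [|j IHj] x; first by rewrite add0n -{2}[x]mul1r => h;
  apply: (ideal_mul_in Logic.I h).
rewrite addSn /=; apply: ideal_mul_min; first exact: is_ideal_mul.
move=> a b Ia /IHj; move: b.
apply: ideal_mul_min; first exact: (is_ideal_colon _ (is_ideal_mul _ _)).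
by move=> c d hc hd /=; rewrite mulrA; apply: ideal_mul_in => //; apply: ideal_mul_in.
Qed.

Lemma ideal_exp_le I j k : (j <= k)%N -> ideal_exp I k `<=` ideal_exp I j.
Proof.
move=> /subnKC <- x /ideal_expD; apply: ideal_mul_min; first exact: is_ideal_exp.
by move=> a b ha _; apply: ideal_Mr => //; apply: is_ideal_exp.
Qed.

Lemma ideal_exp1 I : is_ideal I -> ideal_exp I 1 = I.
Proof.
move=> hI; apply/seteqP; split=> x; last first.
  by move=> Ix; rewrite -[x]mulr1; apply: ideal_mul_in.
by apply: ideal_mul_min => // a b Ia _; apply: ideal_Mr.
Qed.

Lemma ideal_expX I n x : I x -> ideal_exp I n (x ^+ n).
Proof. by move=> Ix; elim: n => // n IHn; rewrite exprS; apply: ideal_mul_in. Qed.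

Definition lincomb (c : nat -> R) s := \sum_(i < size s) c i * s`_i.

Lemma ideal_span_seq s x :
  ideal_span [set` s] x <-> exists c, x = lincomb c s.
Proof.
split; last first.
  case=> c ->; apply: (ideal_sum (is_ideal_span _)) => i _.
  apply: (ideal_Ml (is_ideal_span _)).
  by apply: sub_ideal_span => /=; apply: mem_nth.
move: x; apply: (@ideal_span_min _ [set x | exists c, x = lincomb c s]).
  split=> [|a u v [c ->] [d ->]] /=.
    by exists (fun=> 0); rewrite /lincomb big1// => i _; rewrite mul0r.
  exists (fun i => a * c i + d i); rewrite /lincomb mulr_sumr -big_split /=.
  by apply: eq_bigr => i _; ring.
move=> x /= xs; exists (fun i => (i == index x s)%:R); rewrite /lincomb.
rewrite (bigD1 (Ordinal (eq_ind_r is_true xs (index_mem x s))))//= eqxx mul1r.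
rewrite nth_index// big1 ?addr0// => i ni.
by rewrite [_ == _ :> nat](_ : _ = false) ?mul0r//; apply: contraNF ni => /eqP h;
  apply/eqP/val_inj.
Qed.

Lemma ideal_mul_seq I s x : is_ideal I -> ideal_mul I (ideal_span [set` s]) x ->
  exists2 c, (forall i, I (c i)) & x = lincomb c s.
Proof.
move=> hI; move: x.
apply: (@ideal_mul_min _ _ [set x | exists2 c, (forall i, I (c i)) & x = lincomb c s]).
  split=> [|a u v [c hc ->] [d hd ->]] /=.
    exists (fun=> 0); first by move=> i; apply: ideal_0.
    by rewrite /lincomb big1// => i _; rewrite mul0r.
  exists (fun i => a * c i + d i).
    by move=> i; apply: ideal_D => //; apply: ideal_Ml.
  rewrite /lincomb mulr_sumr -big_split /=.
  by apply: eq_bigr => i _; ring.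
move=> a y Ia /ideal_span_seq[c ->]; exists (fun i => a * c i) => [i|].
  exact: ideal_Mr.
by rewrite /lincomb mulr_sumr; apply: eq_bigr => i _; rewrite mulrA.
Qed.

Definition ipred (J : set R) (hJ : is_ideal J) (n1 : ~ J 1) : {pred R} :=
  fun x => `[< J x >].

Lemma ipred_closed J hJ n1 : idealr_closed (@ipred J hJ n1).
Proof.
split; first by apply/asboolP; exact: ideal_0.
  by apply/negP => /asboolP.
move=> a u v /asboolP hu /asboolP hv; apply/asboolP.
by apply: ideal_D => //; apply: ideal_Ml.
Qed.

HB.instance Definition _ J hJ n1 :=
  isIdealr.Build R (@ipred J hJ n1) (@ipred_closed J hJ n1).

Lemma ipredE J hJ n1 : [set` @ipred J hJ n1] = J.
Proof. by apply/seteqP; split=> x /= => [/asboolP|?]//; apply/asboolP. Qed.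

Definition is_prime J : Prop :=
  [/\ is_ideal J, ~ J 1 & forall x y, J (x * y) -> J x \/ J y].

Definition ppred J (hJ : is_prime J) : {pred R} := fun x => `[< J x >].

Lemma ppred_closed J hJ : idealr_closed (@ppred J hJ).
Proof. have [h0 h1 _] := hJ; exact: (@ipred_closed J h0 h1). Qed.

HB.instance Definition _ J hJ :=
  isIdealr.Build R (@ppred J hJ) (@ppred_closed J hJ).

Lemma ppred_prime J hJ : prime_idealr_closed (@ppred J hJ).
Proof.
have [_ _ h] := hJ; move=> u v /asboolP/h [] h'; apply/orP; [left|right];
  exact/asboolP.
Qed.

HB.instance Definition _ J hJ :=
  isPrimeIdealrClosed.Build R (@ppred J hJ) (@ppred_prime J hJ).

Definition mkspec J (hJ : is_prime J) : spec R := @ppred J hJ.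

Lemma mkspecE J (hJ : is_prime J) : [set` mkspec hJ] = J.
Proof. by apply/seteqP; split=> x /= => [/asboolP|?]//; apply/asboolP. Qed.

Lemma mem_mkspec J (hJ : is_prime J) x : (x \in mkspec hJ) <-> J x.
Proof. by rewrite -[in X in _ <-> X](mkspecE hJ). Qed.

Lemma is_prime_spec (p : spec R) : is_prime [set` p].
Proof.
split; [exact: is_ideal_idealr|by rewrite /= idealr1|].
by move=> x y /=; rewrite prime_idealrM => /orP.
Qed.

Lemma exists_prime_avoiding J (M : set R) :
  is_ideal J -> M 1 -> (forall x y, M x -> M y -> M (x * y)) ->
  (forall x, J x -> ~ M x) ->
  exists q : spec R, J `<=` [set` q] /\ forall x, x \in q -> ~ M x.
Proof.
move=> hJ M1 MM JM.
pose P K := is_ideal (J `|` K) /\ forall x, (J `|` K) x -> ~ M x.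
have [|Q [[hQ QM] Qmax]] := @Zorn_bigcup R P.
  move=> F FP Ftot.
  have chain x y : (J `|` \bigcup_(X in F) X) x -> (J `|` \bigcup_(X in F) X) y ->
      exists2 K, K = set0 \/ F K & (J `|` K) x /\ (J `|` K) y.
    case=> [Jx|[X FX Xx]] [Jy|[Y FY Yy]].
    - by exists set0; [left|split; left].
    - by exists Y; [right|split; [left|right]].
    - by exists X; [right|split; [right|left]].
    - have [XY|YX] := Ftot _ _ FX FY.
        by exists Y; [right|split; right=> //; apply: XY].
      by exists X; [right|split; right=> //; apply: YX].
  have sub K : K = set0 \/ F K -> J `|` K `<=` J `|` \bigcup_(X in F) X.
    by case=> [->|FK]; apply: setUS => // x Kx; exists K.
  have PK K : K = set0 \/ F K -> P K.
    by case=> [->|/FP//]; rewrite /P setU0.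
  split; first split=> [|a u v hu hv]; first by left; apply: ideal_0.
    have [K FK [Ku Kv]] := chain _ _ hu hv.
    by apply: (sub K FK); apply: ideal_D; [case: (PK K FK)..|apply: ideal_Ml => //;
      case: (PK K FK)|].
  move=> x hx; have [K FK [Kx _]] := chain _ _ hx hx.
  by case: (PK K FK) => _; apply.
have hp : is_prime (J `|` Q).
  split=> //; first by move=> /QM.
  move=> x y Qxy; apply: contrapT => /not_orP[nx ny].
  have big z : ~ (J `|` Q) z -> exists2 w, M w & exists2 a, (J `|` Q) a & exists b,
    w = a + b * z.
    move=> nz; apply: contrapT => h.
    pose K := ideal_add (J `|` Q) (principal z).
    have hK : is_ideal K by apply: is_ideal_add => //; apply: is_ideal_principal.
    have QK : J `|` Q `<=` K by apply: ideal_addl; apply: is_ideal_principal.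
    have JKK : J `|` K = K by apply/setUidPr => w Jw; apply: QK; left.
    apply: (Qmax K).
      split=> [w Qw|KQ]; first by apply: QK; right.
      by apply: nz; right; apply: KQ; apply: ideal_addr => //; apply: mem_principal.
    rewrite /P JKK; split=> // w [a Qa [b _ /= hb]] Mw; apply: h; exists w => //.
    by exists a => //; exists b; rewrite mulrC hb; ring.
  have [w Mw [a Qa [b wE]]] := big _ nx; have [w' Mw' [a' Qa' [b' wE']]] := big _ ny.
  apply: (QM (w * w')); last exact: MM.
  have -> : w * w' = (a' + b' * y) * a + b * x * a' + b * b' * (x * y).
    by rewrite wE wE'; ring.
  by repeat (apply: ideal_D => //); apply: ideal_Ml.
exists (mkspec hp); split=> [x Jx|x /mem_mkspec]; last exact: QM.
by apply/mem_mkspec; left.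
Qed.

Lemma spec_eq (p q : spec R) : [set` p] = [set` q] -> p = q.
Proof.
move=> pq.
have {}pq : (p : R -> bool) = q.
  by apply/funext => x; apply/idP/idP => h; [have : [set` p] x by [];
    rewrite pq|have : [set` q] x by []; rewrite -pq].
case: p q pq => [p cp] [q cq] /= pq; case: _ / pq in cq *; congr PrimeIdealr.Pack.
case: cp => [[p1] [p2] [p3] [p4]]; case: cq => [[q1] [q2] [q3] [q4]].
by rewrite (Prop_irrelevance p1 q1) (Prop_irrelevance p2 q2)
  (Prop_irrelevance p3 q3) (Prop_irrelevance p4 q4).
Qed.

End IdealTheory.

(** * Quadratic extensions *)

Ltac ideal_tac h := repeat first
  [done | apply: (ideal_D h) | apply: (ideal_B h) | apply: (ideal_Ml h)].

Section QuotientLift.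
Variables (R Z : comNzRingType) (I : idealr R) (g : {rmorphism R -> Z}).
Hypothesis gI : forall x, x \in I -> g x = 0.

Definition quot_lift (x : {ideal_quot I}) : Z := g (repr x).

Lemma quot_eqP (x y : R) :
  \pi_{ideal_quot I} x = \pi_{ideal_quot I} y <-> x - y \in I.
Proof. by rewrite Quotient.idealrBE; split=> [->|/eqP]. Qed.

Lemma quot_liftE x : quot_lift (\pi x) = g x.
Proof.
apply/eqP; rewrite -subr_eq0 -rmorphB; apply/eqP; apply: gI.
by apply/quot_eqP; rewrite reprK.
Qed.

Lemma quot_lift_zmod : zmod_morphism quot_lift.
Proof.
by move=> x y; rewrite -[x]reprK -[y]reprK -rmorphB !quot_liftE rmorphB.
Qed.

Lemma quot_lift_monoid : monoid_morphism quot_lift.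
Proof.
split; first by rewrite -(rmorph1 (\pi_{ideal_quot I} : R -> _)) quot_liftE rmorph1.
by move=> x y; rewrite -[x]reprK -[y]reprK -rmorphM !quot_liftE rmorphM.
Qed.

HB.instance Definition _ :=
  GRing.isZmodMorphism.Build {ideal_quot I} Z quot_lift quot_lift_zmod.
HB.instance Definition _ :=
  GRing.isMonoidMorphism.Build {ideal_quot I} Z quot_lift quot_lift_monoid.

Definition quot_liftr : {rmorphism {ideal_quot I} -> Z} := quot_lift.

End QuotientLift.

Section SpecMap.
Variables (R Z : comNzRingType) (g : {rmorphism R -> Z}).

Lemma is_ideal_preim (J : set Z) : is_ideal J -> is_ideal (g @^-1` J).
Proof.
move=> hJ; split=> /= [|a u v hu hv]; first by rewrite rmorph0; apply: ideal_0.
by rewrite rmorphD rmorphM; apply: ideal_D => //; apply: ideal_Ml.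
Qed.

Lemma is_prime_preim (q : spec Z) : is_prime (g @^-1` [set` q]).
Proof.
have [h0 h1 h2] := is_prime_spec q; split; first exact: is_ideal_preim.
  by rewrite /preimage /= rmorph1.
by move=> x y /=; rewrite rmorphM => /h2.
Qed.

Definition spec_map (q : spec Z) : spec R := mkspec (is_prime_preim q).

Lemma mem_spec_map q x : (x \in spec_map q) = (g x \in q).
Proof. by apply/idP/idP => [/mem_mkspec|] //; move=> h; apply/mem_mkspec. Qed.

Lemma spec_map_continuous : continuous spec_map.
Proof.
apply/continuousP => U [S ->]; exists (g @` S).
apply/seteqP; split=> q /= nS h; apply: nS => x.
  by move=> Sx /=; rewrite mem_spec_map; apply: h; exists x.
by case=> y Sy <- /=; rewrite -mem_spec_map; apply: h.
Qed.

Lemma span_image (S : set R) x : ideal_span S x -> ideal_span (g @` S) (g x).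
Proof.
move: x; apply: ideal_span_min; first exact/is_ideal_preim/is_ideal_span.
by move=> x Sx /=; apply: sub_ideal_span; exists x.
Qed.

Lemma exp_image (J : set R) (K : set Z) n x : (forall x, J x -> K (g x)) ->
  ideal_exp J n x -> ideal_exp K n (g x).
Proof.
move=> JK; elim: n x => [//|n IHn] /=; apply: ideal_mul_min.
  exact: (is_ideal_preim (is_ideal_mul _ _)).
by move=> a b Ja hb /=; rewrite rmorphM; apply: ideal_mul_in; [exact: JK|exact: IHn].
Qed.

End SpecMap.

Section KrullDim.

Lemma supremum_ge2 (S : set nat) :
  (2%:E <= supremum -oo [set (i%:Z)%:E | i in S] :> \bar int)%E ->
  exists2 n, S n & (2 <= n)%N.
Proof.
move=> h; apply: contrapT => h1.
have {}h1 n : S n -> (n < 2)%N.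
  by move=> Sn; rewrite ltnNge; apply/negP => n2; apply: h1; exists n.
case: (eqVneq [set (i%:Z)%:E%E | i in S] set0) h => [->|S0].
  by rewrite supremum0.
have [n [Sn nmax]] : exists n, S n /\ forall m, S m -> (m <= n)%N.
  have [S1|S1] := pselect (S 1%N).
    by exists 1%N; split => // m /h1.
  have /set0P[_ [m Sm _]] := S0; exists m; split=> // k Sk.
  have := h1 _ Sm; have := h1 _ Sk; have : k != 1%N by apply: contra_notN S1 => /eqP <-.
  by case: k Sk => [|[|]].
rewrite /supremum (negbTE S0); case: xgetP => [y _ [_ ylb]|_ //].
have /ylb : ubound [set (i%:Z)%:E%E | i in S] (n%:Z)%:E%E.
  by move=> _ [m Sm <-]; rewrite lee_fin lez_nat nmax.
move=> yn /le_trans/(_ yn); rewrite lee_fin lez_nat leqNgt.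
by rewrite h1.
Qed.

End KrullDim.

Section QuadExt.
Variables (R Z : comNzRingType) (f : {rmorphism R -> Z}) (r : R) (x : Z).

Definition quad_ext : Prop :=
  [/\ x ^+ 2 = f r, (forall y, exists a b, y = f a + f b * x)
    & forall a b, f a + f b * x = 0 -> a = 0 /\ b = 0].

Hypothesis fx : quad_ext.

Let x2 : x * x = f r. Proof. by case: fx. Qed.
Let gen y : exists a b, y = f a + f b * x. Proof. by case: fx. Qed.
Let free a b : f a + f b * x = 0 -> a = 0 /\ b = 0. Proof. by case: fx => _ _; apply. Qed.

Let freeE a b c d : f a + f b * x = f c + f d * x -> a = c /\ b = d.
Proof.
move=> e; have [] := @free (a - c) (b - d).
  by rewrite !rmorphB; move/eqP: e; rewrite -subr_eq0 => /eqP <-; ring.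
by move=> /eqP + /eqP; rewrite !subr_eq0 => /eqP + /eqP.
Qed.

Lemma quad_inj a : f a = 0 -> a = 0.
Proof. by move=> fa0; have [] := @free a 0; rewrite // fa0 rmorph0 mul0r addr0. Qed.

Definition qext (J : set R) : set Z :=
  [set y | exists a b, [/\ J a, J b & y = f a + f b * x]].

Lemma qextE (J : set R) a b : qext J (f a + f b * x) <-> J a /\ J b.
Proof. by split=> [[c [d [Jc Jd /freeE[-> ->]]]]|[]] //; exists a, b. Qed.

Lemma is_ideal_qext J : is_ideal J -> is_ideal (qext J).
Proof.
move=> hJ; split=> [|y _ _ [a [b [Ja Jb ->]]] [c [d [Jc Jd ->]]]].
  by exists 0, 0; rewrite !rmorph0 mul0r addr0; split=> //; apply: ideal_0.
have [s [t ->]] := gen y; exists (s * a + r * (t * b) + c), (s * b + t * a + d).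
split; [by ideal_tac hJ|by ideal_tac hJ|].
by rewrite !rmorphD !rmorphM -x2; ring.
Qed.

Lemma qext_sub J : is_ideal J -> forall a, J a -> qext J (f a).
Proof.
move=> hJ a Ja; exists a, 0; rewrite rmorph0 mul0r addr0.
by split=> //; apply: ideal_0.
Qed.

Lemma qext_span J : is_ideal J -> qext J = ideal_span (f @` J).
Proof.
move=> hJ; apply/seteqP; split; last first.
  apply: ideal_span_min; first exact: is_ideal_qext.
  by move=> _ [a Ja <-]; apply: qext_sub.
move=> _ [a [b [Ja Jb ->]]]; have hs := is_ideal_span (f @` J).
apply: (ideal_D hs); first by apply: sub_ideal_span; exists a.
by apply: (ideal_Mr hs); apply: sub_ideal_span; exists b.
Qed.

Let normE a b : (f a + f b * x) * (f a - f b * x) = f (a ^+ 2 - r * b ^+ 2).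
Proof. by rewrite rmorphB rmorphXn rmorphM rmorphXn -x2; ring. Qed.

Lemma quad_going_up (J : set Z) (p : spec R) : is_ideal J ->
  f @^-1` J `<=` [set` p] ->
  exists q : spec Z, J `<=` [set` q] /\ spec_map f q = p.
Proof.
move=> hJ Jp; have [hp p1 pM] := is_prime_spec p.
have hpe := is_ideal_qext hp.
have [||||q [Jq qM]] := @exists_prime_avoiding _ (ideal_add J (qext [set` p]))
    (f @` [set a | a \notin p]).
- exact: is_ideal_add.
- by exists 1; rewrite ?rmorph1//= idealr1.
- move=> _ _ [a ap <-] [b bp <-]; exists (a * b); last exact: rmorphM.
  by rewrite /= prime_idealrM negb_or; apply/andP.
- move=> w [y Jy [a [b [pa pb e]]]] [c cp cE]; rewrite -{w}cE in e *.
  have hy : y = f (c - a) - f b * x.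
    by rewrite rmorphB -(subKr (f c) y) e; ring.
  have : [set` p] ((c - a) ^+ 2 - r * b ^+ 2).
    apply: Jp => /=; rewrite -normE -hy; exact: ideal_Ml.
  move=> h; have : [set` p] (c * c).
    apply: (ideal_subl hp (y := c * c - ((c - a) ^+ 2 - r * b ^+ 2))).
      by rewrite subKr.
    have -> : c * c - ((c - a) ^+ 2 - r * b ^+ 2) = (c *+ 2 - a) * a + r * b * b by ring.
    by apply: (ideal_D hp); apply: (ideal_Ml hp).
  by move=> /pM[] /=; apply/negP.
exists q; split; first by move=> y Jy; apply: Jq; apply: ideal_addl.
apply: spec_eq; apply/seteqP; split=> a /=; rewrite mem_spec_map.
  by apply: contraTT => ap; apply/negP => aq; apply: (qM _ aq); exists a.
by move=> pa; apply: Jq; apply: ideal_addr => //; apply: qext_sub.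
Qed.

Lemma quad_lying_over (p : spec R) : exists q : spec Z, spec_map f q = p.
Proof.
have [||q [_ qp]] := @quad_going_up [set 0] p; last by exists q.
  by split=> // a u v -> ->; rewrite mulr0 addr0.
by move=> a /= /quad_inj ->; apply: idealr0.
Qed.

Lemma quad_incomparable (q q' : spec Z) :
  [set` q] `<=` [set` q'] -> spec_map f q = spec_map f q' -> q = q'.
Proof.
move=> qq' e; apply: spec_eq; apply/seteqP; split=> // y q'y.
have [hq q1 qM] := is_prime_spec q; have [hq' q1' qM'] := is_prime_spec q'.
have E a : [set` q] (f a) <-> [set` q'] (f a) by rewrite /= -!mem_spec_map e.
have [a [b yE]] := gen y.
have : [set` q] (y * (f a - f b * x)).
  by rewrite yE normE; apply/E; rewrite -normE -yE; apply: ideal_Mr.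
case/qM => // qy'; have q'y' := qq' _ qy'.
have : [set` q'] (f (2%:R * a)).
  have -> : f (2%:R * a) = y + (f a - f b * x) by rewrite yE rmorphM rmorph_nat; ring.
  exact: ideal_D.
move=> /E; rewrite rmorphM rmorph_nat => /qM[q2|qa].
  have -> : y = 2%:R * f a - (f a - f b * x) by rewrite yE; ring.
  by apply: ideal_B => //; apply: ideal_Mr.
have -> : y = 2%:R * f a - (f a - f b * x) by rewrite yE; ring.
by apply: ideal_B => //; apply: ideal_Ml.
Qed.

Lemma quad_krull_dim : krull_dim Z = krull_dim R.
Proof.
rewrite /krull_dim; congr (supremum _ [set _ | i in _]).
apply/seteqP; split=> n [p hp].
  exists (spec_map f \o p) => i /hp [pi npi]; split=> [a /=|h].
    by rewrite !mem_spec_map => /pi.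
  have e : spec_map f (p i) = spec_map f (p i.+1).
    apply: spec_eq; apply/seteqP; split=> // a /=.
    by rewrite !mem_spec_map; apply: pi.
  by apply: npi; rewrite (quad_incomparable pi e).
have /choice[nx hnx] (z : nat * spec Z) : exists q : spec Z, (z.1 < n)%N ->
    spec_map f z.2 = p z.1 -> [set` z.2] `<=` [set` q] /\ spec_map f q = p z.1.+1.
  case: z => i q0 /=; case: (pselect (i < n)%N) => [lin|]; last by exists q0.
  case: (pselect (spec_map f q0 = p i)) => [e|]; last by exists q0.
  have [||q hq] := @quad_going_up [set` q0] (p i.+1); last by exists q.
    exact: is_ideal_idealr.
  by move=> a /= aq; case: (hp _ lin) => h _; apply: h; rewrite -e /= mem_spec_map.
have [q0 q0E] := quad_lying_over (p 0%N).
pose q := fix q i := if i is j.+1 then nx (j, q j) else q0.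
have qE i : (i <= n)%N -> spec_map f (q i) = p i.
  elim: i => // i IHi lin; have := hnx (i, q i) lin; rewrite /= => h.
  by case: h => //; apply: IHi; apply: ltnW.
exists q => i lin; have [qq qe] := hnx (i, q i) lin (qE _ (ltnW lin)).
split=> // h; have [_ np] := hp _ lin; apply: np => a /=.
by rewrite -!qE// ?mem_spec_map; [apply: h|apply: ltnW].
Qed.

(* 2 a and a ^ 2 - r b ^ 2 are the trace and the norm of f a + f b x. *)
Lemma quad_avoid (p : spec R) a b :
  (exists2 q, spec_map f q = p & f a + f b * x \notin q) <->
  (2%:R * a \notin p) \/ (a ^+ 2 - r * b ^+ 2 \notin p).
Proof.
have [hp p1 pM] := is_prime_spec p; set y := f a + f b * x.
have y2 : y * y = f (2%:R * a) * y - f (a ^+ 2 - r * b ^+ 2).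
  by rewrite -normE -/y rmorphM rmorph_nat /y; ring.
split=> [[q qp yq]|h].
  apply/orP; rewrite -negb_and; apply: contra yq => /andP[tp np].
  have : y * y \in q.
    by rewrite y2; apply: rpredB; rewrite ?[_ * y]mulrC ?idealMr -?mem_spec_map ?qp.
  by rewrite prime_idealrM orbb.
have hpe := is_ideal_qext hp.
have [|||q [Jq qM]] := @exists_prime_avoiding _ (qext [set` p])
    [set z | exists c n, c \notin p /\ z = f c * y ^+ n] hpe.
- by exists 1, 0%N; rewrite idealr1 rmorph1 mulr1.
- move=> _ _ [c [n [pc ->]]] [d [m [pd ->]]]; exists (c * d), (n + m)%N.
  rewrite prime_idealrM negb_or pc pd; split=> //.
  by rewrite rmorphM exprD mulrACA.
- move=> _ /[swap] -[c [n [pc ->]]] h1.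
  have hN : a ^+ 2 - r * b ^+ 2 \in p.
    have key : [set` p] (c ^+ 2 * (a ^+ 2 - r * b ^+ 2) ^+ n).
      case: h1 => s [t [ps pt e]].
      have [z1 [z2 z12]] : exists z1 z2, f c * (f a - f b * x) ^+ n = f z1 - f z2 * x /\
          f c * y ^+ n = f z1 + f z2 * x.
        rewrite /y; elim: (n) => [|k [z1 [z2 [IH1 IH2]]]].
          by exists c, 0; rewrite rmorph0 !expr0 mul0r subr0 addr0 mulr1.
        exists (z1 * a + r * z2 * b), (z1 * b + z2 * a).
        rewrite !exprSr !mulrA IH1 IH2 !rmorphD !rmorphM -x2; split; ring.
      have [z1s z2t] : z1 = s /\ z2 = t by apply: freeE; rewrite -(proj2 z12).
      suff -> : c ^+ 2 * (a ^+ 2 - r * b ^+ 2) ^+ n = s * s - r * t * t.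
        by apply: (ideal_B hp); apply: (ideal_Ml hp).
      apply/eqP; rewrite -subr_eq0; apply/eqP; apply: quad_inj.
      rewrite rmorphB rmorphM !rmorphXn -normE exprMn -/y.
      have -> : f c ^+ 2 * (y ^+ n * (f a - f b * x) ^+ n) =
         (f c * y ^+ n) * (f c * (f a - f b * x) ^+ n) by ring.
      by case: z12 => -> ->; rewrite z1s z2t rmorphB !rmorphM -x2; ring.
    have [/pM|] := pM _ _ key; first by rewrite /= (negbTE pc) => -[].
    elim: (n) => [|k IHk]; first by rewrite expr0 => /p1.
    by rewrite exprS => /pM[].
  have hT : 2%:R * a \notin p by case: h => //; rewrite hN.
  have hyn k : qext [set` p] (y ^+ k.+1 - f (2%:R * a) ^+ k * y).
    elim: k => [|k IHk]; first by rewrite mul1r subrr; apply: ideal_0.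
    have -> : y ^+ k.+2 - f (2%:R * a) ^+ k.+1 * y =
       y * (y ^+ k.+1 - f (2%:R * a) ^+ k * y)
       - f (2%:R * a) ^+ k * f (a ^+ 2 - r * b ^+ 2).
      by rewrite [y ^+ k.+2]exprS [f (2%:R * a)
        ^+ k.+1]exprSr -[f (a ^+ 2 - _)](subKr (f (2%:R * a) * y)) -y2; ring.
    apply: (ideal_B hpe); apply: (ideal_Ml hpe) => //.
    exact: qext_sub.
  have : qext [set` p] (f c * (f (2%:R * a) ^+ n * y)).
    have -> : f c * (f (2%:R * a) ^+ n * y) =
        f c * y ^+ n * y - f c * (y ^+ n.+1 - f (2%:R * a) ^+ n * y).
      by rewrite exprSr; ring.
    by apply: (ideal_B hpe); [apply: (ideal_Mr hpe)|apply: (ideal_Ml hpe)].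
  have -> : f c * (f (2%:R * a) ^+ n * y) =
     f (c * (2%:R * a) ^+ n * a) + f (c * (2%:R * a) ^+ n * b) * x.
    by rewrite !rmorphM !rmorphXn !rmorphM /y; ring.
  case/qextE => /pM[] h2 _; last first.
    by move: hT; rewrite -/([set` p] _); apply/negP; rewrite negbK; apply: (ideal_Ml hp).
  case/pM: h2 => [|h2]; first by apply/negP.
  move: h2; elim: (n) => [|k IHk]; first by rewrite expr0 => /p1.
  by rewrite exprS => /pM[]//; apply/negP.
exists q; last by apply/negP => /qM; apply; exists 1, 1%N; rewrite idealr1 rmorph1 mul1r.
apply: spec_eq; apply/seteqP; split=> c /=; rewrite mem_spec_map.
  by apply: contraTT => cp; apply/negP => /qM; apply; exists c, 0%N; rewrite mulr1.
by move=> pc; apply: Jq; apply: qext_sub.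
Qed.

End QuadExt.

Section QuadQuotient.
Variables (R Z : comNzRingType) (f : {rmorphism R -> Z}) (r : R) (x : Z).
Variables (I : idealr R) (K : idealr Z).
Hypotheses (fx : quad_ext f r x) (KE : [set` K] = qext f x [set` I]).

Let piK : {rmorphism Z -> {ideal_quot K}} := \pi_{ideal_quot K}.

Lemma quad_quot_sub a : a \in I -> (piK \o f) a = 0.
Proof.
move=> aI /=; rewrite -(rmorph0 piK); apply/quot_eqP; rewrite subr0.
have : [set` K] (f a) by rewrite KE; apply: qext_sub => //; apply: is_ideal_idealr.
by [].
Qed.

Definition quad_quot : {rmorphism {ideal_quot I} -> {ideal_quot K}} :=
  quot_liftr quad_quot_sub.

Lemma quad_quotE a : quad_quot (\pi a) = piK (f a).
Proof. exact: (quot_liftE quad_quot_sub). Qed.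

Lemma quad_ext_quot : quad_ext quad_quot (\pi r) (piK x).
Proof.
have [x2 gen free] := fx; split.
- by rewrite -rmorphXn x2 quad_quotE.
- move=> y; rewrite -[y]reprK; have [a [b ->]] := gen (repr y).
  by exists (\pi a), (\pi b); rewrite !quad_quotE -rmorphM -rmorphD.
- move=> a b; rewrite -[a]reprK -[b]reprK !quad_quotE -rmorphM -rmorphD.
  rewrite -(rmorph0 piK) => /quot_eqP; rewrite subr0 => h.
  have : qext f x [set` I] (f (repr a) + f (repr b) * x) by rewrite -KE.
  move=> /(qextE fx) [aI bI].
  by split; rewrite -(rmorph0 (\pi_{ideal_quot I} : R -> _)); apply/quot_eqP;
    rewrite subr0.
Qed.

End QuadQuotient.

Section LocalQuad.
Variables (R Z : localRingType) (f : {rmorphism R -> Z}) (r : R) (x : Z).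
Hypotheses (fx : quad_ext f r x) (rm : r \in maxid R).

Lemma maxid_unitE (A : localRingType) (a : A) :
  a \notin maxid A <-> exists b, a * b = 1.
Proof.
split=> [/maxid_unit//|[b ab]]; apply/negP => am.
by have := idealr1 (maxid A); rewrite -ab mulrC idealMr.
Qed.

Lemma maxid_prime (A : localRingType) (a b : A) :
  (a * b \in maxid A) = (a \in maxid A) || (b \in maxid A).
Proof.
apply/idP/idP; last by case/orP => h; [rewrite mulrC|]; apply: idealMr.
move=> ab; apply: contraLR ab; rewrite negb_or => /andP[].
move=> /maxid_unitE[c ac] /maxid_unitE[d bd]; apply/maxid_unitE; exists (c * d).
by rewrite mulrACA ac bd mulr1.
Qed.

Lemma quad_f_maxid a : (f a \in maxid Z) = (a \in maxid R).
Proof.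
apply/idP/idP; apply: contraLR => /maxid_unitE[b ab]; apply/maxid_unitE.
  by exists (f b); rewrite -rmorphM ab rmorph1.
have [_ gen free] := fx; have [c [d bE]] := gen b.
exists c; have := free (a * c - 1) (a * d).
rewrite rmorphB !rmorphM rmorph1 => h; have [|+ _] := h.
  by rewrite -{1}ab bE; ring.
by move=> /eqP; rewrite subr_eq0 => /eqP.
Qed.

Lemma quad_x_maxid : x \in maxid Z.
Proof.
have [x2 _ _] := fx; have : x * x \in maxid Z by rewrite -expr2 x2 quad_f_maxid.
by rewrite maxid_prime orbb.
Qed.

Lemma quad_maxid a b : (f a + f b * x \in maxid Z) = (a \in maxid R).
Proof.
rewrite -quad_f_maxid; have h : f b * x \in maxid Z by rewrite idealMr ?quad_x_maxid.
apply/idP/idP => h'; last by rewrite rpredD.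
by rewrite -[f a](addrK (f b * x)) rpredB.
Qed.

Lemma punctured_spec_map (q : spec Z) :
  punctured_spec (spec_map f q) <-> punctured_spec q.
Proof.
have [x2 gen free] := fx; split=> h e; apply: h => y.
  by rewrite mem_spec_map e quad_f_maxid.
have qsub : {subset q <= maxid Z} by apply: sub_maxid.
apply/idP/idP => [/qsub//|]; have [a [b ->]] := gen y.
rewrite quad_maxid -e mem_spec_map => aq.
rewrite rpredD// idealMr//.
have : x * x \in q by rewrite -expr2 x2 -mem_spec_map e.
by rewrite prime_idealrM orbb.
Qed.

Let U := @punctured_spec R.
Let V := @punctured_spec Z.
Let c := spec_map f.

Lemma image_punctured (W : set (spec Z)) : c @` (V `&` W) = U `&` (c @` W).
Proof.
apply/seteqP; split=> p [].
  by move=> q [Vq Wq] <-; split; [apply/punctured_spec_map|exists q].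
by move=> Up [q Wq e]; exists q => //; split=> //; apply/punctured_spec_map;
  rewrite -/c e.
Qed.

Lemma quad_connected_down : connected V -> connected U.
Proof.
move=> hV; suff -> : U = c @` V.
  apply: connected_continuous_connected hV _.
  exact/continuous_subspaceT/spec_map_continuous.
rewrite -[V]setIT image_punctured; apply/esym/setIidPl => p _.
by have [q qp] := quad_lying_over fx p; exists q.
Qed.

Lemma quad_open_map (W : set (spec Z)) : open W -> open (c @` W).
Proof.
have [x2 gen free] := fx.
move=> [S ->]; exists [set z | exists a b, S (f a + f b * x) /\
  (z = 2%:R * a \/ z = a ^+ 2 - r * b ^+ 2)].
have notin (A : comNzRingType) (T : set A) (p : spec A) :
    (~` zero_locus T) p <-> exists2 a, T a & a \notin p.
  split=> [h|[a Ta ap] /(_ a Ta)]; last exact/negP.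
  by apply: contrapT => h'; apply: h => a Ta; apply/negPn/negP => ap; apply: h'; exists a.
apply/seteqP; split=> p.
  case=> q /notin[y Sy yq] qp; have [a [b yE]] := gen y; rewrite {}yE in Sy yq.
  have [h _] := quad_avoid fx p a b.
  apply/notin; case: h; first by exists q.
    by move=> h; exists (2%:R * a) => //; exists a, b; split; [|left].
  by move=> h; exists (a ^+ 2 - r * b ^+ 2) => //; exists a, b; split; [|right].
move=> /notin[z [a [b [Sab zE]]] zp]; have [_ h] := quad_avoid fx p a b.
have [|q qp yq] := h; first by case: zE => <-; [left|right].
by exists q => //; apply/notin; exists (f a + f b * x).
Qed.

Lemma quad_closed_map (W : set (spec Z)) : closed W -> closed (c @` W).
Proof.
move=> cW; have [S WE] : open (~` W) by apply: closed_openC.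
have {WE}-> : W = zero_locus S by rewrite -[W]setCK WE setCK.
suff -> : c @` zero_locus S = zero_locus (f @^-1` ideal_span S).
  rewrite -openC; exists (f @^-1` ideal_span S).
  by [].
apply/seteqP; split=> p.
  case=> q Sq <- a ha; rewrite /= mem_spec_map.
  exact: (ideal_span_min (is_ideal_idealr q) Sq ha).
move=> hp; have [q [Sq qp]] := quad_going_up fx (is_ideal_span S) hp.
by exists q => // y Sy; apply: Sq; apply: sub_ideal_span.
Qed.

Lemma quad_connected_up (p0 : spec R) : U p0 -> r \in p0 ->
  connected U -> connected V.
Proof.
move=> Up0 rp0 hU; have [x2 gen free] := fx.
have img (W O C : set (spec Z)) : W !=set0 -> open O -> closed C ->
    W = V `&` O -> W = V `&` C -> c @` W = U.
  move=> [q Wq] oO cC WO WC; apply: hU; first by exists (c q); exists q.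
    by exists (c @` O); [exact: quad_open_map|rewrite WO image_punctured].
  by exists (c @` C); [exact: quad_closed_map|rewrite WC image_punctured].
move=> W W0 [O oO WO] [C cC WC]; apply: contrapT => nW.
have W1 := img W O C W0 oO cC WO WC.
have WD : V `\` W = V `&` ~` O.
  by rewrite WO; apply/seteqP; split=> q [Vq h]; split=> //; [move=> Oq; apply: h|case].
have WD' : V `\` W = V `&` ~` C.
  by rewrite WC; apply/seteqP; split=> q [Vq h]; split=> //; [move=> Oq; apply: h|case].
have W2 : c @` (V `\` W) = U.
  apply: (img _ (~` C) (~` O)) => //; [|exact: closed_openC|exact: open_closedC].
  apply: contrapT => /nonemptyPn h; apply: nW; apply/seteqP; split.
    by rewrite WO; apply: subIsetl.
  by rewrite -setD_eq0 h.
have /(_ p0) : c @` W `<=` c @` (V `\` W) by rewrite W1 W2.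
have [q Wq qp] : (c @` W) p0 by rewrite W1.
case; first by exists q.
move=> q' [_ nWq'] q'p; apply: nWq'; suff -> : q' = q by [].
have mem (s : spec Z) a b : c s = p0 -> (f a + f b * x \in s) = (a \in p0).
  move=> e; have xs : x \in s.
    have : x * x \in s by rewrite -expr2 x2 -mem_spec_map -/c e.
    by rewrite prime_idealrM orbb.
  rewrite -e mem_spec_map; apply/idP/idP => h.
    by rewrite -[f a](addrK (f b * x)) rpredB// idealMr.
  by rewrite rpredD// idealMr.
by apply: spec_eq; apply/seteqP; split=> y /=; have [a [b ->]] := gen y; rewrite !mem.
Qed.

End LocalQuad.

Section QuadRing.
Variables (R : comNzRingType) (r : R).

Definition quad of phant R & R : Type := (R * R)%type.
Notation Q := (quad (Phant R) r).

HB.instance Definition _ := GRing.Zmodule.copy Q (R * R)%type.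

Definition quad_one : Q := (1, 0).
Definition quad_mul (y z : Q) : Q :=
  (y.1 * z.1 + r * y.2 * z.2, y.1 * z.2 + y.2 * z.1).

Lemma quad_mulA : associative quad_mul.
Proof. by move=> [a b] [c d] [e g]; congr pair => /=; ring. Qed.

Lemma quad_mulC : commutative quad_mul.
Proof. by move=> [a b] [c d]; congr pair => /=; ring. Qed.

Lemma quad_mul1 : left_id quad_one quad_mul.
Proof. by move=> [a b]; rewrite /quad_mul /=; congr pair => /=; ring. Qed.

Lemma quad_mulDl : left_distributive quad_mul +%R.
Proof. by move=> [a b] [c d] [e g]; congr pair => /=; ring. Qed.

Lemma quad_one_neq0 : quad_one != 0.
Proof. by apply/eqP => -[] /eqP; rewrite oner_eq0. Qed.

HB.instance Definition _ := GRing.Zmodule_isComNzRing.Build Q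
  quad_mulA quad_mulC quad_mul1 quad_mulDl quad_one_neq0.

Definition quad_inc (a : R) : Q := (a, 0).
Definition quad_root : Q := (0, 1).

Lemma quad_inc_zmod : zmod_morphism quad_inc.
Proof. by move=> a b; congr pair; rewrite /= subr0. Qed.

Lemma quad_inc_monoid : monoid_morphism quad_inc.
Proof. by split=> // a b; congr pair => /=; ring. Qed.

HB.instance Definition _ := GRing.isZmodMorphism.Build R Q quad_inc quad_inc_zmod.
HB.instance Definition _ := GRing.isMonoidMorphism.Build R Q quad_inc quad_inc_monoid.

Lemma quad_decomp (y : Q) : y = quad_inc y.1 + quad_inc y.2 * quad_root.
Proof. by case: y => a b; congr pair => /=; ring. Qed.

Lemma quad_ext_inc : quad_ext (quad_inc : {rmorphism R -> Q}) r quad_root.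
Proof.
split.
- by congr pair => /=; ring.
- by move=> y; exists y.1, y.2; exact: quad_decomp.
- move=> a b; have -> : quad_inc a + quad_inc b * quad_root = (a, b) :> Q.
    by congr pair => /=; ring.
  by case.
Qed.

End QuadRing.
Notation "'Quad' r" := (quad (Phant _) r) (at level 10, r at level 8).

Section QuadLocal.
Variables (R : localRingType) (r : R).
Hypothesis rm : r \in maxid R.

Definition lquad of r \in maxid R : Type := Quad r.
Notation Q := (lquad rm).

HB.instance Definition _ := GRing.ComNzRing.copy Q (Quad r).

Definition lquad_maxid : {pred Q} := fun y => y.1 \in maxid R.

Lemma lquad_maxid_closed : idealr_closed lquad_maxid.
Proof.
split; first exact: (idealr0 (maxid R)).
  by rewrite unfold_in /lquad_maxid /= idealr1.
move=> a u v hu hv; suff: (a.1 * u.1 + r * a.2 * u.2) + v.1 \in maxid R by [].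
have -> : r * a.2 * u.2 = (a.2 * u.2) * r by ring.
by rewrite !rpredD// idealMr.
Qed.

Lemma lquad_maxid_unit (y : Q) : y \notin lquad_maxid -> exists z, y * z = 1.
Proof.
move=> y1; have h : y.1 * y.1 - r * (y.2 * y.2) \notin maxid R.
  have : y.1 * y.1 \notin maxid R by rewrite maxid_prime orbb.
  apply: contra => h; rewrite -[_ * _](subrK (r * (y.2 * y.2))) rpredD//.
  by rewrite mulrC idealMr.
have /maxid_unit[c hc] := h.
by exists (y.1 * c, - (y.2 * c)); congr pair => /=; [rewrite -hc|]; ring.
Qed.

HB.instance Definition _ := isLocal.Build Q lquad_maxid_closed lquad_maxid_unit.

Definition lquad_inc : R -> Q := @quad_inc R r.
Definition lquad_root : Q := quad_root r.

HB.instance Definition _ := GRing.RMorphism.copy lquad_inc (@quad_inc R r).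

Lemma lquad_inc_maxid a : a \in maxid R -> lquad_inc a \in maxid Q.
Proof. by []. Qed.

HB.instance Definition _ := isLocalHom.Build R Q lquad_inc lquad_inc_maxid.

Lemma lquad_ext : quad_ext (lquad_inc : {rmorphism R -> Q}) r lquad_root.
Proof. exact: quad_ext_inc. Qed.

End QuadLocal.

(** * Local cohomology along a quadratic extension *)

Section LocalCohomologyVanishing.
Variables (A : comNzRingType) (I : idealr A) (M : lmodType A).
Variables (E : injective_resolution M) (i : nat).

Lemma local_cohomology_neq0 :
  (exists h : local_cohomology I E i, h != 0) <->
  exists e : E i, [/\ torsion I e, ires_diff E i e = 0 & ~ coboundary_set I e].
Proof.
split=> [[h h0]|[e [te de ne]]].
  have /set_mem[te de] : cocycle_val (repr h) \in @cocycle A I M E i.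
    by case: (repr h).
  exists (cocycle_val (repr h)); split=> // ce; move: h0 => /negP; apply.
  rewrite -[h]reprK -(raddf0 (\pi_(Quotient.quot (@coboundary A I M E i)))).
  by rewrite -Quotient.idealrBE subr0; apply/mem_set.
have he : e \in @cocycle A I M E i by apply/mem_set.
pose c := Cocycle he.
exists (\pi_(Quotient.quot (@coboundary A I M E i)) c); apply/negP.
rewrite -(raddf0 (\pi_(Quotient.quot (@coboundary A I M E i)))).
by rewrite -Quotient.idealrBE subr0 => /set_mem.
Qed.

End LocalCohomologyVanishing.

Section ChangeOfRings.
Variables (A : comNzRingType) (r : A).
Notation B := (Quad r).
Let x : B := quad_root r.

(* A pair (u, v) stands for u + x v: the module is induced by N, and also
   coinduced, by sending h : Hom_A(B, N) to (h x, h 1). *)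
Section Coinduced.
Variable N : lmodType A.

Definition coind : Type := (N * N)%type.
HB.instance Definition _ := GRing.Zmodule.copy coind (N * N)%type.

Definition coind_scale (b : B) (e : coind) : coind :=
  (b.1 *: e.1 + (r * b.2) *: e.2, b.1 *: e.2 + b.2 *: e.1).

Lemma coind_scaleA a b v : coind_scale a (coind_scale b v) = coind_scale (a * b) v.
Proof.
case: a b v => [a1 a2] [b1 b2] [v1 v2]; rewrite /coind_scale /=.
by congr pair; rewrite !scalerDr ?mulrDr !scalerDl !scalerA [LHS](AC (2*2)
  (1 * 4 * (2 * 3)));
  congr (_ *: _ + _ *: _ + (_ *: _ + _ *: _)); ring.
Qed.

Lemma coind_scale1 : left_id 1 coind_scale.
Proof. by case=> v1 v2; rewrite /coind_scale /= mulr0 !scale1r !scale0r !addr0. Qed.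

Lemma coind_scaleDr : right_distributive coind_scale +%R.
Proof.
move=> [a1 a2] [u1 u2] [v1 v2]; rewrite /coind_scale /=.
by congr pair; rewrite !scalerDr addrACA.
Qed.

Lemma coind_scaleDl v : {morph coind_scale^~ v : a b / a + b}.
Proof.
move=> [a1 a2] [b1 b2]; rewrite /coind_scale /=.
by congr pair; rewrite ?mulrDr !scalerDl addrACA.
Qed.

HB.instance Definition _ := GRing.Zmodule_isLmodule.Build B coind
  coind_scaleA coind_scale1 coind_scaleDr coind_scaleDl.

Lemma coind_incE a (e : coind) : quad_inc r a *: e = (a *: e.1, a *: e.2) :> coind.
Proof. by congr pair; rewrite /= ?mulr0 scale0r addr0. Qed.

Lemma coind_rootE (e : coind) : x *: e = (r *: e.2, e.1) :> coind.
Proof. by congr pair; rewrite /= ?mulr1 scale0r add0r ?scale1r. Qed.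

End Coinduced.

Section CoindMap.
Variables (N N' : lmodType A) (f : {linear N -> N'}).

Definition coind_map (e : coind N) : coind N' := (f e.1, f e.2).

Lemma coind_map_linear : linear coind_map.
Proof.
by move=> [b1 b2] [u1 u2] [v1 v2]; rewrite /coind_map /= !linearD !linearZ.
Qed.
HB.instance Definition _ :=
  GRing.isLinear.Build B (coind N) (coind N') *:%R coind_map coind_map_linear.

End CoindMap.

Section Restriction.
Variable N : lmodType B.

Definition restr : Type := N.
HB.instance Definition _ := GRing.Zmodule.on restr.

Definition restr_scale (a : A) (v : restr) : restr := quad_inc r a *: (v : N).

Lemma restr_scaleA a b v : restr_scale a (restr_scale b v) = restr_scale (a * b) v.
Proof. by rewrite /restr_scale scalerA rmorphM. Qed.

Lemma restr_scale1 : left_id 1 restr_scale.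
Proof. by move=> v; rewrite /restr_scale rmorph1 scale1r. Qed.

Lemma restr_scaleDr : right_distributive restr_scale +%R.
Proof. by move=> a u v; rewrite /restr_scale scalerDr. Qed.

Lemma restr_scaleDl v : {morph restr_scale^~ v : a b / a + b}.
Proof. by move=> a b; rewrite /restr_scale rmorphD scalerDl. Qed.

HB.instance Definition _ := GRing.Zmodule_isLmodule.Build A restr
  restr_scaleA restr_scale1 restr_scaleDr restr_scaleDl.

Lemma restr_scaleE (a : A) (v : restr) : a *: v = quad_inc r a *: (v : N).
Proof. by []. Qed.

End Restriction.

Section RestrMap.
Variables (N N' : lmodType B) (f : {linear N -> N'}).

Definition restr_map : restr N -> restr N' := f.

Lemma restr_map_linear : linear restr_map.
Proof. by move=> a u v; rewrite /restr_map /= linearP. Qed.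
HB.instance Definition _ :=
  GRing.isLinear.Build A (restr N) (restr N') *:%R restr_map restr_map_linear.

End RestrMap.

Lemma quad_scale (N : lmodType B) (b : B) (v : N) :
  b *: v = quad_inc r b.1 *: v + x *: (quad_inc r b.2 *: v).
Proof. by rewrite {1}(quad_decomp b) scalerDl scalerA [x * _]mulrC. Qed.

Lemma quad_root2 (N : lmodType B) (v : N) : x *: (x *: v) = quad_inc r r *: v.
Proof. by rewrite scalerA; case: (quad_ext_inc r) => <-. Qed.

Lemma quad_rootZ (N : lmodType B) a (v : N) :
  x *: (quad_inc r a *: v) = quad_inc r a *: (x *: v).
Proof. by rewrite !scalerA mulrC. Qed.

Section CoindAdjoint.
Variables (N : lmodType B) (E : lmodType A) (h : {linear restr N -> E}).

Definition coind_adj (v : N) : coind E := (h (x *: v), h v).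

Lemma coind_adj_linear : linear coind_adj.
Proof.
move=> b u v; rewrite quad_scale.
have hZ a (w : N) : h (quad_inc r a *: w) = a *: h w by exact: (linearZZ h a w).
have hD (w w' : N) : h (w + w') = h w + h w' by exact: (linearD h w w').
congr pair; rewrite /= ?scalerDr !hD ?quad_root2 ?quad_rootZ !hZ.
  by rewrite scalerA.
by [].
Qed.
HB.instance Definition _ :=
  GRing.isLinear.Build B N (coind E) *:%R coind_adj coind_adj_linear.

End CoindAdjoint.

Section IndAdjoint.
Variables (N : lmodType A) (E : lmodType B) (g : {linear N -> restr E}).

Definition ind_adj (e : coind N) : E := (g e.1 : E) + x *: (g e.2 : E).

Lemma ind_adj_linear : linear ind_adj.
Proof.
move=> b [u1 u2] [v1 v2]; rewrite /ind_adj.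
have gZ a (w : N) : g (a *: w) = quad_inc r a *: (g w : E) by exact: (linearZZ g a w).
have gD (w w' : N) : g (w + w') = (g w : E) + (g w' : E) by exact: (linearD g w w').
rewrite (@quad_scale E b) /= !gD !gZ !scalerDr -!quad_rootZ quad_root2.
rewrite [quad_inc r r *: _]scalerA -rmorphM.
by rewrite [LHS](AC (3*3) ((1 * 4) * (5 * 2) * (3 * 6))).
Qed.
HB.instance Definition _ :=
  GRing.isLinear.Build B (coind N) E *:%R ind_adj ind_adj_linear.

End IndAdjoint.

Section IndSection.
Variables (N : lmodType A) (E : lmodType B) (h : {linear coind N -> E}).

Definition ind_restr (v : N) : restr E := h (v, 0).

Lemma ind_restr_linear : linear ind_restr.
Proof.
move=> a u v; rewrite restr_scaleE /ind_restr -linearZ -linearD coind_incE /=.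
by congr (h _); congr pair; rewrite /= scaler0 addr0.
Qed.
HB.instance Definition _ :=
  GRing.isLinear.Build A N (restr E) *:%R ind_restr ind_restr_linear.

End IndSection.

Lemma coind_injective (E : lmodType A) : injective_module E -> injective_module (coind E).
Proof.
move=> injE M N f g finj.
pose f' : {linear restr M -> restr N} := restr_map f.
have g2l : linear (fun v : restr M => (g v).2).
  by move=> a u v; have := linearP g (quad_inc r a) u v;
    rewrite coind_incE => /(congr1 snd).
pose g2 : {linear restr M -> E} :=
  HB.pack (fun v : restr M => (g v).2) (GRing.isLinear.Build A (restr M) E *:%R _ g2l).
have [h hE] := injE (restr M) (restr N) f' g2 finj.
exists (coind_adj h) => v; rewrite /= /coind_adj -linearZ.
have e w : h (f w) = (g w).2 by exact: hE.
have gx : g (x *: v) = (r *: (g v).2, (g v).1) by rewrite -coind_rootE;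
  exact: (linearZZ g x v).
by rewrite !e gx; case: (g v).
Qed.

Lemma restr_injective (E : lmodType B) : injective_module E -> injective_module (restr E).
Proof.
move=> injE M N f g finj.
have [|h hE] := injE (coind M) (coind N) (coind_map f) (ind_adj g).
  by move=> [u1 u2] [v1 v2] [/finj -> /finj ->].
exists (ind_restr h) => v; rewrite /= /ind_restr.
have := hE (v, 0); rewrite /= /coind_map /ind_adj /= !linear0 => ->.
by rewrite ?scaler0 addr0.
Qed.

Definition coind_resolution (M : lmodType A) (E : injective_resolution M) :
  injective_resolution (coind M).
Proof.
case: E => E aug d injE injaug ex0 ex.
apply: (@InjectiveResolution B (coind M) (fun n => coind (E n))
  (coind_map aug) (fun n => coind_map (d n))).
- by move=> n; apply: coind_injective.
- by move=> [u1 u2] [v1 v2] [/injaug -> /injaug ->].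
- case=> u1 u2; split=> [[/ex0[y <-] /ex0[z <-]]|[[y1 y2] [<- <-]]].
    by exists (y, z).
  by congr pair; apply/ex0; [exists y1|exists y2].
- move=> n [u1 u2]; split=> [[/ex[y <-] /ex[z <-]]|[[y1 y2] [<- <-]]].
    by exists (y, z).
  by congr pair; apply/ex; [exists y1|exists y2].
Defined.

Definition restr_resolution (M : lmodType B) (E : injective_resolution M) :
  injective_resolution (restr M).
Proof.
case: E => E aug d injE injaug ex0 ex.
apply: (@InjectiveResolution A (restr M) (fun n => restr (E n))
  (restr_map aug) (fun n => restr_map (d n))) => //.
by move=> n; apply: restr_injective.
Defined.

Variables (I : idealr A) (J : idealr B).
Hypothesis JI : [set` J] = qext (quad_inc r) x [set` I].

Lemma quad_exp_inc n a : ideal_exp [set` I] n a -> ideal_exp [set` J] n (quad_inc r a).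
Proof.
apply: (@exp_image _ _ (quad_inc r : {rmorphism A -> B})) => b Ib.
by rewrite JI; apply: qext_sub => //; apply: is_ideal_idealr.
Qed.

Lemma quad_exp_sub n (b : B) : ideal_exp [set` J] n b ->
  ideal_exp [set` I] n b.1 /\ ideal_exp [set` I] n b.2.
Proof.
have ext := quad_ext_inc r.
suff : ideal_exp [set` J] n `<=` qext (quad_inc r) x (ideal_exp [set` I] n).
  by move=> h hb; apply/(qextE ext); rewrite -(quad_decomp b); apply: h.
elim: n => [|n IHn] /=.
  by move=> y _; exists y.1, y.2; split=> //; exact: quad_decomp.
apply: ideal_mul_min; first exact/(is_ideal_qext ext)/is_ideal_mul.
have JE y : [set` J] y -> qext (quad_inc r) x [set` I] y by rewrite JI.
move=> y z /JE[a1 [a2 [Ia1 Ia2 ->]]] hz; have [b1 [b2 [hb1 hb2 ->]]] := IHn _ hz.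
have hI := is_ideal_mul [set` I] (ideal_exp [set` I] n).
exists (a1 * b1 + r * (a2 * b2)), (a1 * b2 + a2 * b1); split.
- by apply: (ideal_D hI); [|apply: (ideal_Ml hI)]; apply: ideal_mul_in.
- by apply: (ideal_D hI); apply: ideal_mul_in.
- by rewrite !rmorphD !rmorphM; case: ext => <- _ _; ring.
Qed.

Lemma torsion_coind (N : lmodType A) (e : coind N) :
  torsion J e <-> torsion I e.1 /\ torsion I e.2.
Proof.
split=> [[n hn]|[[n hn] [m hm]]].
  by split; exists n => a ha; have := hn _ (quad_exp_inc ha); rewrite coind_incE => -[].
exists (maxn n m) => b /quad_exp_sub[h1 h2].
have hI := is_ideal_exp [set` I] n; have hI' := is_ideal_exp [set` I] m.
have n1 := @ideal_exp_le _ [set` I] _ _ (leq_maxl n m).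
have m1 := @ideal_exp_le _ [set` I] _ _ (leq_maxr n m).
congr pair => /=.
  by rewrite (hn _ (n1 _ h1)) add0r; apply: hm; apply: (ideal_Ml hI'); apply: m1.
by rewrite (hm _ (m1 _ h1)) (hn _ (n1 _ h2)) addr0.
Qed.

Lemma torsion_restr (N : lmodType B) (e : N) :
  torsion I (e : restr N) <-> torsion J e.
Proof.
split=> -[n hn]; exists n; last by move=> a /quad_exp_inc/hn.
move=> b /quad_exp_sub[/hn h1 /hn h2]; rewrite quad_scale.
by rewrite -[quad_inc r b.1 *: e]/(b.1 *: (e : restr N)) h1
  -[quad_inc r b.2 *: e]/(b.2 *: (e : restr N)) h2 add0r scaler0.
Qed.

Lemma cd_quad : cd I = cd J.
Proof.
rewrite /cd; congr (supremum _ [set _ | i in _]); apply/seteqP; split=> i /=.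
  move=> [M [E /local_cohomology_neq0[e [te de ne]]]].
  exists (coind M), (coind_resolution E); apply/local_cohomology_neq0.
  move: te de ne; case: E e => E aug d injE injaug ex0 ex /= e te de ne.
  exists (e, 0); split.
  - by apply/torsion_coind; split=> //; exists 0%N => a _; rewrite scaler0.
  - by rewrite /coind_map /= de linear0.
  - case: i e te de ne => [|i] e te de ne /=; first by case.
    by case=> -[u1 u2] /torsion_coind[tu _] [h _]; apply: ne; exists u1.
move=> [M [E /local_cohomology_neq0[e [te de ne]]]].
exists (restr M), (restr_resolution E); apply/local_cohomology_neq0.
move: te de ne; case: E e => E aug d injE injaug ex0 ex /= e te de ne.
exists e; split=> //; first exact/torsion_restr.
case: i e te de ne => [|i] e te de ne //=.
by case=> u /torsion_restr tu h; apply: ne; exists u.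
Qed.

End ChangeOfRings.

(** * Regularity *)

Section QuadNoetherian.
Variables (R Z : comNzRingType) (f : {rmorphism R -> Z}) (r : R) (x : Z).
Hypotheses (fx : quad_ext f r x) (noeR : noetherian R).

Lemma quad_noetherian : noetherian Z.
Proof.
move=> K hK; have [x2 gen free] := fx.
have hK0 : is_ideal (f @^-1` K) by apply: is_ideal_preim.
pose lead (L : set Z) : set R := [set b | exists a, L (f a + f b * x)].
have hlead L : is_ideal L -> is_ideal (lead L).
  move=> hL; split=> [|a u v [c hc] [d hd]].
    by exists 0; rewrite rmorph0 mul0r addr0; apply: ideal_0.
  exists (a * c + d); have -> : f (a * c + d) + f (a * u + v) * x =
      f a * (f c + f u * x) + (f d + f v * x) by rewrite !rmorphD !rmorphM; ring.
  by ideal_tac hL.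
have [s0 s0E] := noeR hK0; have [s1 s1E] := noeR (hlead _ hK).
have /choice[h hh] b : exists a, lead K b -> K (f a + f b * x).
  by have [[a ha]|nb] := pselect (lead K b); [exists a|exists 0].
pose t := map f s0 ++ map (fun b => f (h b) + f b * x) s1.
exists t; set L := ideal_span _; have hL : is_ideal L by exact: is_ideal_span.
have LK : L `<=` K.
  apply: ideal_span_min => // y /=; rewrite mem_cat => /orP[] /mapP[b bs ->].
    have : (f @^-1` K) b by rewrite s0E; apply: sub_ideal_span.
    by [].
  by apply: hh; rewrite s1E; apply: sub_ideal_span.
have L0 a : K (f a) -> L (f a).
  move=> Ka; have : (f @^-1` K) a by []; rewrite s0E => /(@span_image _ _ f).
  apply: ideal_span_min => // _ [b bs <-]; apply: sub_ideal_span => /=.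
  by rewrite mem_cat map_f.
apply/seteqP; split=> // y Ky; have [a [b yE]] := gen y.
have [a' La'] : lead L b.
  have : lead K b by exists a; rewrite -yE.
  rewrite s1E; apply: ideal_span_min; first exact: hlead.
  move=> c cs; exists (h c); apply: sub_ideal_span => /=.
  by rewrite mem_cat (map_f (fun b => f (h b) + f b * x) cs) orbT.
have -> : y = f (a - a') + (f a' + f b * x) by rewrite yE rmorphB; ring.
apply: (ideal_D hL) => //; apply: L0.
have -> : f (a - a') = y - (f a' + f b * x) by rewrite yE rmorphB; ring.
by apply: (ideal_B hK) => //; apply: LK.
Qed.

End QuadNoetherian.

Section QuadRegular.
Variables (A : localRingType) (r : A).
Hypotheses (rm : r \in maxid A) (r2 : ~ ideal_exp [set` maxid A] 2 r).
Notation B := (lquad rm).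
Notation inc := (@lquad_inc A r rm).
Notation root := (@lquad_root A r rm).

Lemma quad_regular : regular_local A -> regular_local B.
Proof.
have ext := lquad_ext rm.
move=> [noeA [s [sE sdim]]]; split; first exact: quad_noetherian ext noeA.
have hmA := is_ideal_idealr (maxid A); have hmB := is_ideal_idealr (maxid B).
have [c rE] : exists c, r = lincomb c s.
  by apply/ideal_span_seq; rewrite -sE.
have [i ci] : exists i : 'I_(size s), c i \notin maxid A.
  apply: contrapT => h; apply: r2; rewrite rE.
  apply: ideal_sum => [|i _]; first exact: is_ideal_exp.
  apply: ideal_mul_in; first by apply: contrapT => /negP ci; apply: h; exists i.
  suff : ideal_exp [set` maxid A] 1 s`_i by [].
  rewrite (ideal_exp1 hmA) sE; apply: sub_ideal_span => /=; exact: mem_nth.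
pose t := mkseq (fun j => if j == i :> nat then root else inc s`_j) (size s).
have tn j : (j < size s)%N -> t`_j = if j == i :> nat then root else inc s`_j.
  by move=> js; rewrite nth_mkseq.
exists t; rewrite size_mkseq; split; last by rewrite (quad_krull_dim ext).
set L := ideal_span _; have hL : is_ideal L by exact: is_ideal_span.
have Ltn j : (j < size s)%N -> L (if j == i :> nat then root else inc s`_j).
  by move=> js; rewrite -tn//; apply: sub_ideal_span => /=; rewrite mem_nth ?size_mkseq.
have Lroot : L root by have := Ltn i (ltn_ord i); rewrite eqxx.
have Linc j : (j < size s)%N -> L (inc s`_j).
  move=> js; have := Ltn j js; case: eqP => // -> _.
  have /maxid_unitE[d cd] := ci.
  have -> : s`_i = d * (r - \sum_(k < size s | k != i) c k * s`_k).
    rewrite rE /lincomb (bigD1 i)//= addrK mulrA [d * _]mulrC cd mul1r//.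
  rewrite rmorphM; apply: (ideal_Ml hL); rewrite rmorphB; apply: (ideal_B hL).
    by case: ext => <- _ _; apply: (ideal_Ml hL).
  rewrite rmorph_sum; apply: (ideal_sum hL) => k ki.
  rewrite rmorphM; apply: (ideal_Ml hL).
  by have := Ltn k (ltn_ord k); rewrite (negbTE (_ : k != i :> nat)).
apply/seteqP; split=> y.
  have [_ gen _] := ext; have [a [b ->]] := gen y; rewrite /= (quad_maxid ext rm) => am.
  apply: (ideal_D hL); last exact: (ideal_Ml hL).
  have : [set` maxid A] a by []; rewrite sE => /(@span_image _ _ inc).
  by apply: ideal_span_min => // _ [b' /= /(nthP 0)[j js <-] <-]; apply: Linc.
move: y; apply: ideal_span_min => // y /= /(nthP 0)[j]; rewrite size_mkseq => js <-.
rewrite tn//; case: eqP => _; first exact: (quad_x_maxid ext).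
rewrite (quad_f_maxid ext); have : [set` maxid A] s`_j.
  by rewrite sE; apply: sub_ideal_span => /=; apply: mem_nth.
by [].
Qed.

Lemma quad_mixed_char p : mixed_char A p -> mixed_char B p.
Proof.
have ext := lquad_ext rm; move=> [pp p0 pm]; split=> // [n|].
  apply: contraNneq (p0 n) => h; apply/eqP; apply: (quad_inj ext).
  by rewrite rmorph_nat.
by rewrite -(rmorph_nat inc) (quad_f_maxid ext).
Qed.

Lemma quad_ramified p : r = p%:R -> ramified B p.
Proof.
have ext := lquad_ext rm; move=> rp; rewrite /ramified -(rmorph_nat inc) -rp.
have xm := quad_x_maxid ext rm.
case: ext => <- _ _; exact: (ideal_expX 2 (I := [set` maxid B])).
Qed.

End QuadRegular.

(** * Completions *)

Section Hensel.
Variable R : comNzRingType.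
Implicit Types (p : {poly R}) (x y h : R).

Lemma horner_taylor2 p x h :
  exists g, p.[x + h] = p.[x] + h * p^`().[x] + h ^+ 2 * g.
Proof.
elim/poly_ind: p => [|p c [g IH]].
  by exists 0; rewrite deriv0 !horner0; ring.
exists (p^`().[x] + h * g + x * g); rewrite !hornerMXaddC derivD derivM derivX derivC.
by rewrite addr0 mulr1 hornerD hornerMX IH; ring.
Qed.

Lemma horner_sub_dvd p x y : exists g, p.[x] - p.[y] = (x - y) * g.
Proof.
have [g] := horner_taylor2 p y (x - y); rewrite subrKC => ->.
by exists (p^`().[y] + (x - y) * g); ring.
Qed.

Lemma newton_sequence (K : nat -> set R) p x c :
  (forall n, is_ideal (K n)) -> (forall n, K n.+1 `<=` K n) ->
  (forall n a b, K 0%N a -> K n b -> K n.+1 (a * b)) ->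
  K 0%N p.[x] -> p^`().[x] * c = 1 ->
  exists u : nat -> R, u 0%N = x /\ forall n, K n (u n.+1 - u n) /\ K n p.[u n].
Proof.
move=> hK Kd KM Kx xc.
pose u := fix u n := if n is m.+1 then u m - c * p.[u m] else x.
exists u; split=> //.
have K0 n : K n `<=` K 0%N by elim: n => // n IHn y /Kd/IHn.
have hu n : K 0%N (u n - x) /\ K n p.[u n].
  elim: n => [|n [IH1 IH2]] /=; first by rewrite subrr; split=> //; apply: ideal_0.
  have hc : K n (c * p.[u n]) by apply: ideal_Ml.
  split.
    have -> : u n - c * p.[u n] - x = (u n - x) - c * p.[u n] by ring.
    by apply: (ideal_B (hK 0%N)) => //; apply: K0 hc.
  have [g ->] := horner_taylor2 p (u n) (- (c * p.[u n])).
  have [g' E] := horner_sub_dvd p^`() (u n) x.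
  have -> : p.[u n] + - (c * p.[u n]) * p^`().[u n] + (- (c * p.[u n])) ^+ 2 * g =
     (p^`().[x] * c - c * p^`().[u n] + c * c * g * p.[u n]) * p.[u n].
    by rewrite xc; ring.
  apply: KM => //; apply: (ideal_D (hK 0%N)); last exact/(ideal_Ml (hK 0%N))/(K0 n).
  have -> : p^`().[x] * c - c * p^`().[u n] = - c * (p^`().[u n] - p^`().[x]) by ring.
  by rewrite E; apply: (ideal_Ml (hK 0%N)); apply: ideal_Mr.
move=> n; case: (hu n) => _ h; split=> //=.
have -> : u n - c * p.[u n] - u n = - c * p.[u n] by ring.
exact: ideal_Ml.
Qed.

End Hensel.

Section HenselLocal.
Variable R : localRingType.
Implicit Types (p : {poly R}) (x y : R).

Lemma hensel_unique p x y : p.[x] = 0 -> p.[y] = 0 -> x - y \in maxid R ->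
  p^`().[x] \notin maxid R -> x = y.
Proof.
move=> px py xy dp; have [g] := horner_taylor2 p x (y - x).
rewrite subrKC py px => E.
have E' : (y - x) * (p^`().[x] + (y - x) * g) = 0 by rewrite [RHS]E; ring.
have /maxid_unitE[b hb] : p^`().[x] + (y - x) * g \notin maxid R.
  apply: contra dp => h; rewrite -[p^`().[x]](addrK ((y - x) * g)) rpredB//.
  by rewrite mulrC idealMr// -opprB rpredN.
have /eqP : (y - x) * (p^`().[x] + (y - x) * g) * b = 0 by rewrite E' mul0r.
by rewrite -mulrA hb mulr1 subr_eq0 => /eqP.
Qed.

Lemma res_eqP x y : res x = res y <-> x - y \in maxid R.
Proof. by rewrite -res_eq0 rmorphB subr_eq0; split=> /eqP. Qed.

Lemma horner_res p x : (map_poly (@res R) p).[res x] = res p.[x].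
Proof. exact: horner_map. Qed.

Lemma henselianP : henselian R <->
  forall p x, p \is monic -> p.[x] \in maxid R -> p^`().[x] \notin maxid R ->
    exists2 y, p.[y] = 0 & y - x \in maxid R.
Proof.
split=> [h p x pm px dp|h p a pm].
  have [||y /rootP yp /res_eqP] := h p (res x) pm; last by exists y.
    by rewrite rootE horner_res res_eq0.
  by rewrite rootE deriv_map horner_res res_eq0.
rewrite -[a]res_surj !rootE deriv_map !horner_res !res_eq0 => px dp.
by have [y /rootP yp /res_eqP yx] := h p (repr a) pm px dp; exists y.
Qed.

Lemma nil_henselian :
  (forall x, x \in maxid R -> exists n, x ^+ n = 0) -> henselian R.
Proof.
move=> nil; apply/henselianP => p x pm px dp.
have /maxid_unitE[c hc] := dp; have [k hk] := nil _ px.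
pose K n := principal (p.[x] ^+ n.+1).
have hK n : is_ideal (K n) by exact: is_ideal_principal.
have [|||u [u0 hu]] := @newton_sequence _ K p x c hK _ _ _ hc.
- move=> n _ [b _ <-]; exists (p.[x] * b) => //.
  by rewrite [p.[x] ^+ n.+2]exprSr mulrA.
- move=> n _ _ [a _ <-] [b _ <-]; exists (a * b) => //.
  by rewrite expr1 [p.[x] ^+ n.+2]exprS mulrACA.
- by exists 1 => //; rewrite mulr1.
exists (u k); first by case: (hu k) => _ [b _ <-]; rewrite exprS hk mulr0 mul0r.
elim: (k) => [|n IHn]; first by rewrite u0 subrr rpred0.
rewrite -[u n.+1](subrK (u n)) -addrA rpredD//.
by case: (hu n) => -[b _ <-] _; rewrite exprS mulrC mulrCA mulrC idealMr// mulrC idealMr.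
Qed.

End HenselLocal.

Section FieldMorphisms.

Section Inverse.
Variables (K L : fieldType) (i : {rmorphism K -> L}).
Hypothesis surj : forall y, exists x, i x = y.

Definition field_inv (y : L) : K := xget 0 [set x | i x = y].

Lemma field_invK y : i (field_inv y) = y.
Proof. by rewrite /field_inv; case: xgetP => [x _ //|h]; have [x /h] := surj y. Qed.

Lemma field_inv_zmod : zmod_morphism field_inv.
Proof. by move=> x y; apply: (fmorph_inj i); rewrite rmorphB !field_invK. Qed.

Lemma field_inv_monoid : monoid_morphism field_inv.
Proof.
by split=> [|x y]; apply: (fmorph_inj i); rewrite ?rmorph1 ?rmorphM !field_invK.
Qed.

HB.instance Definition _ := GRing.isZmodMorphism.Build L K field_inv field_inv_zmod.
HB.instance Definition _ := GRing.isMonoidMorphism.Build L K field_inv field_inv_monoid.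

Lemma exists_field_inv : exists j : {rmorphism L -> K}, cancel i j /\ cancel j i.
Proof.
exists (field_inv : {rmorphism L -> K}); split=> x; last exact: field_invK.
by apply: (fmorph_inj i); exact: field_invK.
Qed.

Lemma separably_closed_surj : separably_closed K -> separably_closed L.
Proof.
have [j [ij ji]] := exists_field_inv => hK p sp szp.
have [||x hx] := hK (map_poly j p); first by rewrite separable_map.
  by rewrite size_map_poly.
exists (i x); rewrite -(fmorph_root j) ij.
by [].
Qed.

End Inverse.

End FieldMorphisms.

Section CompleteFiltered.

Record complete_filtered (Z : localRingType) (K : nat -> set Z) : Prop := {
  cf_ideal : forall n, is_ideal (K n);
  cf_decr : forall n, K n.+1 `<=` K n;
  cf_maxid : K 0%N = [set` maxid Z];
  cf_mul : forall n a b, a \in maxid Z -> K n b -> K n.+1 (a * b);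
  cf_sep : forall z, (forall n, K n z) -> z = 0;
  cf_lim : forall u : nat -> Z, (forall n, K n (u n.+1 - u n)) ->
    exists z, forall n, K n (z - u n) }.

Variables (Z : localRingType) (K : nat -> set Z).
Hypothesis hK : complete_filtered K.

Lemma cf_exp n z : ideal_exp [set` maxid Z] n.+1 z -> K n z.
Proof.
elim: n z => [|n IHn] z.
  by rewrite ideal_exp1 ?(cf_maxid hK)//; apply: is_ideal_idealr.
apply: ideal_mul_min; first exact: cf_ideal hK _.
by move=> a b am /IHn; apply: cf_mul hK _ _ _ am.
Qed.

Lemma cf_le m n : (m <= n)%N -> K n `<=` K m.
Proof.
move=> /subnK <-; elim: (n - m)%N => // k IHk z; rewrite addSn => /(cf_decr hK).
exact: IHk.
Qed.

Lemma cf_unique z w (u : nat -> Z) :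
  (forall n, K n (z - u n)) -> (forall n, K n (w - u n)) -> z = w.
Proof.
move=> hz hw; apply/eqP; rewrite -subr_eq0; apply/eqP; apply: (cf_sep hK) => n.
have -> : z - w = (z - u n) - (w - u n) by ring.
exact: ideal_B (cf_ideal hK n) _ _ (hz n) (hw n).
Qed.

Lemma cf_henselian : henselian Z.
Proof.
apply/henselianP => p x pm px dp; have /maxid_unitE[c hc] := dp.
have hi := cf_ideal hK.
have [||u [u0 hu]] := @newton_sequence _ K p x c hi (cf_decr hK) _ _ hc.
- by move=> n a b; rewrite (cf_maxid hK); apply: (cf_mul hK).
- by rewrite (cf_maxid hK).
have [|y hy] := @cf_lim _ _ hK u; first by move=> n; case: (hu n).
exists y.
  apply: (cf_sep hK) => n; have [g E] := horner_sub_dvd p y (u n).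
  apply: (ideal_subl (hi n) (y := p.[u n])); last by case: (hu n).
  by rewrite E; apply: (ideal_Mr (hi n)).
have : K 0%N (y - x) by rewrite -u0; apply: hy.
by rewrite (cf_maxid hK).
Qed.

End CompleteFiltered.

Section CompletionFiltration.
Variable R : localRingType.
Notation mpow n := (ideal_exp [set` maxid R] n).
Notation C := (completion R).
Implicit Types (a : coherent_seq R) (z : C).

Definition completion_filt n : set C :=
  [set z | mpow n.+1 ((repr z : coherent_seq R) n)].

Definition completion_pi a : C := \pi_{ideal_quot (@null_seq R)} a.

Lemma completion_pi_zmod : zmod_morphism completion_pi.
Proof. by move=> a b; rewrite /completion_pi rmorphB. Qed.

Lemma completion_pi_monoid : monoid_morphism completion_pi.
Proof. by split=> [|a b]; rewrite /completion_pi ?rmorph1 ?rmorphM. Qed.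

HB.instance Definition _ := GRing.isZmodMorphism.Build _ _ completion_pi
  completion_pi_zmod.
HB.instance Definition _ := GRing.isMonoidMorphism.Build _ _ completion_pi
  completion_pi_monoid.

Lemma completion_reprK z : completion_pi (repr z) = z.
Proof. exact: reprK. Qed.

Lemma completion_pi_eq a b :
  completion_pi a = completion_pi b <-> forall n, mpow n.+1 (a n - b n).
Proof.
rewrite /completion_pi (quot_eqP (@null_seq R)); split=> [/asboolP //|h].
exact/asboolP.
Qed.

Lemma completion_filtE n a : completion_filt n (completion_pi a) <-> mpow n.+1 (a n).
Proof.
have : mpow n.+1 ((repr (completion_pi a) : coherent_seq R) n - a n).
  by have /completion_pi_eq := completion_reprK (completion_pi a).
have hm := is_ideal_exp [set` maxid R] n.+1.
split=> h; last by apply: (ideal_subl hm) h.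
by rewrite -[a n](subKr ((repr (completion_pi a) : coherent_seq R) n));
  exact: (ideal_B hm).
Qed.

Lemma to_completionE x : @to_completion R x = completion_pi (CoherentSeq
  (const_coherent x)).
Proof. by []. Qed.

Lemma completion_filt_const n x : completion_filt n (@to_completion R x) <-> mpow n.+1 x.
Proof. by rewrite to_completionE completion_filtE. Qed.

Lemma completion_maxidE a : (completion_pi a \in maxid C) = (a 0%N \in maxid R).
Proof. exact: quot_maxidE. Qed.

Lemma completion_filt_ideal n : is_ideal (completion_filt n).
Proof.
have hm := is_ideal_exp [set` maxid R] n.+1; split.
  by rewrite -(rmorph0 completion_pi); apply/completion_filtE; exact: (ideal_0 hm).
move=> b u v; rewrite -(completion_reprK b) -(completion_reprK u) -(completion_reprK v).
rewrite -rmorphM -rmorphD => /completion_filtE hu /completion_filtE hv.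
by apply/completion_filtE; apply: (ideal_D hm) => //; exact: (ideal_Ml hm).
Qed.

Lemma completion_dense n z : exists x, completion_filt n (z - @to_completion R x).
Proof.
exists ((repr z : coherent_seq R) n); rewrite -{1}(completion_reprK z)
  to_completionE -rmorphB.
apply/completion_filtE; set a : R := (repr z : coherent_seq R) n.
suff : mpow n.+1 (a - a) by [].
by rewrite subrr; apply: ideal_0; apply: is_ideal_exp.
Qed.

Lemma completion_complete : complete_filtered completion_filt.
Proof.
have hm n := is_ideal_exp [set` maxid R] n.
have shift a n : mpow n.+1 (a n.+1) <-> mpow n.+1 (a n).
  have h := @coherent_seqP R a n; split=> h'; last exact: (ideal_subl (hm _) h h').
  by rewrite -[a n](subKr (a n.+1)); apply: (ideal_B (hm _)).
split.
- exact: completion_filt_ideal.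
- move=> n z; rewrite -(completion_reprK z) => /completion_filtE h.
  by apply/completion_filtE/shift; apply: ideal_exp_le h.
- have e (a : coherent_seq R) : completion_filt 0 (completion_pi a) <->
      [set` maxid C] (completion_pi a).
    rewrite completion_filtE ideal_exp1; last exact: is_ideal_idealr.
    by rewrite /= completion_maxidE.
  by apply/seteqP; split=> z; rewrite -(completion_reprK z) => /e.
- move=> n a b; rewrite -(completion_reprK a) -(completion_reprK b) -rmorphM.
  rewrite completion_maxidE => a0 /completion_filtE bn; apply/completion_filtE.
  apply: ideal_mul_in; last exact/shift.
  by rewrite /= coherent_maxid.
- move=> z; rewrite -(completion_reprK z) -(rmorph0 completion_pi) => h.
  by apply/completion_pi_eq => n; rewrite subr0; apply/completion_filtE; exact: h.
move=> u hu; pose a n := (repr (u n) : coherent_seq R).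
have uE n : u n = completion_pi (a n) by rewrite completion_reprK.
have ha n : mpow n.+1 (a n.+1 n - a n n).
  by have := hu n; rewrite !uE -rmorphB => /completion_filtE.
have hz : (fun n => a n n) \in @coherent R.
  apply/asboolP => n.
  have -> : a n.+1 n.+1 - a n n = (a n.+1 n.+1 - a n.+1 n) + (a n.+1 n - a n n) by ring.
  by apply: (ideal_D (hm _)); [exact: coherent_seqP|exact: ha].
exists (completion_pi (CoherentSeq hz)) => n.
rewrite uE -rmorphB; apply/completion_filtE.
suff : mpow n.+1 (a n n - a n n) by []; rewrite subrr.
exact: (ideal_0 (hm _)).
Qed.

End CompletionFiltration.

Section CompletionExtension.
Variables (R Z : localRingType) (K : nat -> set Z).
Hypothesis hK : complete_filtered K.
Implicit Types (a : coherent_seq R).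

Section Extension.
Variable g : localHom R Z.

Lemma local_hom_exp n x : ideal_exp [set` maxid R] n.+1 x -> K n (g x).
Proof.
move=> hx; apply: (cf_exp hK).
by apply: exp_image hx => y; exact: local_hom_maxid.
Qed.

Definition completion_ext (z : completion R) : Z :=
  xget 0 [set w | forall n, K n (w - g ((repr z : coherent_seq R) n))].

Lemma completion_extP a n : K n (completion_ext (completion_pi a) - g (a n)).
Proof.
set z := completion_pi a; pose b : coherent_seq R := repr z.
have hb : forall n, K n (completion_ext z - g (b n)).
  rewrite /completion_ext; case: xgetP => [w _ //|/= h].
  have [|w hw] := @cf_lim _ _ hK (fun n => g (b n)); last by have := h w hw.
  by move=> k; rewrite -rmorphB; apply: local_hom_exp; exact: coherent_seqP.
have -> : completion_ext z - g (a n) = (completion_ext z - g (b n)) + g (b n - a n).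
  by rewrite rmorphB; ring.
apply: (ideal_D (cf_ideal hK n)) => //; apply: local_hom_exp.
by have /completion_pi_eq := completion_reprK z.
Qed.

Lemma completion_ext_unique a w :
  (forall n, K n (w - g (a n))) -> completion_ext (completion_pi a) = w.
Proof. by move=> hw; apply: (cf_unique hK _ hw); exact: completion_extP. Qed.

Lemma completion_ext_zmod : zmod_morphism completion_ext.
Proof.
move=> y z; rewrite -(completion_reprK y) -(completion_reprK z) -rmorphB.
apply: completion_ext_unique => n.
set a : coherent_seq R := repr y; set b : coherent_seq R := repr z.
have -> : g ((a - b) n) = g (a n) - g (b n) by rewrite -rmorphB.
set p := completion_ext _; set q := completion_ext _.
have -> : p - q - (g (a n) - g (b n)) = (p - g (a n)) - (q - g (b n)) by ring.
by apply: (ideal_B (cf_ideal hK n)); exact: completion_extP.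
Qed.

Lemma completion_ext_monoid : monoid_morphism completion_ext.
Proof.
split=> [|y z].
  rewrite -(rmorph1 (@completion_pi R)); apply: completion_ext_unique => n.
  have -> : g ((1 : coherent_seq R) n) = 1 by rewrite -(rmorph1 g).
  by rewrite subrr; apply: (ideal_0 (cf_ideal hK n)).
rewrite -(completion_reprK y) -(completion_reprK z) -rmorphM.
apply: completion_ext_unique => n.
set a : coherent_seq R := repr y; set b : coherent_seq R := repr z.
have -> : g ((a * b) n) = g (a n) * g (b n) by rewrite -rmorphM.
set p := completion_ext _; set q := completion_ext _.
have -> : p * q - g (a n) * g (b n) = q * (p - g (a n)) + g (a n) * (q - g (b n)) by ring.
by apply: (ideal_D (cf_ideal hK n)); apply: (ideal_Ml (cf_ideal hK n));
  exact: completion_extP.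
Qed.

Lemma completion_ext_maxid z :
  z \in maxid (completion R) -> completion_ext z \in maxid Z.
Proof.
rewrite -(completion_reprK z) completion_maxidE => h.
set a : coherent_seq R := repr z.
rewrite -[completion_ext _](subrK (g (a 0%N))) rpredD ?local_hom_maxid//.
by have := completion_extP a 0; rewrite (cf_maxid hK).
Qed.

HB.instance Definition _ := GRing.isZmodMorphism.Build _ _ completion_ext
  completion_ext_zmod.
HB.instance Definition _ := GRing.isMonoidMorphism.Build _ _ completion_ext
  completion_ext_monoid.
HB.instance Definition _ := isLocalHom.Build _ _ completion_ext completion_ext_maxid.

Definition completion_exth : localHom (completion R) Z := completion_ext.

Lemma completion_extE x : completion_exth (to_completion x) = g x.
Proof.
apply: completion_ext_unique => n; rewrite subrr.
exact: (ideal_0 (cf_ideal hK n)).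
Qed.

Lemma completion_ext_filt n z : completion_filt n z -> K n (completion_exth z).
Proof.
rewrite -(completion_reprK z) => /completion_filtE h.
apply: (ideal_subl (cf_ideal hK n) (@completion_extP _ n)).
exact: local_hom_exp.
Qed.

End Extension.

Lemma completion_hom_eq (g1 g2 : {rmorphism completion R -> Z}) :
  (forall n, exists m, forall z, completion_filt m z -> K n (g1 z)) ->
  (forall n, exists m, forall z, completion_filt m z -> K n (g2 z)) ->
  (forall x : R, g1 (to_completion x) = g2 (to_completion x)) -> g1 =1 g2.
Proof.
move=> c1 c2 e z; apply/eqP; rewrite -subr_eq0; apply/eqP; apply: (cf_sep hK) => n.
have [m1 h1] := c1 n; have [m2 h2] := c2 n.
have [x hx] := completion_dense (maxn m1 m2) z.
have -> : g1 z - g2 z = g1 (z - to_completion x) - g2 (z - to_completion x).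
  by rewrite !rmorphB e; ring.
have hC := completion_complete R.
apply: (ideal_B (cf_ideal hK n)); [apply: h1|apply: h2]; apply: cf_le hx => //.
  exact: leq_maxl.
exact: leq_maxr.
Qed.

Hypothesis noeR : noetherian R.

Lemma completion_filt_exp n z : completion_filt n z ->
  ideal_exp [set` maxid (completion R)] n.+1 z.
Proof.
rewrite -(completion_reprK z); set a : coherent_seq R := repr z => /completion_filtE an.
have [s sE] := noeR (is_ideal_exp [set` maxid R] n.+1).
have dec j y : ideal_exp [set` maxid R] (j + n.+1) y ->
    exists2 c, (forall i, ideal_exp [set` maxid R] j (c i)) & y = lincomb c s.
  by move=> /ideal_expD; rewrite sE; apply: ideal_mul_seq; exact: is_ideal_exp.
have [d0 _ d0E] := dec 0%N _ an.
have /choice[d hd] j : exists c, (forall i, ideal_exp [set` maxid R] j (c i)) /\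
    a (n + j).+1 - a (n + j)%N = lincomb c s.
  have [|c hc cE] := dec j (a (n + j).+1 - a (n + j)%N); last by exists c.
  by rewrite addnC addSn; exact: coherent_seqP.
pose e i j := d0 i + \sum_(l < j.+1) d l i.
have eE j : lincomb (e ^~ j) s = a (n + j).+1.
  elim: j => [|j IHj].
    rewrite -[a (n + 0).+1](subrK (a (n + 0)%N)) (proj2 (hd 0%N)) addn0 d0E.
    by rewrite -big_split /=; apply: eq_bigr => i _; rewrite /e big_ord1; ring.
  rewrite -[a (n + j.+1).+1](subrK (a (n + j.+1)%N)) (proj2 (hd j.+1)) addnS -IHj.
  by rewrite -big_split /=; apply: eq_bigr => i _; rewrite /e [in LHS]big_ord_recr /=;
    ring.
have ce i : e i \in @coherent R.
  apply/asboolP => j; rewrite /e big_ord_recr /=.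
  set q := \sum_(_ < _) _; have -> : d0 i + (q + d j.+1 i) - (d0 i + q)
    = d j.+1 i by ring.
  by case: (hd j.+1) => h _; exact: h.
pose E i := CoherentSeq (ce i).
have jump k j : ideal_exp [set` maxid R] k.+1 (a (k + j)%N - a k).
  have hm := is_ideal_exp [set` maxid R] k.+1.
  elim: j => [|j IHj]; first by rewrite addn0 subrr; apply: ideal_0.
  have -> : a (k + j.+1)%N - a k = (a (k + j).+1 - a (k + j)%N) + (a (k + j)%N - a k).
    by rewrite addnS; ring.
  apply: (ideal_D hm) => //; have := @coherent_seqP R a (k + j).
  by apply: ideal_exp_le; rewrite ltnS leq_addr.
have -> : completion_pi a = \sum_(i < size s) to_completion s`_i * completion_pi (E i).
  transitivity (completion_pi (\sum_(i < size s) CoherentSeq (const_coherent s`_i)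
    * E i)).
    apply/completion_pi_eq => k.
    have -> : (\sum_(i < size s) CoherentSeq (const_coherent s`_i) * E i)
      k = a (n + k).+1.
      rewrite -eE /lincomb; elim/big_rec2: _ => [//|i y1 y2 _ <-].
      by rewrite mulrC.
    rewrite -opprB; apply: (ideal_N (is_ideal_exp _ _)).
    by rewrite addnC -addnS.
  by rewrite rmorph_sum; apply: eq_bigr => i _; rewrite rmorphM.
apply: ideal_sum => [|i _]; first exact: is_ideal_exp.
apply: (ideal_Mr (is_ideal_exp _ _)).
apply: (@exp_image _ _ (@to_completion R : {rmorphism _ -> _}) [set` maxid R]).
  by move=> x; exact: to_completion_maxid.
by rewrite sE; apply: sub_ideal_span => /=; apply: mem_nth.
Qed.

Lemma noetherian_completion_hom_eq (g1 g2 : localHom (completion R) Z) :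
  (forall x : R, g1 (to_completion x) = g2 (to_completion x)) -> g1 =1 g2.
Proof.
have c (g : localHom (completion R) Z) n :
    exists m, forall z, completion_filt m z -> K n (g z).
  exists n => z /completion_filt_exp h; apply: (cf_exp hK).
  by apply: exp_image h => y; exact: local_hom_maxid.
exact: (completion_hom_eq (c g1) (c g2)).
Qed.

End CompletionExtension.

Section QuadFiltration.
Variables (Z : localRingType) (K : nat -> set Z) (r : Z) (rm : r \in maxid Z).
Hypothesis hK : complete_filtered K.
Notation Q := (lquad rm).

(* The powers of the maximal ideal (m, root) of Q interlace with pairs of
   terms of the filtration of Z because root ^ 2 lies in m. *)
Definition lquad_filt n : set Q :=
  [set y | K n./2 y.1 /\ (n = 0%N \/ K n.-1./2 y.2)].

Lemma lquad_filt_even n (y : Q) : lquad_filt n.*2 y -> K n y.1.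
Proof. by rewrite /lquad_filt /= doubleK => -[]. Qed.

Lemma lquad_filt_odd n (y : Q) : lquad_filt n.*2.+1 y -> K n y.1 /\ K n y.2.
Proof. by rewrite /lquad_filt /= uphalf_double doubleK => -[h1 [|]]. Qed.

Lemma lquad_filtS n (y : Q) :
  lquad_filt n.+1 y <-> K (uphalf n) y.1 /\ K n./2 y.2.
Proof. by rewrite /lquad_filt /=; split=> [[h [|]]|[h h']] //; split=> //; right. Qed.

Lemma lquad_complete : complete_filtered lquad_filt.
Proof.
have hi := cf_ideal hK; have le := cf_le hK.
have uh k : (k./2 <= uphalf k)%N by rewrite uphalf_half leq_addl.
have hu k : (uphalf k <= k./2.+1)%N by rewrite uphalf_half; case: (odd k);
  rewrite ?add1n// add0n leqnSn.
split.
- case=> [|n]; split.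
  + by split; [apply: ideal_0|left].
  + move=> a u v [u1 _] [v1 _]; split; last by left.
    change (K 0%N (a.1 * u.1 + r * a.2 * u.2 + v.1)); rewrite (cf_maxid hK) in u1 v1 *.
    have hm := is_ideal_idealr (maxid Z).
    by apply: (ideal_D hm) => //; apply: (ideal_D hm); [apply: (ideal_Ml hm)|
      apply: (ideal_Mr hm); apply: (ideal_Mr hm)].
  + by apply/lquad_filtS; split; apply: ideal_0.
  + move=> a u v /lquad_filtS[u1 u2] /lquad_filtS[v1 v2]; apply/lquad_filtS.
    split; first change (K (uphalf n) (a.1 * u.1 + r * a.2 * u.2 + v.1)).
      apply: (ideal_D (hi _)) => //; apply: (ideal_D (hi _));
        first exact: (ideal_Ml (hi _)).
      have -> : r * a.2 * u.2 = a.2 * (r * u.2) by ring.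
      by apply: (ideal_Ml (hi _)); apply: (le _ _ (hu n)); apply: cf_mul hK _ _ _ rm u2.
    change (K n./2 (a.1 * u.2 + a.2 * u.1 + v.2)).
    apply: (ideal_D (hi _)) => //; apply: (ideal_D (hi _));
      apply: (ideal_Ml (hi _)) => //.
    exact: (le _ _ (uh n)).
- move=> n y /lquad_filtS[h1 h2]; split; first exact: (le _ _ (uh n)).
  by case: n h1 h2 => [|n] h1 h2; [left|right; apply: (le _ _ (uh n))].
- apply/seteqP; split=> y /=; first by case=> h _; move: h; rewrite /= (cf_maxid hK).
  by move=> h; split; [rewrite /= (cf_maxid hK)|left].
- move=> n a b am hb; apply/lquad_filtS.
  change (K (uphalf n) (a.1 * b.1 + r * a.2 * b.2) /\ K n./2 (a.1 * b.2 + a.2 * b.1)).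
  have {}am : a.1 \in maxid Z by [].
  have hm := is_ideal_idealr (maxid Z).
  case: n hb => [|n] hb.
    case: hb; rewrite (cf_maxid hK) => b1 _; split; apply: (ideal_D hm).
    - exact: (ideal_Ml hm).
    - by apply: (ideal_Mr hm); apply: (ideal_Mr hm).
    - exact: (ideal_Mr hm).
    - exact: (ideal_Ml hm).
  have /lquad_filtS[b1 b2] := hb; split; apply: (ideal_D (hi _)).
  - by apply: (le _ (uphalf n).+1); [exact: uh|apply: cf_mul hK _ _ _ am b1].
  - have -> : r * a.2 * b.2 = a.2 * (r * b.2) by ring.
    by apply: (ideal_Ml (hi _)); apply: cf_mul hK _ _ _ rm b2.
  - by apply: (le _ _ (hu n)); apply: cf_mul hK _ _ _ am b2.
  - exact: (ideal_Ml (hi _)).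
- move=> y hy; have y1 : y.1 = 0 by apply: (cf_sep hK) => n; apply: lquad_filt_even.
  have y2 : y.2 = 0 by apply: (cf_sep hK) => n; case: (lquad_filt_odd (hy n.*2.+1)).
  by case: y y1 y2 {hy} => a b /= -> ->.
move=> u hu'.
have e n : K n ((u n.*2.+1).1 - (u n.*2).1) by apply: (lquad_filt_even (hu' n.*2)).
have o1 n : K n ((u n.*2.+2).1 - (u n.*2.+1).1) by case: (lquad_filt_odd (hu' n.*2.+1)).
have o2 n : K n ((u n.*2.+2).2 - (u n.*2.+1).2) by case: (lquad_filt_odd (hu' n.*2.+1)).
have e2 n : K n ((u n.*2.+3).2 - (u n.*2.+2).2).
  by have /lquad_filtS[_] := hu' n.*2.+2; rewrite /= uphalf_double.
have [|z1 hz1] := @cf_lim _ _ hK (fun n => (u n.*2).1).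
  move=> n; have -> : (u n.+1.*2).1 - (u n.*2).1 =
    ((u n.*2.+2).1 - (u n.*2.+1).1) + ((u n.*2.+1).1 - (u n.*2).1) by rewrite doubleS;
      ring.
  exact: (ideal_D (hi _)).
have [|z2 hz2] := @cf_lim _ _ hK (fun n => (u n.*2.+1).2).
  move=> n; have -> : (u n.+1.*2.+1).2 - (u n.*2.+1).2 =
    ((u n.*2.+3).2 - (u n.*2.+2).2) + ((u n.*2.+2).2 - (u n.*2.+1).2)
      by rewrite doubleS; ring.
  exact: (ideal_D (hi _)).
exists ((z1, z2) : Q) => n.
have h1 k : K k (z1 - (u k.*2.+1).1).
  have -> : z1 - (u k.*2.+1).1 = (z1 - (u k.*2).1) - ((u k.*2.+1).1 - (u k.*2).1) by ring.
  exact: (ideal_B (hi _)).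
have h2 k : K k (z2 - (u k.*2.+2).2).
  have -> : z2 - (u k.*2.+2).2 = (z2 - (u k.*2.+1).2) - ((u k.*2.+2).2 - (u k.*2.+1).2)
    by ring.
  exact: (ideal_B (hi _)).
split.
  change (K n./2 (z1 - (u n).1)); rewrite -{2}[n]odd_double_half.
  by case: (odd n); [exact: h1|exact: hz1].
case: n => [|n]; [by left|right]; change (K n./2 (z2 - (u n.+1).2)).
rewrite -{2}[n]odd_double_half; by case: (odd n); [exact: h2|exact: hz2].
Qed.

End QuadFiltration.

Section ResidueMaps.

Lemma residue_map_surj (A B : localRingType) (f : localHom A B) :
  (forall b, exists a, b - f a \in maxid B) ->
  forall y, exists x, residue_map f x = y.
Proof.
move=> h y; rewrite -[y]res_surj; have [a ha] := h (repr y).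
by exists (res a); rewrite residue_mapE; apply/esym/res_eqP.
Qed.

Lemma residue_map_comp (A B C : localRingType) (g : localHom B C) (f : localHom A B) x :
  residue_map (g \o f) x = residue_map g (residue_map f x).
Proof. by rewrite -[x]res_surj !residue_mapE. Qed.

Lemma strictly_henselian_along (A B : localRingType) (f : localHom A B) :
  (forall b, exists a, b - f a \in maxid B) ->
  strictly_henselian A -> henselian B -> strictly_henselian B.
Proof.
move=> h [_ sA] hB; split=> //.
exact: (separably_closed_surj (i := residue_map f) (residue_map_surj h) sA).
Qed.

Lemma completion_surj (S : localRingType) (z : completion S) :
  exists a, z - to_completion a \in maxid (completion S).
Proof.
have [a ha] := completion_dense 0 z; exists a.
by have := cf_maxid (completion_complete S) => e; rewrite e in ha.
Qed.

Lemma completion_strictly_henselian (S : localRingType) :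
  strictly_henselian S -> strictly_henselian (completion S).
Proof.
move=> hS; apply: (@strictly_henselian_along _ _ (@to_completion S)) => //.
  exact: completion_surj.
exact: cf_henselian (completion_complete S).
Qed.

Section LquadResidue.
Variables (Z : localRingType) (r : Z) (rm : r \in maxid Z).

Lemma lquad_surj (y : lquad rm) : exists a, y - lquad_inc rm a \in maxid (lquad rm).
Proof.
exists y.1; have ext := lquad_ext rm.
have {1}-> : y = lquad_inc rm y.1 + lquad_inc rm y.2 * lquad_root rm by exact:
  quad_decomp.
by rewrite addrC addKr idealMr// (quad_x_maxid ext rm).
Qed.

Lemma lquad_strictly_henselian (K : nat -> set Z) : complete_filtered K ->
  strictly_henselian Z -> strictly_henselian (lquad rm).
Proof.
move=> hK hZ; apply: (@strictly_henselian_along _ _ (@lquad_inc _ _ rm)) => //.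
  exact: lquad_surj.
exact: cf_henselian (lquad_complete rm hK).
Qed.

Variables (W : localRingType) (g : localHom Z W) (t : W).
Hypothesis t2 : t ^+ 2 = g r.

Definition lquad_lift of t ^+ 2 = g r : lquad rm -> W := fun y => g y.1 + g y.2 * t.
Notation lift := (lquad_lift t2).

Lemma lquad_lift_zmod : zmod_morphism lift.
Proof. by move=> y z; rewrite /lquad_lift !rmorphB; ring. Qed.

Lemma lquad_lift_monoid : monoid_morphism lift.
Proof.
split; first by rewrite /lquad_lift rmorph1 rmorph0 mul0r addr0.
move=> y z; rewrite /lquad_lift.
have -> : (y * z).1 = y.1 * z.1 + r * y.2 * z.2 by [].
have -> : (y * z).2 = y.1 * z.2 + y.2 * z.1 by [].
by rewrite !rmorphD !rmorphM /= -t2; ring.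
Qed.

Lemma lquad_lift_maxid y : y \in maxid (lquad rm) -> lift y \in maxid W.
Proof.
move=> ym; rewrite rpredD//; first exact: local_hom_maxid.
rewrite idealMr//; have : t * t \in maxid W by rewrite -expr2 t2 local_hom_maxid.
by rewrite maxid_prime orbb.
Qed.

HB.instance Definition _ := GRing.isZmodMorphism.Build _ _ lift lquad_lift_zmod.
HB.instance Definition _ := GRing.isMonoidMorphism.Build _ _ lift lquad_lift_monoid.
HB.instance Definition _ := isLocalHom.Build _ _ lift lquad_lift_maxid.

Definition lquad_lifth : localHom (lquad rm) W := lift.

Lemma lquad_lift_inc a : lquad_lifth (lquad_inc rm a) = g a.
Proof. by rewrite /= /lquad_lift /= rmorph0 mul0r addr0. Qed.

Lemma lquad_lift_root : lquad_lifth (lquad_root rm) = t.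
Proof. by rewrite /= /lquad_lift /= rmorph0 rmorph1 add0r mul1r. Qed.

End LquadResidue.

End ResidueMaps.

Section DaggerQuad.
Variables (A : localRingType) (r : A) (rm : r \in maxid A).
Hypothesis noeA : noetherian A.
Notation B := (lquad rm).

Definition completion_inc : localHom (completion A) (completion B) :=
  completion_exth (completion_complete B) (@to_completion B \o @lquad_inc A r rm).

Lemma completion_incE a :
  completion_inc (to_completion a) = to_completion (lquad_inc rm a).
Proof. exact: (completion_extE (completion_complete B)). Qed.

Variables (S S' : localRingType).
Variables (f : localHom (completion A) S) (f' : localHom (completion B) S').
Hypotheses (hf : is_strict_henselization f) (hf' : is_strict_henselization f').
Variables (al : {rmorphism residue S -> residue S'}).
Variables (be : {rmorphism residue S' -> residue S}).
Hypotheses (alK : cancel al be) (beK : cancel be al).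
Hypothesis alE : al \o residue_map f =1 residue_map (f' \o completion_inc).
Notation T := (completion S).
Notation T' := (completion S').

(* Maps between T' and the quadratic extension of T exist by the universal
   properties of S' and S, both targets being complete and hence henselian;
   they are mutually inverse because a local homomorphism from the completion
   of a noetherian ring is continuous, hence determined on that ring. *)
Lemma dagger_quad_ext : exists (g : localHom T T') (t : T'),
  quad_ext (g : {rmorphism T -> T'}) (to_completion (f (to_completion r))) t /\
  forall a, g (to_completion (f (to_completion a))) =
    to_completion (f' (to_completion (lquad_inc rm a))).
Proof.
have noeB : noetherian B by exact: quad_noetherian (lquad_ext rm) noeA.
have hT := completion_complete S; have hT' := completion_complete S'.
have [shS _ univS] := hf; have [shS' _ univS'] := hf'.
have [h [[hfE hres] _]] := univS _ (f' \o completion_inc) al shS' alE.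
pose Phi1 : localHom T T' := completion_exth hT' (@to_completion S' \o h).
have Phi1E s : Phi1 (to_completion s) = to_completion (h s)
  by exact: (completion_extE hT').
have Phi1A a : Phi1 (to_completion (f (to_completion a))) =
    to_completion (f' (to_completion (lquad_inc rm a))).
  rewrite Phi1E; have -> : h (f (to_completion a))
    = f' (completion_inc (to_completion a)).
    exact: hfE.
  by rewrite completion_incE.
pose rT : T := to_completion (f (to_completion r)).
have rTm : rT \in maxid T by do 3?apply: local_hom_maxid.
pose t : T' := to_completion (f' (to_completion (lquad_root rm))).
have t2 : t ^+ 2 = Phi1 rT.
  by rewrite Phi1A -!rmorphXn; case: (lquad_ext rm) => ->.
pose Z := lquad rTm.
pose Phi : localHom Z T' := @lquad_lifth _ _ rTm _ Phi1 t t2.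
have PhiI y : Phi (lquad_inc rTm y) = Phi1 y by exact: lquad_lift_inc.
have PhiR : Phi (lquad_root rTm) = t by exact: lquad_lift_root.
have hZ := lquad_complete rTm hT.
have shT := completion_strictly_henselian shS;
  have shT' := completion_strictly_henselian shS'.
have shZ : strictly_henselian Z by exact: lquad_strictly_henselian hT shT.
pose iS : localHom S Z := @lquad_inc _ _ rTm \o @to_completion S.
pose Psi0A : localHom A Z := iS \o (f \o @to_completion A).
have Psi0r : lquad_root rTm ^+ 2 = Psi0A r by case: (lquad_ext rTm) => ->.
pose Psi0 : localHom B Z := @lquad_lifth _ _ rm _ Psi0A _ Psi0r.
pose Psi1 : localHom (completion B) Z := completion_exth hZ Psi0.
have Psi1E b : Psi1 (to_completion b) = Psi0 b by exact: (completion_extE hZ).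
have Psi1u a : Psi1 (completion_inc (to_completion a)) = iS (f (to_completion a)).
  by rewrite completion_incE Psi1E; exact: lquad_lift_inc.
have uE : Psi1 \o completion_inc =1 iS \o f.
  by apply: (noetherian_completion_hom_eq hZ noeA) => a; exact: Psi1u.
pose ga : {rmorphism residue S' -> residue Z} := residue_map iS \o be.
have gaal s : ga (al s) = residue_map iS s by rewrite /ga /= alK.
have gaE : ga \o residue_map f' =1 residue_map Psi1.
  move=> y; have [x <-] : exists x, residue_map completion_inc x = y.
    apply: residue_map_surj => z; have [b hb] := completion_surj z.
    have [a ha] := lquad_surj b; exists (to_completion a); rewrite completion_incE.
    rewrite -[z](subrK (to_completion b)) -addrA rpredD//.
    by have := to_completion_maxid ha; rewrite rmorphB.
  rewrite -[x]res_surj; set w := repr x.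
  have e : residue_map f' (residue_map completion_inc (res w)) = al (res (f w)).
    by rewrite -residue_map_comp -alE /= residue_mapE.
  rewrite -[LHS]/(ga (residue_map f' (residue_map completion_inc (res w)))).
  by rewrite e gaal !residue_mapE; congr (res _); exact: esym (uE w).
have [Psi2 [[Psi2E Psi2res] _]] := univS' _ Psi1 ga shZ gaE.
pose Psi3 : localHom T' Z := completion_exth hZ Psi2.
have Psi3E s : Psi3 (to_completion s) = Psi2 s by exact: (completion_extE hZ).
have Phi_cont n : exists m, forall z,
  completion_filt m z -> completion_filt n (Phi (Psi3 z)).
  exists n.*2.+1 => z hz; have [h1 h2] := lquad_filt_odd (completion_ext_filt hZ Psi2 hz).
  apply: (ideal_D (cf_ideal hT' n)); first exact: (completion_ext_filt hT' _ h1).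
  apply: (ideal_Mr (cf_ideal hT' n)); exact: (completion_ext_filt hT' _ h2).
have Psi2h s : res (Psi2 (h s)) = res (iS s).
  by rewrite -!residue_mapE Psi2res hres gaal.
have PhiPsi2 : Phi \o Psi2 =1 @to_completion S'.
  have [k [_ kuniq]] := univS' T' (@to_completion S' \o f')
    (residue_map (@to_completion S'))
     shT' (fun x => esym (residue_map_comp _ _ x)).
  have e1 : (Phi \o Psi2) \o f' =1 @to_completion S' \o f'.
    move=> z; transitivity ((Phi \o Psi1) z); first by rewrite /= -(Psi2E z).
    move: z; apply: (noetherian_completion_hom_eq hT' noeB) => b.
    rewrite -[LHS]/(Phi (Psi1 (to_completion b))) Psi1E.
    have -> : Phi (Psi0 b) = Phi (Psi0A b.1) + Phi (Psi0A b.2) * Phi (lquad_root rTm).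
      by rewrite -rmorphM -rmorphD.
    rewrite PhiR -[Psi0A b.1]/(lquad_inc rTm _) -[Psi0A b.2]/(lquad_inc rTm _)
      !PhiI !Phi1A.
    by rewrite -!rmorphM -!rmorphD; congr (to_completion (f' (to_completion _)));
      exact/esym/quad_decomp.
  have e2 : residue_map (Phi \o Psi2) =1 residue_map (@to_completion S').
    move=> y; rewrite -[y]beK -[be y]res_surj; set s := repr (be y).
    have -> : al (res s) = res (h s) by rewrite -residue_mapE hres.
    rewrite !residue_mapE; transitivity (residue_map Phi (res (Psi2 (h s)))).
      by rewrite residue_mapE.
    rewrite Psi2h residue_mapE; congr (res _).
    change (Phi (lquad_inc rTm (to_completion s)) = to_completion (h s)).
    by rewrite PhiI Phi1E.
  by move=> s; rewrite (kuniq _ e1 e2) -(kuniq (@to_completion S')).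
have PhiPsi : Phi \o Psi3 =1 id.
  apply: (@completion_hom_eq _ _ _ hT' (Phi \o Psi3) idfun) => //.
    by move=> n; exists n.
  by move=> s; rewrite -[LHS]/(Phi (Psi3 (to_completion s))) Psi3E; exact: PhiPsi2.
have PsiPhi1 : Psi3 \o Phi1 =1 lquad_inc rTm.
  apply: (completion_hom_eq hZ) => [n|n|s].
  - exists n => z hz; apply: (completion_ext_filt hZ).
    exact: (completion_ext_filt hT').
  - exists n => z hz; rewrite /lquad_filt.
    have hT'' := cf_le hT; split; first by apply: hT'' hz;
      rewrite -{2}[n]odd_double_half -addnn addnA leq_addl.
    by right; apply: ideal_0; exact: cf_ideal hT _.
  rewrite -[LHS]/(Psi3 (Phi1 (to_completion s))) Phi1E Psi3E.
  have [k [_ kuniq]] := univS Z (iS \o f) (residue_map iS) shZ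
    (fun x => esym (residue_map_comp _ _ x)).
  have e1 : (Psi2 \o h) \o f =1 iS \o f.
    move=> z; rewrite -[LHS]/(Psi2 ((h \o f) z)) hfE -[LHS]/((Psi2 \o f')
      (completion_inc z)).
    by rewrite Psi2E; exact: uE.
  have e2 : residue_map (Psi2 \o h) =1 residue_map iS.
    by move=> y; rewrite -[y]res_surj !residue_mapE; exact: Psi2h.
  by have := kuniq _ e1 e2 s; rewrite -(kuniq iS).
have PsiPhi z : Psi3 (Phi z) = z.
  have E y : Psi3 (Phi1 y) = lquad_inc rTm y by exact: PsiPhi1.
  have -> : Psi3 (Phi z) = Psi3 (Phi1 z.1) + Psi3 (Phi1 z.2) * Psi3 t.
    by rewrite -rmorphM -rmorphD.
  rewrite !E; have -> : Psi3 t = lquad_root rTm.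
    rewrite Psi3E; have -> : Psi2 (f' (to_completion (lquad_root rm)))
      = Psi1 (to_completion (lquad_root rm)).
      exact: Psi2E.
    by rewrite Psi1E; exact: lquad_lift_root.
  exact/esym/quad_decomp.
exists Phi1, t; split; last exact: Phi1A.
split=> //.
  move=> y; exists (Psi3 y).1, (Psi3 y).2; exact: esym (PhiPsi y).
move=> a b e; have : Psi3 (Phi ((a, b) : Z)) = 0.
  have -> : Phi ((a, b) : Z) = Phi1 a + Phi1 b * t by [].
  by rewrite e rmorph0.
by rewrite PsiPhi => -[-> ->].
Qed.

End DaggerQuad.

(** * Strict henselization *)

Lemma separable_simple_root (F : fieldType) (p : {poly F}) a :
  separable_poly p -> root p a -> ~~ root p^`() a.
Proof. by rewrite unlock => /coprimep_root h /h. Qed.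

Lemma monic_separable_root (k L : fieldType) (i : {rmorphism k -> L}) a :
  separable_algebraic i -> exists p : {poly k},
  [/\ p \is monic, separable_poly p & root (map_poly i p) a].
Proof.
move=> /(_ a)[p sp pa]; have p0 := separable_poly_neq0 sp.
have l0 : (lead_coef p)^-1 != 0 by rewrite invr_eq0 lead_coef_eq0.
exists ((lead_coef p)^-1 *: p); split.
- by rewrite monicE lead_coefZ mulVf// lead_coef_eq0.
- by rewrite (eqp_separable (eqp_scale _ l0)).
- by rewrite map_polyZ rootZ// fmorph_eq0.
Qed.

Section MonicPolynomials.
Variable R : comNzRingType.

Definition monic_poly n (c : nat -> R) : {poly R} := 'X^n + \poly_(j < n) c j.

Lemma monic_polyP n c : monic_poly n c \is monic.
Proof.
rewrite monicE /monic_poly lead_coefDl ?lead_coefXn//.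
by rewrite size_polyXn ltnS size_poly.
Qed.

Lemma monic_polyE (p : {poly R}) :
  p \is monic -> p = monic_poly (size p).-1 (fun j => p`_j).
Proof.
move=> pm; apply/polyP => j; rewrite coefD coefXn coef_poly.
have sp : (0 < size p)%N by rewrite size_poly_gt0 monic_neq0.
case: (ltngtP j (size p).-1) => jp.
- by rewrite add0r.
- by rewrite addr0 nth_default// -(prednK sp).
- by rewrite addr0 jp; apply/eqP; rewrite -monicE.
Qed.

Lemma eq_monic_poly n (c d : nat -> R) : c =1 d -> monic_poly n c = monic_poly n d.
Proof. by move=> cd; congr (_ + _); apply: eq_poly => j _; rewrite cd. Qed.

End MonicPolynomials.

Lemma map_monic_poly (R R' : comNzRingType) (g : {rmorphism R -> R'}) n c :
  map_poly g (monic_poly n c) = monic_poly n (g \o c).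
Proof.
apply/polyP => j; rewrite coef_map /monic_poly !coefD !coefXn !coef_poly.
rewrite [LHS](rmorphD g) rmorph_nat.
by congr (_ + _); case: ifP => // _; rewrite rmorph0.
Qed.

Section StrictHenselization.
Variables (C : localRingType) (L : fieldType) (i : {rmorphism residue C -> L}).

(* A term denotes an element of every strictly henselian local C-algebra whose
   residue field is an extension of L: [SHRoot n c a] is the root with residue a of the
   monic polynomial with coefficients c if a is a simple root modulo the maximal
   ideal, and 0 otherwise. The strict henselization is the ring of terms
   modulo equality of all denotations. *)
Inductive sh_term : Type :=
  | SHConst of C
  | SHAdd of sh_term & sh_term
  | SHOpp of sh_term
  | SHMul of sh_term & sh_term
  | SHInv of sh_term
  | SHRoot (n : nat) of (nat -> sh_term) & L.

Record sh_model := SHModel {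
  shm_ring : localRingType;
  shm_map : localHom C shm_ring;
  shm_res : {rmorphism L -> residue shm_ring};
  shm_henselian : henselian shm_ring;
  shm_mapE : shm_res \o i =1 residue_map shm_map }.

Definition simple_root_in (R : localRingType) (p : {poly R}) (b : residue R) : set R :=
  [set y | [/\ p.[y] = 0, res y = b & p^`().[y] \notin maxid R]].

Fixpoint sh_ev (t : sh_term) : L :=
  match t with
  | SHConst c => i (res c)
  | SHAdd t u => sh_ev t + sh_ev u
  | SHOpp t => - sh_ev t
  | SHMul t u => sh_ev t * sh_ev u
  | SHInv t => (sh_ev t)^-1
  | SHRoot n c a =>
      let p := monic_poly n (fun j => sh_ev (c j)) in
      if root p a && ~~ root p^`() a then a else 0
  end.

Fixpoint sh_interp (M : sh_model) (t : sh_term) : shm_ring M :=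
  match t with
  | SHConst c => shm_map M c
  | SHAdd t u => sh_interp M t + sh_interp M u
  | SHOpp t => - sh_interp M t
  | SHMul t u => sh_interp M t * sh_interp M u
  | SHInv t => xget 0 [set y | sh_interp M t * y = 1]
  | SHRoot n c a =>
      xget 0 (simple_root_in (monic_poly n (fun j => sh_interp M (c j))) (shm_res M a))
  end.

Lemma sh_root_interp (M : sh_model) n c a :
  (forall j, res (sh_interp M (c j)) = shm_res M (sh_ev (c j))) ->
  let p := monic_poly n (fun j => sh_ev (c j)) in
  let q := monic_poly n (fun j => sh_interp M (c j)) in
  if root p a && ~~ root p^`() a then
    simple_root_in q (shm_res M a) (sh_interp M (SHRoot n c a))
  else sh_interp M (SHRoot n c a) = 0.
Proof.
move=> IH p q.
have pq : map_poly (@res (shm_ring M)) q = map_poly (shm_res M) p.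
  by rewrite !map_monic_poly; apply: eq_monic_poly => j /=.
have rp b : root (map_poly (@res (shm_ring M)) q) (shm_res M b) = root p b.
  by rewrite pq fmorph_root.
have rdp b : root (map_poly (@res (shm_ring M)) q)^`() (shm_res M b) = root p^`() b.
  by rewrite pq deriv_map fmorph_root.
case: ifPn => [/andP[pa dpa]|npa].
  rewrite /= -/q; case: xgetP => [y _ //|].
  have [||y /rootP qy ya] := @shm_henselian M q (shm_res M a) (monic_polyP _ _).
  - by rewrite rp.
  - by rewrite rdp.
  move=> /(_ y)[]; split=> //; apply: contra dpa => h.
  by rewrite -rdp -ya rootE deriv_map horner_res res_eq0.
rewrite /= -/q; case: xgetP => [y _ [qy ya dqy]|//]; case/negP: npa.
rewrite -rp -rdp -ya !rootE deriv_map !horner_res !res_eq0 qy dqy.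
by rewrite rpred0.
Qed.

Lemma sh_res_interp (M : sh_model) t : res (sh_interp M t) = shm_res M (sh_ev t).
Proof.
elim: t => [c|t IHt u IHu|t IHt|t IHt u IHu|t IHt|n c IHc a] /=.
- by rewrite -residue_mapE -shm_mapE.
- by rewrite !rmorphD /= IHt IHu.
- by rewrite !rmorphN /= IHt.
- by rewrite !rmorphM /= IHt IHu.
- rewrite fmorphV -IHt; case: xgetP => [y _ /= ty|nt].
    have /eqP : res (sh_interp M t) * res y = 1 by rewrite -rmorphM ty rmorph1.
    move=> e; have t0 : res (sh_interp M t) != 0.
      by apply: contraTneq e => ->; rewrite mul0r eq_sym oner_eq0.
    by apply: (mulfI t0); rewrite divff//; apply/eqP.
  case: (boolP (sh_interp M t \in maxid (shm_ring M))) => [|/maxid_unitE[y ty]].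
    by rewrite -res_eq0 => /eqP ->; rewrite invr0 rmorph0.
  by case: (nt y).
have := @sh_root_interp M n c a IHc; rewrite /=.
by case: ifP => _; [case|move=> ->; rewrite !rmorph0].
Qed.

Definition sh_equiv (t u : sh_term) : Prop :=
  sh_ev t = sh_ev u /\ forall M, sh_interp M t = sh_interp M u.

Definition sh_rel : rel sh_term := fun t u => `[< sh_equiv t u >].

Lemma sh_rel_equiv : equiv_class_of sh_rel.
Proof.
split=> [t|t u|u t v]; first exact/asboolP.
  by apply/asboolP/asboolP => -[h1 h2]; split.
by move=> /asboolP[h1 h2] /asboolP[k1 k2]; apply/asboolP; split=> [|M];
  rewrite ?h1// h2.
Qed.

HB.instance Definition _ := gen_eqMixin sh_term.
HB.instance Definition _ := gen_choiceMixin sh_term.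
Canonical sh_rel_equivRel := EquivRelPack sh_rel_equiv.
Canonical sh_rel_encModRel := defaultEncModRel sh_rel.

Definition sh_ring : Type := {eq_quot sh_rel}.
HB.instance Definition _ := Choice.on sh_ring.

Definition sh_pi (t : sh_term) : sh_ring := \pi_{eq_quot sh_rel} t.
Definition sh_repr (x : sh_ring) : sh_term := repr (x : {eq_quot sh_rel}).

Lemma sh_reprK x : sh_pi (sh_repr x) = x. Proof. exact: reprK. Qed.

Lemma sh_pi_eq t u : sh_pi t = sh_pi u <-> sh_equiv t u.
Proof. by split=> [/eqmodP/asboolP|h] //; apply/eqmodP/asboolP. Qed.

Definition shq_ev (x : sh_ring) : L := sh_ev (sh_repr x).
Definition shq_interp M (x : sh_ring) : shm_ring M := sh_interp M (sh_repr x).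

Lemma shq_evE t : shq_ev (sh_pi t) = sh_ev t.
Proof. by have /sh_pi_eq[] := sh_reprK (sh_pi t). Qed.

Lemma shq_interpE M t : shq_interp M (sh_pi t) = sh_interp M t.
Proof. by have /sh_pi_eq[] := sh_reprK (sh_pi t). Qed.

Lemma sh_ext (x y : sh_ring) : shq_ev x = shq_ev y ->
  (forall M, shq_interp M x = shq_interp M y) -> x = y.
Proof. by move=> e h; rewrite -(sh_reprK x) -(sh_reprK y); apply/sh_pi_eq. Qed.

Definition sh_zero := sh_pi (SHConst 0).
Definition sh_one := sh_pi (SHConst 1).
Definition sh_add x y := sh_pi (SHAdd (sh_repr x) (sh_repr y)).
Definition sh_opp x := sh_pi (SHOpp (sh_repr x)).
Definition sh_mul x y := sh_pi (SHMul (sh_repr x) (sh_repr y)).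

Let ev_zero : shq_ev sh_zero = 0. Proof. by rewrite shq_evE /= !rmorph0. Qed.
Let ev_one : shq_ev sh_one = 1. Proof. by rewrite shq_evE /= !rmorph1. Qed.
Let ev_add x y : shq_ev (sh_add x y) = shq_ev x + shq_ev y.
Proof. by rewrite shq_evE. Qed.
Let ev_opp x : shq_ev (sh_opp x) = - shq_ev x.
Proof. by rewrite shq_evE. Qed.
Let ev_mul x y : shq_ev (sh_mul x y) = shq_ev x * shq_ev y.
Proof. by rewrite shq_evE. Qed.
Let int_zero M : shq_interp M sh_zero = 0. Proof. by rewrite shq_interpE /= rmorph0. Qed.
Let int_one M : shq_interp M sh_one = 1. Proof. by rewrite shq_interpE /= rmorph1. Qed.
Let int_add M x y : shq_interp M (sh_add x y) = shq_interp M x + shq_interp M y.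
Proof. by rewrite shq_interpE. Qed.
Let int_opp M x : shq_interp M (sh_opp x) = - shq_interp M x.
Proof. by rewrite shq_interpE. Qed.
Let int_mul M x y : shq_interp M (sh_mul x y) = shq_interp M x * shq_interp M y.
Proof. by rewrite shq_interpE. Qed.
Let evE := (ev_zero, ev_one, ev_add, ev_opp, ev_mul).
Let intE := (int_zero, int_one, int_add, int_opp, int_mul).

Lemma sh_addA : associative sh_add.
Proof. by move=> x y z; apply: sh_ext => [|M]; rewrite ?evE ?intE addrA. Qed.
Lemma sh_addC : commutative sh_add.
Proof. by move=> x y; apply: sh_ext => [|M]; rewrite ?evE ?intE addrC. Qed.
Lemma sh_add0 : left_id sh_zero sh_add.
Proof. by move=> x; apply: sh_ext => [|M]; rewrite ?evE ?intE add0r. Qed.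
Lemma sh_addN : left_inverse sh_zero sh_opp sh_add.
Proof. by move=> x; apply: sh_ext => [|M]; rewrite ?evE ?intE addNr. Qed.
HB.instance Definition _ := GRing.isZmodule.Build sh_ring sh_addA sh_addC sh_add0 sh_addN.

Lemma sh_mulA : associative sh_mul.
Proof. by move=> x y z; apply: sh_ext => [|M]; rewrite ?evE ?intE mulrA. Qed.
Lemma sh_mulC : commutative sh_mul.
Proof. by move=> x y; apply: sh_ext => [|M]; rewrite ?evE ?intE mulrC. Qed.
Lemma sh_mul1 : left_id sh_one sh_mul.
Proof. by move=> x; apply: sh_ext => [|M]; rewrite ?evE ?intE mul1r. Qed.
Lemma sh_mulDl : left_distributive sh_mul +%R.
Proof.
by move=> x y z; apply: sh_ext => [|M]; rewrite ?(evE, intE) /= ?(evE, intE) mulrDl.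
Qed.
Lemma sh_one_neq0 : sh_one != 0.
Proof.
apply: contraTneq isT => /(congr1 shq_ev)/eqP.
by rewrite ev_one ev_zero oner_eq0.
Qed.
HB.instance Definition _ := GRing.Zmodule_isComNzRing.Build sh_ring
  sh_mulA sh_mulC sh_mul1 sh_mulDl sh_one_neq0.

Lemma shq_ev_zmod : zmod_morphism shq_ev.
Proof. by move=> x y; rewrite ev_add ev_opp. Qed.
Lemma shq_ev_monoid : monoid_morphism shq_ev.
Proof. by split=> [|x y]; rewrite ?ev_one// ev_mul. Qed.
HB.instance Definition _ := GRing.isZmodMorphism.Build _ _ shq_ev shq_ev_zmod.
HB.instance Definition _ := GRing.isMonoidMorphism.Build _ _ shq_ev shq_ev_monoid.

Lemma shq_interp_zmod M : zmod_morphism (shq_interp M).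
Proof. by move=> x y; rewrite int_add int_opp. Qed.
Lemma shq_interp_monoid M : monoid_morphism (shq_interp M).
Proof. by split=> [|x y]; rewrite ?int_one// int_mul. Qed.
HB.instance Definition _ M := GRing.isZmodMorphism.Build _ _ (shq_interp M)
  (shq_interp_zmod M).
HB.instance Definition _ M := GRing.isMonoidMorphism.Build _ _ (shq_interp M)
  (shq_interp_monoid M).

Definition sh_maxid : {pred sh_ring} := fun x => shq_ev x == 0.

Lemma sh_maxid_closed : idealr_closed sh_maxid.
Proof.
split; first by rewrite unfold_in /sh_maxid rmorph0.
  by rewrite unfold_in /sh_maxid rmorph1 oner_eq0.
move=> a u v /eqP hu /eqP hv; rewrite unfold_in /sh_maxid.
by rewrite rmorphD rmorphM /= hu hv mulr0 addr0.
Qed.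

Lemma shq_interp_inv M t : sh_ev t != 0 -> sh_interp M t * sh_interp M (SHInv t) = 1.
Proof.
move=> t0 /=; case: xgetP => [y _ //|nt].
have /maxid_unitE[y ty] : sh_interp M t \notin maxid (shm_ring M).
  by rewrite -res_eq0 sh_res_interp fmorph_eq0.
by case: (nt y).
Qed.

Lemma sh_pi_inv t : sh_ev t != 0 -> sh_pi t * sh_pi (SHInv t) = 1.
Proof.
move=> t0; apply: sh_ext => [|M].
  by rewrite rmorphM rmorph1 /= !shq_evE /= divff.
by rewrite rmorphM rmorph1 /= !shq_interpE shq_interp_inv.
Qed.

Lemma sh_maxid_unit x : x \notin sh_maxid -> exists y, x * y = 1.
Proof.
by move=> x0; exists (sh_pi (SHInv (sh_repr x))); rewrite -{1}(sh_reprK x) sh_pi_inv.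
Qed.
HB.instance Definition _ := isLocal.Build sh_ring sh_maxid_closed sh_maxid_unit.

Lemma sh_maxidE x : (x \in maxid sh_ring) = (shq_ev x == 0).
Proof. by []. Qed.

Lemma shq_res_interp M x : res (shq_interp M x) = shm_res M (shq_ev x).
Proof. exact: sh_res_interp. Qed.

Lemma shq_interp_maxid M x : x \in maxid sh_ring -> shq_interp M x \in maxid (shm_ring M).
Proof. by rewrite sh_maxidE -res_eq0 shq_res_interp fmorph_eq0. Qed.
HB.instance Definition _ M := isLocalHom.Build _ _ (shq_interp M) (@shq_interp_maxid M).

Definition sh_const (c : C) : sh_ring := sh_pi (SHConst c).

Lemma sh_const_zmod : zmod_morphism sh_const.
Proof.
by move=> x y; apply: sh_ext => [|M];
  rewrite rmorphB /= ?shq_evE ?shq_interpE /= !rmorphB.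
Qed.
Lemma sh_const_monoid : monoid_morphism sh_const.
Proof.
by split=> // x y; apply: sh_ext => [|M];
  rewrite rmorphM /= ?shq_evE ?shq_interpE /= !rmorphM.
Qed.
Lemma sh_const_maxid c : c \in maxid C -> sh_const c \in maxid sh_ring.
Proof. by rewrite sh_maxidE shq_evE /= -res_eq0 => /eqP ->; rewrite rmorph0. Qed.
HB.instance Definition _ := GRing.isZmodMorphism.Build _ _ sh_const sh_const_zmod.
HB.instance Definition _ := GRing.isMonoidMorphism.Build _ _ sh_const sh_const_monoid.
HB.instance Definition _ := isLocalHom.Build _ _ sh_const sh_const_maxid.

Definition sh_residue : {rmorphism residue sh_ring -> L} :=
  @quot_liftr _ _ (maxid sh_ring) shq_ev (fun x => elimTF eqP).

Lemma sh_residueE x : sh_residue (res x) = shq_ev x.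
Proof. exact: (@quot_liftE _ _ (maxid sh_ring) shq_ev (fun x => elimTF eqP)). Qed.

Lemma sh_residue_const : sh_residue \o residue_map sh_const =1 i.
Proof.
move=> y; rewrite -[y]res_surj.
by rewrite -[LHS]/(sh_residue (residue_map sh_const _)) residue_mapE sh_residueE shq_evE.
Qed.

Lemma sh_henselian : henselian sh_ring.
Proof.
apply/henselianP => p x pm px dpx; set n := (size p).-1.
pose t := SHRoot n (fun j => sh_repr p`_j) (shq_ev x).
have evp : monic_poly n (fun j => sh_ev (sh_repr p`_j)) = map_poly shq_ev p.
  by rewrite [in RHS](monic_polyE pm) map_monic_poly.
have intp M : monic_poly n (fun j => sh_interp M (sh_repr p`_j))
  = map_poly (shq_interp M) p.
  by rewrite [in RHS](monic_polyE pm) map_monic_poly.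
have simple : root (map_poly shq_ev p) (shq_ev x) && ~~ root (map_poly shq_ev p)^`()
  (shq_ev x).
  by rewrite !rootE deriv_map !horner_map -!sh_maxidE px.
have evt : sh_ev t = shq_ev x by rewrite /= evp simple.
exists (sh_pi t); last by rewrite sh_maxidE rmorphB /= shq_evE evt subrr.
apply: sh_ext => [|M].
  rewrite -horner_map rmorph0 /= shq_evE evt; apply/rootP.
  by case/andP: simple.
rewrite -horner_map rmorph0 /= shq_interpE.
have := @sh_root_interp M n (fun j => sh_repr p`_j) (shq_ev x)
  (fun j => sh_res_interp M _).
by rewrite /= evp simple intp => -[].
Qed.

Hypotheses (Lsep : separable_algebraic i) (Lclosed : separably_closed L).

Lemma sh_ev_surj a : exists x, shq_ev x = a.
Proof.
have [q [qm sq qa]] := monic_separable_root a Lsep.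
have qsimple : root (map_poly i q) a && ~~ root (map_poly i q)^`() a.
  by rewrite qa separable_simple_root// separable_map.
exists (sh_pi (SHRoot (size q).-1 (fun j => SHConst (repr q`_j)) a)).
rewrite shq_evE /=; have -> : monic_poly (size q).-1 (fun j => i (res (repr q`_j)))
  = map_poly i q.
  rewrite [in RHS](monic_polyE qm) map_monic_poly; apply: eq_monic_poly => j /=.
  by rewrite res_surj.
by rewrite qsimple.
Qed.

Lemma sh_residue_surj a : exists y, sh_residue y = a.
Proof. by have [x <-] := sh_ev_surj a; exists (res x); rewrite sh_residueE. Qed.

Lemma sh_hom_unique M (h : localHom sh_ring (shm_ring M)) :
  h \o sh_const =1 shm_map M ->
  residue_map h =1 shm_res M \o sh_residue -> h =1 shq_interp M.
Proof.
move=> hc hres x; rewrite -(sh_reprK x) shq_interpE.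
have hpi y : res (h y) = shm_res M (shq_ev y).
  rewrite -residue_mapE hres -[LHS]/(shm_res M (sh_residue _)).
  by rewrite sh_residueE.
elim: (sh_repr x) => {x} [c|t IHt u IHu|t IHt|t IHt u IHu|t IHt|n c IHc a].
- exact: hc.
- have -> : sh_pi (SHAdd t u) = sh_pi t + sh_pi u.
    by apply: sh_ext => [|M']; rewrite rmorphD /= ?shq_evE ?shq_interpE.
  by rewrite rmorphD /= IHt IHu.
- have -> : sh_pi (SHOpp t) = - sh_pi t.
    by apply: sh_ext => [|M']; rewrite rmorphN /= ?shq_evE ?shq_interpE.
  by rewrite rmorphN /= IHt.
- have -> : sh_pi (SHMul t u) = sh_pi t * sh_pi u.
    by apply: sh_ext => [|M']; rewrite rmorphM /= ?shq_evE ?shq_interpE.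
  by rewrite rmorphM /= IHt IHu.
- have [t0|t0] := eqVneq (sh_ev t) 0; last first.
    have e1 := shq_interp_inv M t0.
    have e2 : sh_interp M t * h (sh_pi (SHInv t)) = 1.
      by rewrite -IHt -rmorphM sh_pi_inv// rmorph1.
    by rewrite -[LHS]mulr1 -e1 mulrA [h _ * _]mulrC e2 mul1r.
  have z M' : sh_interp M' (SHInv t) = 0.
    rewrite /=; case: xgetP => [y _ /= ty|//].
    have : sh_interp M' t \in maxid (shm_ring M').
      by rewrite -res_eq0 sh_res_interp t0 rmorph0.
    by move=> tm; have := idealr1 (maxid (shm_ring M')); rewrite -ty mulrC idealMr.
  rewrite z; have -> : sh_pi (SHInv t) = 0; last by rewrite rmorph0.
  by apply: sh_ext => [|M']; rewrite rmorph0 ?shq_evE ?shq_interpE ?z//= t0 invr0.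
have := @sh_root_interp M n c a (fun j => sh_res_interp M _).
set p := monic_poly n _; set q := monic_poly n _; rewrite /=.
have all M' := @sh_root_interp M' n c a (fun j => sh_res_interp M' _).
case: ifP => [pa|npa].
  move=> [qy ya dqy]; apply/esym/(hensel_unique qy) => //; last first.
    apply/res_eqP; rewrite ya hpi shq_evE /= -/p pa.
    by [].
  pose F := monic_poly n (fun j => sh_pi (c j)).
  have -> : q = map_poly h F.
    by rewrite map_monic_poly; apply: eq_monic_poly => j /=; rewrite IHc.
  rewrite horner_map /=; have -> : F.[sh_pi (SHRoot n c a)] = 0; last by rewrite rmorph0.
  apply: sh_ext => [|M'].
    rewrite -horner_map rmorph0 map_monic_poly /= shq_evE /= -/p pa; apply/rootP.
    have -> : monic_poly n (shq_ev \o (fun j => sh_pi (c j))) = p.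
      by apply: eq_monic_poly => j /=; rewrite shq_evE.
    by case/andP: pa.
  rewrite -horner_map rmorph0 map_monic_poly /= shq_interpE.
  have := all M'; rewrite /= -/p pa => -[+ _ _]; congr (_.[_] = _).
  by apply: eq_monic_poly => j /=; rewrite shq_interpE.
move=> z; rewrite z; have -> : sh_pi (SHRoot n c a) = 0; last by rewrite rmorph0.
apply: sh_ext => [|M']; rewrite rmorph0 ?shq_evE ?shq_interpE /=.
  by rewrite -/p npa.
by have := all M'; rewrite /= -/p npa.
Qed.

Theorem exists_strict_henselization :
  exists (S : localRingType) (f : localHom C S) (e : {rmorphism residue S -> L}),
    [/\ is_strict_henselization f, forall a, exists y, e y = a
      & e \o residue_map f =1 i].
Proof.
exists sh_ring, sh_const, sh_residue; split;
  [|exact: sh_residue_surj|exact: sh_residue_const].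
have [j [jK Kj]] := exists_field_inv sh_residue_surj; split.
- split; first exact: sh_henselian.
  apply: (separably_closed_surj (i := j)) Lclosed => y.
  by exists (sh_residue y).
- move=> y; have [p sp pa] := Lsep (sh_residue y); exists p => //.
  rewrite -(fmorph_root sh_residue) -map_poly_comp.
  by rewrite (eq_map_poly sh_residue_const).
move=> R g al [hR sR] alE.
have ME : (al \o j) \o i =1 residue_map g.
  move=> y; rewrite -alE -[LHS]/(al (j (i y))) -sh_residue_const.
  by rewrite -[LHS]/(al (j (sh_residue (residue_map sh_const y)))) jK.
pose M := @SHModel R g (al \o j) hR ME.
exists (shq_interp M : localHom sh_ring (shm_ring M)); split; first split.
- by move=> c; exact: (shq_interpE M (SHConst c)).
- move=> y; rewrite -[y]res_surj residue_mapE [LHS](shq_res_interp M).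
  by rewrite -sh_residueE -[LHS]/(al (j _)) jK.
move=> h' h'c h'res; apply: (sh_hom_unique (M := M)) => //.
by move=> y; rewrite h'res -[RHS]/(al (j (sh_residue y))) jK.
Qed.

End StrictHenselization.

Section Subfields.
Variable Q : comNzRingType.

Record is_subfield (E : set Q) : Prop := IsSubfield {
  subfield1 : E 1;
  subfieldB : forall x y, E x -> E y -> E (x - y);
  subfieldM : forall x y, E x -> E y -> E (x * y);
  subfieldV : forall x, E x -> x != 0 -> exists2 y, E y & x * y = 1 }.

Section SubfieldType.
Variables (E : set Q) (hE : is_subfield E).

Definition subfield_pred of is_subfield E : {pred Q} := fun x => `[< E x >].

Lemma subfield_subring_closed : subring_closed (subfield_pred hE).
Proof.
by split=> [|x y /asboolP Ex /asboolP Ey|x y /asboolP Ex /asboolP Ey]; apply/asboolP;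
  [exact: subfield1|exact: subfieldB|exact: subfieldM].
Qed.
HB.instance Definition _ :=
  GRing.isSubringClosed.Build Q (subfield_pred hE) subfield_subring_closed.

Record subfield_type := SubfieldType {
  subfield_val : Q; _ : subfield_val \in subfield_pred hE }.
HB.instance Definition _ := [isSub for subfield_val].
HB.instance Definition _ := [Choice of subfield_type by <:].
HB.instance Definition _ := [SubChoice_isSubComNzRing of subfield_type by <:].

Lemma subfield_valP (x : subfield_type) : E (subfield_val x).
Proof. by case: x => x /= /asboolP. Qed.

Definition subfield_sub x (Ex : E x) : subfield_type := SubfieldType (asboolT Ex).

Definition subfield_inv (x : subfield_type) : subfield_type :=
  if x == 0 then 0 else xget 0 [set y | y * x = 1].

Lemma subfield_mulVf x : x != 0 -> subfield_inv x * x = 1.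
Proof.
rewrite /subfield_inv => x0; rewrite (negbTE x0).
have x0' : subfield_val x != 0.
  by apply: contra x0 => /eqP h; apply/eqP/val_inj; rewrite /= h.
have [y Ey xy] := subfieldV hE (subfield_valP x) x0'.
case: xgetP => [? _ //|/(_ (subfield_sub Ey))[]]; apply: val_inj => /=.
by rewrite mulrC.
Qed.

Lemma subfield_inv0 : subfield_inv 0 = 0. Proof. by rewrite /subfield_inv eqxx. Qed.
HB.instance Definition _ :=
  GRing.ComNzRing_isField.Build subfield_type subfield_mulVf subfield_inv0.

Definition subfield_inj : {rmorphism subfield_type -> Q} := \val.

End SubfieldType.
End Subfields.

Section EtaleAdjunction.
Variables (K : fieldType) (Q : localRingType) (s : {rmorphism K -> Q}) (y : Q).
Variable H : {poly K}.
Hypotheses (sepH : separable_poly H) (Hy : (map_poly s H).[y] = 0).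

Definition adjoin_set : set Q := [set (map_poly s g).[y] | g in setT].

Let ev (g : {poly K}) := (map_poly s g).[y].
Let evM g g' : ev (g * g') = ev g * ev g'.
Proof. by rewrite /ev rmorphM hornerM. Qed.
Let evD g g' : ev (g + g') = ev g + ev g'.
Proof. by rewrite /ev rmorphD hornerD. Qed.

Lemma adjoin_subfield : is_subfield adjoin_set.
Proof.
split.
- by exists 1 => //; rewrite rmorph1 hornerC.
- by move=> _ _ [g _ <-] [g' _ <-]; exists (g - g') => //;
  rewrite rmorphB hornerD hornerN.
- by move=> _ _ [g _ <-] [g' _ <-]; exists (g * g') => //; exact: evM.
move=> _ [g _ <-] gy.
pose P n := `[< exists h : {poly K}, [/\ h != 0, ev h = 0 & size h = n] >].
have exP : exists n, P n.
  by exists (size H); apply/asboolP; exists H; split=> //; exact: separable_poly_neq0.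
case: (ex_minnP exP) => n /asboolP[h [h0 hy <-]] hmin.
have small (e : {poly K}) : (size e < size h)%N -> ev e = 0 -> e = 0.
  move=> es ey; apply: contraTeq es => e0; rewrite -leqNgt; apply: hmin.
  by apply/asboolP; exists e.
have hH : h %| H.
  rewrite /dvdp; apply/eqP/small; first by rewrite ltn_modp.
  have := Hy; rewrite -/(ev H) {1}(divp_eq H h) evD evM hy mulr0 add0r.
  by [].
have [d0 d1] : h %/ gcdp g h * gcdp g h = h /\ gcdp g h %| h.
  by rewrite divpK ?dvdp_gcdr.
set d := gcdp g h in d0 d1; set e := h %/ d in d0.
have /separable_polyP[/(_ e d) ecop _] := sepH.
have {}ecop : coprimep e d by apply: ecop; rewrite d0.
have /Bezout_coprimepP[[u v] /= uv] := ecop.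
have unit1 (c : {poly K}) : c %= 1 -> exists2 b, b != 0 & c = b%:P.
  by rewrite -size_poly_eq1 => /size_poly1P[b b0 ->]; exists b.
have [b b0 bE] := unit1 _ uv.
have ued : ev u * ev e + ev v * ev d = s b.
  by rewrite -!evM -evD bE /ev map_polyC hornerC.
have ede : ev e * ev d = 0 by rewrite -evM d0.
have sb c : c != 0 -> exists a, s c * a = 1.
  by move=> c0; exists (s c^-1); rewrite -rmorphM divff// rmorph1.
have e0 : e != 0 by apply: contra_neq h0 => e0; rewrite -d0 e0 mul0r.
have dn0 : d != 0 by apply: contra_neq h0 => e0'; rewrite -d0 e0' mulr0.
have cancel0 z w : z * w = 0 -> z \notin maxid Q -> w = 0.
  by move=> zw /maxid_unitE[a za]; rewrite -[w]mul1r -za mulrAC zw mul0r.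
have [ed|ed] : ev e = 0 \/ ev d = 0.
- have [em|em] := boolP (ev e \in maxid Q); last by right; apply: cancel0 ede em.
  have dm : ev d \notin maxid Q.
    have [a ba] := sb _ b0; apply/negP => dm; have := idealr1 (maxid Q).
    by rewrite -ba -ued mulrC idealMr// rpredD// idealMr.
  by left; apply: cancel0 dm; rewrite mulrC.
- have deq1 : d %= 1.
    rewrite -size_poly_eq1 eqn_leq lt0n size_poly_eq0 dn0 andbT leqNgt.
    apply/negP => ds; have h1 : e = 0.
      apply: small => //; rewrite -[in X in (_ < X)%N]d0 size_mul//.
      by case: (size d) ds => [//|[//|k]] _; rewrite !addnS /= ltnS leq_addr.
    by move: e0; rewrite h1 eqxx.
  have [[u' v'] /= uv'] := Bezoutp g h.
  have [c' c'0 c'E] : exists2 c', c' != 0 & u' * g + v' * h = c'%:P.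
    by apply: unit1; apply: eqp_trans uv' deq1.
  have [a ca] := sb _ c'0; exists (ev ((c'^-1)%:P * u'));
    first by exists ((c'^-1)%:P * u').
  have : ev u' * ev g = s c'.
    have := congr1 ev c'E; rewrite evD !evM hy mulr0 addr0 => ->.
    by rewrite /ev map_polyC hornerC.
  rewrite -/(ev g) evM => e1; rewrite mulrCA [ev g * _]mulrC e1.
  by rewrite /ev map_polyC hornerC -rmorphM mulVf// rmorph1.
exfalso; move/eqP: gy; apply.
have hd : (size h <= size d)%N.
  by rewrite leqNgt; apply/negP => /small/(_ ed) d00; move: dn0; rewrite d00 eqxx.
have hg : h %| g.
  have : d %= h by rewrite -dvdp_size_eqp// eqn_leq hd dvdp_leq.
  by move=> /eqp_dvdl <-; exact: dvdp_gcdl.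
by rewrite -/(ev g) -(divpK hg) evM hy mulr0.
Qed.

Lemma adjoin_sub c : adjoin_set (s c).
Proof. by exists c%:P => //; rewrite map_polyC hornerC. Qed.

Lemma adjoin_gen : adjoin_set y.
Proof. by exists 'X => //; rewrite map_polyX hornerX. Qed.

End EtaleAdjunction.

Section MaximalSubfield.
Variables (k : fieldType) (Q : localRingType) (kap : {rmorphism k -> Q}).

Lemma exists_etale_closed_subfield : exists E : set Q,
  [/\ is_subfield E, range kap `<=` E
    & forall y (H : {poly k}), separable_poly H -> (map_poly kap H).[y] = 0 -> E y].
Proof.
pose P (E : set Q) := E = set0 \/ (is_subfield E /\ range kap `<=` E).
have [|E [PE Emax]] := @Zorn_bigcup Q P.
  move=> F FP Ftot.
  have [[X FX X0]|none] := pselect (exists2 X, F X & X !=set0); last first.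
    left; apply/seteqP; split=> // x [X FX Xx].
    by apply: none; exists X => //; exists x.
  right; have [?|[sX kX]] := FP _ FX; first by subst X; case: X0.
  have chain x y : (\bigcup_(Y in F) Y) x -> (\bigcup_(Y in F) Y) y ->
      exists Y, [/\ F Y, is_subfield Y, Y x & Y y].
    move=> [Y FY Yx] [Z FZ Zy].
    have [YZ|ZY] := Ftot _ _ FY FZ.
      have [?|[sZ _]] := FP _ FZ; first by subst Z.
      by exists Z; split=> //; apply: YZ.
    have [?|[sY _]] := FP _ FY; first by subst Y.
    by exists Y; split=> //; apply: ZY.
  split; last by move=> x /kX Xx; exists X.
  split.
  - by exists X => //; apply: subfield1.
  - by move=> x y hx hy; have [Y [FY sY Yx Yy]] := chain _ _ hx hy; exists Y => //;
    apply: subfieldB.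
  - by move=> x y hx hy; have [Y [FY sY Yx Yy]] := chain _ _ hx hy; exists Y => //;
    apply: subfieldM.
  - move=> x hx x0; have [Y [FY sY Yx _]] := chain _ _ hx hx.
    by have [y Yy xy] := subfieldV sY Yx x0; exists y => //; exists Y.
have [E0|[sE kE]] := PE.
  have : is_subfield (range kap).
    split.
    - by exists 1 => //; rewrite rmorph1.
    - by move=> _ _ [a _ <-] [b _ <-]; exists (a - b) => //; rewrite rmorphB.
    - by move=> _ _ [a _ <-] [b _ <-]; exists (a * b) => //; rewrite rmorphM.
    - move=> _ [a _ <-] a0; exists (kap a^-1); first by exists a^-1.
      rewrite -rmorphM divff ?rmorph1//.
      by apply: contraNneq a0 => ->; rewrite rmorph0.
  move=> sk; case: (Emax (range kap)); last by right; split.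
  by rewrite E0; split=> // /(_ 1); apply; exists 1 => //; rewrite rmorph1.
exists E; split=> // y H sepH Hy.
have kz : zmod_morphism (fun c => subfield_sub sE (kE _ (imageT kap c))).
  by move=> a b; apply: val_inj; rewrite /= rmorphB.
have km : monoid_morphism (fun c => subfield_sub sE (kE _ (imageT kap c))).
  by split=> [|a b]; apply: val_inj; rewrite /= ?rmorph1 ?rmorphM.
pose j : {rmorphism k -> subfield_type sE} := HB.pack
  (fun c => subfield_sub sE (kE _ (imageT kap c)))
  (GRing.isZmodMorphism.Build _ _ _ kz) (GRing.isMonoidMorphism.Build _ _ _ km).
have sepH' : separable_poly (map_poly j H) by rewrite separable_map.
have Hy' : (map_poly (subfield_inj sE) (map_poly j H)).[y] = 0.
  by rewrite -map_poly_comp.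
have sA := adjoin_subfield sepH' Hy'.
set E' := adjoin_set _ _ in sA.
have EE' : E `<=` E'.
  by move=> x Ex; exact: (adjoin_sub (subfield_inj sE) y (subfield_sub sE Ex)).
apply: contrapT => nEy; apply: (Emax E').
  by split=> // E'E; apply: nEy; apply: E'E; exact: adjoin_gen.
by right; split=> // x /kE /EE'.
Qed.

End MaximalSubfield.

Section LocalQuotientMap.
Variables (R : localRingType) (I : idealr R).
Notation Q := {ideal_quot I}.

Definition local_quot : R -> Q := \pi_Q.
HB.instance Definition _ := GRing.RMorphism.on local_quot.

Lemma local_quot_maxid x : x \in maxid R -> local_quot x \in maxid Q.
Proof. by move=> xm; rewrite [_ \in _](quot_maxidE I x). Qed.
HB.instance Definition _ := isLocalHom.Build R Q local_quot local_quot_maxid.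

Lemma local_quot_eq0 x : local_quot x = 0 <-> x \in I.
Proof. by rewrite -(rmorph0 local_quot) quot_eqP subr0. Qed.

Lemma local_quot_repr (x : Q) : local_quot (repr x) = x.
Proof. exact: reprK. Qed.

Lemma local_quot_maxidE x : (local_quot x \in maxid Q) = (x \in maxid R).
Proof. exact: quot_maxidE. Qed.

Lemma quot_henselian : henselian R -> henselian Q.
Proof.
move=> /henselianP hR; apply/henselianP => p x pm px dpx.
pose P := monic_poly (size p).-1 (fun j => repr p`_j).
have PE : map_poly local_quot P = p.
  rewrite map_monic_poly [in RHS](monic_polyE pm).
  by apply: eq_monic_poly => j; exact: local_quot_repr.
have [|||y Py yx] := hR P (repr x); first exact: monic_polyP.
- by rewrite -local_quot_maxidE -horner_map PE /= local_quot_repr.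
- by rewrite -local_quot_maxidE -horner_map -deriv_map PE /= local_quot_repr.
exists (local_quot y).
  by rewrite -PE horner_map Py /= rmorph0.
by rewrite -[x]local_quot_repr -rmorphB /= local_quot_maxidE.
Qed.

Lemma quot_strictly_henselian : strictly_henselian R -> strictly_henselian Q.
Proof.
move=> hR; apply: (@strictly_henselian_along _ _ local_quot) => //.
  move=> x; exists (repr x); suff : x - local_quot (repr x) \in maxid Q by [].
  by rewrite local_quot_repr subrr rpred0.
by apply: quot_henselian; case: hR.
Qed.

End LocalQuotientMap.

Section StrictHenselizationMaxid.
Variables (C S : localRingType) (f : localHom C S).
Hypothesis hf : is_strict_henselization f.

Let I := extended_ideal f (maxid C).
Let S1 := {ideal_quot I}.
Let q : localHom S S1 := @local_quot S I.

(* The quotient of S by the extension of the maximal ideal of C contains a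
   copy of its residue field, so by uniqueness S maps to it through the
   residue field. *)
Lemma strict_henselization_maxid :
  [set` maxid S] = ideal_span (f @` [set` maxid C]).
Proof.
have [shS sepf univ] := hf; have [hS sS] := shS.
have shS1 : strictly_henselian S1 by exact: quot_strictly_henselian.
have qC c : c \in maxid C -> (q \o f) c = 0.
  move=> cm; apply/local_quot_eq0/asboolP.
  by apply: sub_ideal_span; exists c.
pose kap : {rmorphism residue C -> S1} := quot_liftr (I := maxid C) qC.
have kapE c : kap (res c) = q (f c) by exact: (quot_liftE (I := maxid C) qC).
have [E [sE kE Eet]] := exists_etale_closed_subfield kap.
have Einj x y : E x -> E y -> res x = res y -> x = y.
  move=> Ex Ey /res_eqP xy; apply/eqP; rewrite -subr_eq0; apply: contraTT xy => xy0.
  by have [z _ xyz] := subfieldV sE (subfieldB sE Ex Ey) xy0; apply/maxid_unitE; exists z.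
have Esurj (a : residue S1) : exists2 e, E e & res e = a.
  have [b <-] : exists b, residue_map q b = a.
    apply: residue_map_surj => z; exists (repr z).
    suff : z - @local_quot S I (repr z) \in maxid S1 by [].
    by rewrite local_quot_repr subrr rpred0.
  have [p [pm sp pb]] := monic_separable_root b sepf.
  have pE : map_poly (@res S1) (map_poly kap p) = map_poly (residue_map q)
    (map_poly (residue_map f) p).
    rewrite -!map_poly_comp; apply: eq_map_poly => c.
    change (res (kap c) = residue_map q (residue_map f c)).
    by rewrite -[c]res_surj kapE !residue_mapE.
  have [|||y /rootP py yb] := proj1 shS1 (map_poly kap p) (residue_map q b).
  - exact: monic_map.
  - by rewrite pE fmorph_root.
  - rewrite pE deriv_map fmorph_root; apply: separable_simple_root => //.
    by rewrite separable_map.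
  by exists y => //; apply: Eet py.
have /choice[sec secP] s : exists e, E e /\ res e = res (q s).
  by have [e Ee ee] := Esurj (res (q s)); exists e.
have secU s e : E e -> res e = res (q s) -> sec s = e.
  by move=> Ee ee; have [Es es] := secP s; apply: Einj => //; rewrite es.
have secz : zmod_morphism sec.
  move=> s t; have [Es es] := secP s; have [Et et] := secP t.
  by apply: secU; [exact: subfieldB|rewrite !rmorphB /= es et].
have secm : monoid_morphism sec.
  split; first by apply: secU; [exact: subfield1|rewrite !rmorph1].
  move=> s t; have [Es es] := secP s; have [Et et] := secP t.
  by apply: secU; [exact: subfieldM|rewrite !rmorphM /= es et].
have secmax s : s \in maxid S -> sec s \in maxid S1.
  move=> sm; have [_ es] := secP s; rewrite -res_eq0 es res_eq0.
  exact: local_hom_maxid.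
pose sech : localHom S S1 := HB.pack sec (GRing.isZmodMorphism.Build _ _ _ secz)
  (GRing.isMonoidMorphism.Build _ _ _ secm) (isLocalHom.Build _ _ _ secmax).
have [h [_ hU]] := univ S1 (q \o f) (residue_map q) shS1
  (fun x => esym (residue_map_comp _ _ x)).
have e1 : sech =1 h.
  apply: hU => [c|x].
    by apply: (secU (f c) (q (f c))) => //; apply: kE; exists (res c) => //; exact: kapE.
  rewrite -[x]res_surj residue_mapE; have [_ e] := secP (repr x).
  exact: etrans e (esym (residue_mapE q (repr x))).
have e2 : q =1 h by exact: hU.
apply/seteqP; split=> s.
  move=> sm; have : q s = 0.
    rewrite e2 -e1; apply: Einj; [by case: (secP s)| |].
      by rewrite -(subrr 1); apply: (subfieldB sE); apply: subfield1 sE.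
    have [_ ->] := secP s; rewrite rmorph0; apply/eqP; rewrite res_eq0.
    exact: local_hom_maxid.
  by move=> /local_quot_eq0/asboolP.
move: s; apply: ideal_span_min; first exact: is_ideal_idealr.
by move=> _ [c cm <-]; exact: local_hom_maxid.
Qed.

End StrictHenselizationMaxid.

(** * Base change of the residue field in characteristic p *)

Section LinearFunctional.
Variables (k L : fieldType) (j : {rmorphism k -> L}).

Record klin := KLin {
  klin_fun :> L -> k;
  klinD : forall x y, klin_fun (x + y) = klin_fun x + klin_fun y;
  klinZ : forall c x, klin_fun (j c * x) = c * klin_fun x }.

Lemma klin_eq (l l' : klin) : l =1 l' -> l = l'.
Proof.
case: l l' => [f fD fZ] [g gD gZ] /= /funext fg; case: _ / fg in gD gZ *.
by rewrite (Prop_irrelevance fD gD) (Prop_irrelevance fZ gZ).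
Qed.

Lemma klin_mul_subproof (l : klin) a :
  (forall x y, l (a * (x + y)) = l (a * x) + l (a * y)) /\
  (forall c x, l (a * (j c * x)) = c * l (a * x)).
Proof. by split=> [x y|c x]; [rewrite mulrDr klinD|rewrite mulrCA klinZ]. Qed.

Definition klin_mul (l : klin) a : klin :=
  KLin (klin_mul_subproof l a).1 (klin_mul_subproof l a).2.

Lemma klin_mulA l a b : klin_mul (klin_mul l a) b = klin_mul l (a * b).
Proof. by apply: klin_eq => x; rewrite /= mulrA. Qed.

Lemma klin_mul1 l : klin_mul l 1 = l.
Proof. by apply: klin_eq => x; rewrite /= mul1r. Qed.

Lemma exists_klin1 : exists l : klin, l 1 = 1.
Proof.
pose P (W : set L) := [/\ forall x y, W x -> W y -> W (x + y),
  forall c x, W x -> W (j c * x) & ~ W 1].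
have [|W [[WD WZ W1] Wmax]] := @Zorn_bigcup L P.
  move=> F FP Ftot; split.
  - move=> x y [X FX Xx] [Y FY Yy].
    have [XY|YX] := Ftot _ _ FX FY.
      by exists Y => //; have [YD _ _] := FP _ FY; apply: YD => //; apply: XY.
    by exists X => //; have [XD _ _] := FP _ FX; apply: XD => //; apply: YX.
  - by move=> c x [X FX Xx]; exists X => //; have [_ XZ _] := FP _ FX; apply: XZ.
  - by move=> [X FX X1]; have [_ _ ] := FP _ FX.
have W0 : W 0.
  apply: contrapT => nW0; apply: (Wmax (W `|` [set 0])).
    by split=> [x|h]; [left|apply: nW0; apply: h; right].
  split.
  - move=> x y [Wx|->] [Wy|->]; rewrite ?addr0 ?add0r; [left;
    exact: WD|by left|by left|by right].
  - by move=> c x [Wx|->]; [left; exact: WZ|right; rewrite mulr0].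
  - by case=> // /eqP; rewrite oner_eq0.
have WN x : W x -> W (- x) by move=> /(WZ (-1)); rewrite rmorphN rmorph1 mulN1r.
have /choice[l hl] x : exists c, W (x - j c).
  apply: contrapT => nx.
  apply: (Wmax [set y | exists2 w, W w & exists a, y = w + j a * x]).
    split=> [y Wy|h]; first by exists y => //; exists 0; rewrite rmorph0 mul0r addr0.
    apply: nx; exists 0; rewrite rmorph0 subr0; apply: h; exists 0 => //.
    by exists 1; rewrite rmorph1 mul1r add0r.
  split.
  - move=> _ _ [w Ww [a ->]] [w' Ww' [a' ->]]; exists (w + w'); first exact: WD.
    by exists (a + a'); rewrite rmorphD; ring.
  - move=> c _ [w Ww [a ->]]; exists (j c * w); first exact: WZ.
    by exists (c * a); rewrite rmorphM; ring.
  - move=> [w Ww [a e]]; have a0 : a != 0.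
      by apply: contra_not_neq W1 => a0; rewrite e a0 rmorph0 mul0r addr0.
    apply: nx; exists a^-1; have -> : x - j a^-1 = - (j a^-1 * w).
      rewrite -[x]mul1r -[in 1 * x](rmorph1 j) -(mulVf a0) rmorphM.
      have -> : j a^-1 * j a * x = j a^-1 * (1 - w) by rewrite e; ring.
      by ring.
    exact/WN/WZ.
have lU x c : W (x - j c) -> l x = c.
  move=> h; apply/eqP; rewrite -subr_eq0; apply: contra_notT W1 => n0.
  have : W (j (l x - c)).
    have -> : j (l x - c) = (x - j c) + - (x - j (l x)) by rewrite rmorphB; ring.
    by apply: WD => //; apply: WN.
  by move=> /(WZ (l x - c)^-1); rewrite -rmorphM mulVf// rmorph1.
have lD x y : l (x + y) = l x + l y.
  apply: lU; have -> : x + y - j (l x + l y) = (x - j (l x)) + (y - j (l y)).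
    by rewrite rmorphD; ring.
  exact: WD.
have lZ c x : l (j c * x) = c * l x.
  apply: lU; have -> : j c * x - j (c * l x) = j c * (x - j (l x)).
    by rewrite rmorphM; ring.
  exact: WZ.
by exists (KLin lD lZ) => /=; apply: lU; rewrite rmorph1 subrr.
Qed.

End LinearFunctional.

Section TensorProduct.
Variables (k L : fieldType) (j : {rmorphism k -> L}) (D : comNzRingType).
Variable iota : {rmorphism k -> D}.
Local Notation lin := (klin j).

(* The tensor product of D and L over k: the functional [l] sends it to D by
   [id * (iota o l)], and these maps separate its elements. *)
Definition tens_fun (s : seq (D * L)) : lin -> D :=
  fun l => \sum_(u <- s) u.1 * iota (l u.2).

Definition tens_pred : {pred lin -> D} := fun t => `[< exists s, t = tens_fun s >].

Lemma tens_zmod_closed : zmod_closed tens_pred.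
Proof.
split=> [|_ _ /asboolP[s ->] /asboolP[u ->]]; apply/asboolP.
  by exists [::]; apply/funext => l; rewrite /tens_fun big_nil.
exists (s ++ [seq (- v.1, v.2) | v <- u]); apply/funext => l.
rewrite -[LHS]/(tens_fun s l - tens_fun u l) /tens_fun big_cat big_map /= -sumrN.
congr (_ + _).
by apply: eq_bigr => v _; rewrite mulNr.
Qed.
HB.instance Definition _ := GRing.isZmodClosed.Build (lin -> D)
  tens_pred tens_zmod_closed.

Record tens := Tens { tens_val :> lin -> D; _ : tens_val \in tens_pred }.
HB.instance Definition _ := [isSub for tens_val].
HB.instance Definition _ := [Choice of tens by <:].
HB.instance Definition _ := [SubChoice_isSubZmodule of tens by <:].

Lemma tens_ext (x y : tens) : (forall l, x l = y l) -> x = y.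
Proof. by move=> h; apply/val_inj/funext. Qed.

Lemma tens_of_subproof s : tens_fun s \in tens_pred.
Proof. by apply/asboolP; exists s. Qed.
Definition tens_of s : tens := Tens (tens_of_subproof s).

Lemma tens_ofE s l : tens_of s l = \sum_(u <- s) u.1 * iota (l u.2).
Proof. by []. Qed.

Lemma tens_repr_subproof (x : tens) : exists s, x = tens_of s.
Proof. by case: x => x /[dup] /asboolP[s ->] hx; exists s; apply: val_inj. Qed.

Definition tens_repr (x : tens) : seq (D * L) := projT1 (cid (tens_repr_subproof x)).
Lemma tens_reprK x : tens_of (tens_repr x) = x.
Proof. by rewrite /tens_repr; case: cid. Qed.

Lemma tensE x l : (x : tens) l = \sum_(u <- tens_repr x) u.1 * iota (l u.2).
Proof. by rewrite -{1}(tens_reprK x). Qed.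

Definition tens_mul_seq (s u : seq (D * L)) : seq (D * L) :=
  [seq (v.1 * w.1, v.2 * w.2) | v <- s, w <- u].
Definition tens_mul (x y : tens) : tens := tens_of (tens_mul_seq (tens_repr x)
  (tens_repr y)).
Definition tens_one : tens := tens_of [:: (1, 1)].

Lemma tens_mulE x y l :
  tens_mul x y l = \sum_(w <- tens_repr y) w.1 * x (klin_mul l w.2).
Proof.
rewrite /tens_mul tens_ofE /tens_mul_seq big_allpairs_dep exchange_big /=.
apply: eq_bigr => w _; rewrite tensE mulr_sumr; apply: eq_bigr => v _ /=.
by rewrite mulrCA mulrA [w.2 * _]mulrC.
Qed.

Lemma tens_mulC : commutative tens_mul.
Proof.
move=> x y; apply: tens_ext => l;
  rewrite /tens_mul !tens_ofE /tens_mul_seq !big_allpairs_dep.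
rewrite exchange_big; apply: eq_bigr => v _; apply: eq_bigr => w _ /=.
by rewrite [v.1 * _]mulrC [v.2 * _]mulrC.
Qed.

Lemma tens_mul_of x s l : tens_mul x (tens_of s) l = \sum_(w <- s)
  w.1 * x (klin_mul l w.2).
Proof.
rewrite tens_mulC tens_mulE.
transitivity (\sum_(v <- tens_repr x) \sum_(w <- s) v.1 * (w.1 * iota (l (v.2 * w.2)))).
  by apply: eq_bigr => v _; rewrite /= /tens_fun mulr_sumr.
rewrite exchange_big; apply: eq_bigr => w _; rewrite tensE mulr_sumr.
by apply: eq_bigr => v _; rewrite /= mulrCA [w.2 * _]mulrC.
Qed.

Lemma tens_mulA : associative tens_mul.
Proof.
move=> x y z; apply: tens_ext => l.
rewrite [RHS]tens_mulE.
transitivity (tens_mul x (tens_of (tens_mul_seq (tens_repr y) (tens_repr z))) l) => //.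
rewrite tens_mul_of /tens_mul_seq big_allpairs_dep exchange_big; apply: eq_bigr => w _.
rewrite tens_mulE mulr_sumr.
by apply: eq_bigr => v _ /=; rewrite mulrCA mulrA klin_mulA [w.2 * _]mulrC.
Qed.

Lemma tens_mul1 : left_id tens_one tens_mul.
Proof.
move=> x; apply: tens_ext => l; rewrite tens_mulC tens_mul_of big_seq1 /=.
by rewrite mul1r klin_mul1.
Qed.

Lemma tens_mulDl : left_distributive tens_mul +%R.
Proof.
move=> x y z; apply: tens_ext => l.
rewrite -[RHS]/(tens_mul x z l + tens_mul y z l) !tens_mulE -big_split /=.
by apply: eq_bigr => w _; rewrite -mulrDr.
Qed.

Lemma tens_one_neq0 : tens_one != 0.
Proof.
have [l l1] := exists_klin1 j; apply: contraTneq isT => /(congr1 (fun x : tens => x l)).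
by rewrite /= /tens_fun big_seq1 /= l1 rmorph1 mulr1 => /eqP; rewrite oner_eq0.
Qed.

HB.instance Definition _ := GRing.Zmodule_isComNzRing.Build tens
  tens_mulA tens_mulC tens_mul1 tens_mulDl tens_one_neq0.

Definition tensl (d : D) : tens := tens_of [:: (d, 1)].
Definition tensr (a : L) : tens := tens_of [:: (1, a)].

Lemma tenslE d l : tensl d l = d * iota (l 1).
Proof. by rewrite /= /tens_fun big_seq1. Qed.
Lemma tensrE a l : tensr a l = iota (l a).
Proof. by rewrite /= /tens_fun big_seq1 mul1r. Qed.

Lemma tensl_zmod : zmod_morphism tensl.
Proof.
move=> a b; apply: tens_ext => l; rewrite tenslE mulrBl -!tenslE.
by [].
Qed.
Lemma tensl_monoid : monoid_morphism tensl.
Proof.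
split=> // a b; apply: tens_ext => l; rewrite [in RHS]tens_mul_of big_seq1.
by rewrite klin_mul1 !tenslE mulrCA mulrA.
Qed.
HB.instance Definition _ := GRing.isZmodMorphism.Build _ _ tensl tensl_zmod.
HB.instance Definition _ := GRing.isMonoidMorphism.Build _ _ tensl tensl_monoid.

Lemma klinB (l : lin) x y : l (x - y) = l x - l y.
Proof. by rewrite klinD -mulN1r -(rmorph1 j) -rmorphN klinZ mulN1r. Qed.

Lemma tensr_zmod : zmod_morphism tensr.
Proof.
move=> a b; apply: tens_ext => l; rewrite tensrE klinB rmorphB -!tensrE.
by [].
Qed.
Lemma tensr_monoid : monoid_morphism tensr.
Proof.
split=> // a b; apply: tens_ext => l; rewrite [in RHS]tens_mul_of big_seq1.
by rewrite mul1r !tensrE /= mulrC.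
Qed.
HB.instance Definition _ := GRing.isZmodMorphism.Build _ _ tensr tensr_zmod.
HB.instance Definition _ := GRing.isMonoidMorphism.Build _ _ tensr tensr_monoid.

Lemma tensl_iota c : tensl (iota c) = tensr (j c).
Proof.
by apply: tens_ext => l; rewrite tenslE tensrE -rmorphM -klinZ mulr1.
Qed.

Lemma tens_decomp (x : tens) : x = \sum_(u <- tens_repr x) tensl u.1 * tensr u.2.
Proof.
apply: tens_ext => l; rewrite tensE.
elim: (tens_repr x) => [|u s IHs]; first by rewrite !big_nil.
rewrite !big_cons IHs -[RHS]/((tensl u.1 * tensr u.2) l + _); congr (_ + _).
by rewrite [RHS]tens_mul_of big_seq1 mul1r tenslE /= mulr1.
Qed.

Lemma tensl_inj d : tensl d = 0 -> d = 0.
Proof.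
have [l l1] := exists_klin1 j => /(congr1 (fun x : tens => x l)).
by rewrite tenslE l1 rmorph1 mulr1.
Qed.

End TensorProduct.

Section FrobeniusPower.
Variables (R : comNzRingType) (p e : nat).
Hypotheses (pp : prime p) (p0 : p%:R = 0 :> R).

Lemma frob_additive (x y : R) : (x + y) ^+ (p ^ e) = x ^+ (p ^ e) + y ^+ (p ^ e).
Proof.
apply: exprDn_pchar; rewrite pnatX; apply/orP; left; rewrite pnatE//.
by rewrite inE pp p0 eqxx.
Qed.

Definition frob of prime p & p%:R = 0 :> R : R -> R := fun x => x ^+ (p ^ e).

Lemma frob_zmod : zmod_morphism (frob pp p0).
Proof.
by move=> x y; rewrite /frob -[in RHS](subrK y x) [in RHS]frob_additive addrK.
Qed.
Lemma frob_monoid : monoid_morphism (frob pp p0).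
Proof. by split=> [|x y]; rewrite /frob ?expr1n// exprMn. Qed.
HB.instance Definition _ := GRing.isZmodMorphism.Build R R (frob pp p0) frob_zmod.
HB.instance Definition _ := GRing.isMonoidMorphism.Build R R (frob pp p0) frob_monoid.

Definition frobr : {rmorphism R -> R} := frob pp p0.
Lemma frobrE x : frobr x = x ^+ (p ^ e). Proof. by []. Qed.

End FrobeniusPower.

Section ResidueExtension.
Variables (D : localRingType) (p e : nat).
Hypotheses (pp : prime p) (p0 : p%:R = 0 :> D).
Local Notation q := (p ^ e)%N.
Hypothesis nilD : forall x : D, x \in maxid D -> frobr e pp p0 x = 0.
Variables (L : fieldType) (j : {rmorphism residue D -> L}).
Hypothesis sepj : separable_algebraic j.

(* In characteristic p, a large power of Frobenius lifts the residue field to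
   D, whence a base change of D along j. *)
Definition residue_lift : {rmorphism residue D -> D} :=
  quot_liftr (I := maxid D) nilD.

Lemma residue_liftE x : residue_lift (res x) = x ^+ q.
Proof. exact: (quot_liftE (I := maxid D) nilD). Qed.

Notation T := (tens j residue_lift).

Let q0 : (0 < q)%N. Proof. by rewrite expn_gt0 prime_gt0. Qed.

Lemma tens_p0 : p%:R = 0 :> T.
Proof. by rewrite -(rmorph_nat (tensl j residue_lift)) p0 rmorph0. Qed.

Lemma tensr_eq0 a : (tensr j residue_lift a == 0 :> T) = (a == 0).
Proof.
apply/eqP/eqP => [h|->]; last by rewrite rmorph0.
apply: contraTeq isT => a0; have := oner_neq0 T.
by rewrite -(rmorph1 (tensr j residue_lift)) -(mulVf a0) rmorphM /= h mulr0 eqxx.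
Qed.

Lemma tensl_frob d : (tensl j residue_lift d : T) ^+ q = tensr j residue_lift (j (res d)).
Proof. by rewrite -rmorphXn -residue_liftE; exact: tensl_iota. Qed.

Lemma tens_frob (x : T) : exists b, x ^+ q = tensr j residue_lift b.
Proof.
rewrite -(frobrE e pp tens_p0) {1}(tens_decomp x) rmorph_sum.
elim: (tens_repr x) => [|u s [b IH]]; first by exists 0; rewrite big_nil rmorph0.
exists (j (res u.1) * u.2 ^+ q + b).
by rewrite big_cons IH rmorphM rmorphD /= !rmorphM /= !frobrE tensl_frob -rmorphXn.
Qed.

Definition tens_norm (x : T) : L := projT1 (cid (tens_frob x)).

Lemma tens_normP x : x ^+ q = tensr j residue_lift (tens_norm x).
Proof. by rewrite /tens_norm; case: cid. Qed.

Lemma tens_norm_unique (x : T) b : x ^+ q = tensr j residue_lift b -> tens_norm x = b.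
Proof.
move=> h; apply/eqP; rewrite -subr_eq0 -tensr_eq0 rmorphB /= -tens_normP h.
by rewrite subrr.
Qed.

Lemma tens_norm_zmod : zmod_morphism tens_norm.
Proof.
move=> x y; apply: tens_norm_unique; rewrite rmorphB /= -!tens_normP.
by rewrite -!(frobrE e pp tens_p0) rmorphB.
Qed.
Lemma tens_norm_monoid : monoid_morphism tens_norm.
Proof.
split=> [|x y]; apply: tens_norm_unique; first by rewrite expr1n rmorph1.
by rewrite rmorphM /= -!tens_normP exprMn.
Qed.
HB.instance Definition _ := GRing.isZmodMorphism.Build T L tens_norm tens_norm_zmod.
HB.instance Definition _ := GRing.isMonoidMorphism.Build T L tens_norm tens_norm_monoid.

Definition tens_maxid : {pred T} := fun x => tens_norm x == 0.

Lemma tens_maxid_closed : idealr_closed tens_maxid.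
Proof.
split; first by rewrite unfold_in /tens_maxid rmorph0.
  by rewrite unfold_in /tens_maxid rmorph1 oner_eq0.
move=> a u v /eqP hu /eqP hv; rewrite unfold_in /tens_maxid.
by rewrite rmorphD rmorphM /= hu hv mulr0 addr0.
Qed.

Lemma tens_maxid_unit x : x \notin tens_maxid -> exists y, x * y = 1.
Proof.
rewrite unfold_in /tens_maxid => n0;
  exists (x ^+ q.-1 * tensr j residue_lift (tens_norm x)^-1).
by rewrite mulrA -exprS prednK// tens_normP -rmorphM divff// rmorph1.
Qed.
HB.instance Definition _ := isLocal.Build T tens_maxid_closed tens_maxid_unit.

Lemma tens_maxidE (x : T) : (x \in maxid T) = (tens_norm x == 0).
Proof. by []. Qed.

Lemma tens_norml d : tens_norm (tensl j residue_lift d) = j (res d).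
Proof. by apply: tens_norm_unique; rewrite tensl_frob. Qed.

Lemma tens_normr a : tens_norm (tensr j residue_lift a) = a ^+ q.
Proof. by apply: tens_norm_unique; rewrite rmorphXn. Qed.

Lemma tensl_maxid d : d \in maxid D -> tensl j residue_lift d \in maxid T.
Proof. by rewrite tens_maxidE tens_norml -res_eq0 => /eqP ->; rewrite rmorph0. Qed.
HB.instance Definition _ := isLocalHom.Build D T (tensl j residue_lift) tensl_maxid.

Lemma tens_henselian : henselian T.
Proof.
by apply: nil_henselian => x /eqP x0; exists q; rewrite tens_normP x0 rmorph0.
Qed.

Definition tens_residue : {rmorphism residue T -> L} :=
  @quot_liftr _ _ (maxid T) tens_norm (fun x => elimTF eqP).

Lemma tens_residueE x : tens_residue (res x) = tens_norm x.
Proof. exact: (@quot_liftE _ _ (maxid T) tens_norm (fun x => elimTF eqP)). Qed.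

Lemma tens_residuel c : tens_residue (residue_map (tensl j residue_lift) c) = j c.
Proof. by rewrite -[c]res_surj residue_mapE tens_residueE tens_norml. Qed.

(* The residue field of T contains a ^ q, and a is separable over it. *)
Lemma tens_residue_surj a : exists b, tens_residue b = a.
Proof.
have [h sh ha] := sepj a.
have LP : p%:R = 0 :> L.
  by rewrite -(rmorph_nat j) -(rmorph_nat (@res D)) p0 !rmorph0.
pose P := map_poly (residue_map (tensl j residue_lift)) h.
have PE : map_poly tens_residue P = map_poly j h.
  by rewrite -map_poly_comp; apply: eq_map_poly => c; exact: tens_residuel.
pose b : residue T := res (tensr j residue_lift a).
have bE : tens_residue b = a ^+ q by rewrite tens_residueE tens_normr.
pose G := gcdp P ('X^q - b%:P).
have GE : map_poly tens_residue G = gcdp (map_poly j h) (('X - a%:P) ^+ q).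
  rewrite gcdp_map PE; congr (gcdp _ _).
  have -> : map_poly tens_residue ('X^q - b%:P) = 'X^q - (a ^+ q)%:P.
    apply/polyP => m; rewrite coef_map !coefB !coefXn !coefC [LHS](rmorphB
      tens_residue) rmorph_nat.
    by congr (_ - _); case: ifP => _; [exact: bE|exact: rmorph0].
  have pP : p%:R = 0 :> {poly L} by rewrite -(rmorph_nat (@polyC L)) LP rmorph0.
  by have := frob_zmod e pp pP 'X a%:P; rewrite /frob => ->; rewrite polyC_exp.
have /dvdp_exp_XsubCP[n nq Gn] : map_poly tens_residue G %| ('X - a%:P) ^+ q.
  by rewrite GE dvdp_gcdr.
have sepP : separable_poly (map_poly j h) by rewrite separable_map.
have n1 : (n <= 1)%N.
  rewrite leqNgt; apply/negP => n2.
  have d2 : ('X - a%:P) * ('X - a%:P) %| map_poly j h.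
    rewrite -expr2; apply: (dvdp_trans (dvdp_exp2l _ n2)).
    by rewrite -(eqp_dvdl _ Gn) GE dvdp_gcdl.
  have /separable_polyP[/(_ _ _ d2) cop _] := sepP.
  by move: cop; rewrite coprimepp size_XsubC.
have n0 : (0 < n)%N.
  rewrite lt0n; apply/negP => /eqP n0; move: Gn; rewrite n0 expr0 GE => g1.
  have : 'X - a%:P %| gcdp (map_poly j h) (('X - a%:P) ^+ q).
    by rewrite dvdp_gcd dvdp_XsubCl ha /= -[X in X %| _]expr1 dvdp_exp2l.
  by rewrite (eqp_dvdr _ g1) dvdp1 size_XsubC.
have Ga : map_poly tens_residue G %= 'X - a%:P.
  by rewrite (_ : n = 1%N) ?expr1// in Gn; apply/eqP; rewrite eqn_leq n1.
have sG : size G = 2%N.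
  by rewrite -(size_map_poly tens_residue) (eqp_size Ga) size_XsubC.
have [c hc] : exists c, root G c.
  exists (- G`_0 / G`_1); have l1 : G`_1 != 0.
    have : lead_coef G != 0 by rewrite lead_coef_eq0 -size_poly_eq0 sG.
    by rewrite lead_coefE sG.
  rewrite rootE horner_coef sG !big_ord_recl big_ord0 /= expr0 expr1 mulr1 addr0.
  by rewrite mulrC divfK// addrN.
exists c; apply/eqP; rewrite -root_XsubC -(eqp_root Ga).
by rewrite fmorph_root.
Qed.

Lemma exists_residue_extension : exists (T' : localRingType) (g : localHom D T')
    (al : {rmorphism L -> residue T'}),
  [/\ henselian T', al \o j =1 residue_map g, (forall b, exists a, al a = b)
    & forall d, g d = 0 -> d = 0].
Proof.
have [i [iK Ki]] := exists_field_inv tens_residue_surj.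
exists T, (tensl j residue_lift : localHom D T), i; split.
- exact: tens_henselian.
- by move=> c; rewrite -[LHS]/(i (j c)) -tens_residuel iK.
- by move=> b; exists (tens_residue b).
- exact: tensl_inj.
Qed.

End ResidueExtension.

(** * Krull's principal ideal theorem *)

Section Noetherian.
Variable R : comNzRingType.
Hypothesis noeR : noetherian R.

Lemma noetherian_max (P : set (set R)) J0 :
  (forall J, P J -> is_ideal J) -> P J0 ->
  exists J, P J /\ forall K, P K -> J `<=` K -> K = J.
Proof.
move=> Pid PJ0.
have [|J [PJ Jmax]] := @Zorn_bigcup R (fun W => W = set0 \/ P W).
  move=> F FP Ftot.
  have [[X0 FX0 PX0]|none] := pselect (exists2 X, F X & P X); last first.
    left; apply/seteqP; split=> // x [X FX Xx]; have [X0|PX] := FP _ FX.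
      by rewrite X0 in Xx.
    by apply: none; exists X.
  right; set U := \bigcup_(X in F) X.
  have chain X Y : F X -> P X -> F Y -> exists Z, [/\ F Z, P Z, X `<=` Z & Y `<=` Z].
    move=> FX PX FY; have [XY|YX] := Ftot _ _ FX FY; last by exists X; split.
    have [Y0|PY] := FP _ FY; last by exists Y; split.
    by exists X; split=> //; rewrite Y0.
  have hU : is_ideal U.
    split; first by exists X0 => //; apply: ideal_0; apply: Pid.
    move=> a u v [X FX Xu] [Y FY Yv].
    have [Z [FZ PZ _ XZ]] := chain _ _ FX0 PX0 FX.
    have [V [FV PV ZV YV]] := chain _ _ FZ PZ FY.
    exists V => //; have hV := Pid _ PV; apply: (ideal_D hV); last exact: YV.
    by apply: (ideal_Ml hV); apply/ZV/XZ.
  have [s sE] := noeR hU.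
  have [X [FX PX sX]] : exists X, [/\ F X, P X & [set` s] `<=` X].
    have : [set` s] `<=` U by rewrite sE; apply: sub_ideal_span.
    elim: (s) => [|x t IH] h; first by exists X0; split.
    have [|X [FX PX tX]] := IH; first by move=> y yt; apply: h; rewrite /= inE yt orbT.
    have [Y FY Yx] : U x by apply: h; rewrite /= inE eqxx.
    have [Z [FZ PZ XZ YZ]] := chain _ _ FX PX FY.
    exists Z; split=> // y /=; rewrite inE => /orP[/eqP ->|yt]; first exact: YZ.
    by apply/XZ/tX.
  suff -> : U = X by [].
  apply/seteqP; split; last by move=> x Xx; exists X.
  by rewrite sE; apply: ideal_span_min => //; apply: Pid.
have J0n : J0 0 by apply: ideal_0; apply: Pid.
have {}PJ : P J.
  case: PJ => // J00; exfalso; apply: (Jmax J0); last by right.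
  by rewrite J00; split=> // /(_ 0); apply.
exists J; split=> // K PK JK; apply/seteqP; split=> //.
by apply: contrapT => KJ; apply: (Jmax K); [split|right].
Qed.

Section Saturation.
Variable q : spec R.
Let hq := is_prime_spec q.

Definition saturation (J : set R) : set R := [set y | exists2 t, t \notin q & J (t * y)].

Lemma is_ideal_saturation J : is_ideal J -> is_ideal (saturation J).
Proof.
move=> hJ; split; first by exists 1; rewrite ?idealr1// mulr0; apply: ideal_0.
move=> a u v [t tq tu] [s sq sv]; exists (t * s).
  by rewrite prime_idealrM negb_or tq sq.
have -> : t * s * (a * u + v) = s * a * (t * u) + t * (s * v) by ring.
by apply: (ideal_D hJ); apply: (ideal_Ml hJ).
Qed.

Lemma saturation_sub J : J `<=` saturation J.
Proof. by move=> x Jx; exists 1; rewrite ?idealr1// mul1r. Qed.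

Lemma saturationM J t x : t \notin q -> saturation J (t * x) -> saturation J x.
Proof.
by move=> tq [s sq h]; exists (s * t); rewrite ?prime_idealrM ?negb_or ?sq// -mulrA.
Qed.

Lemma saturation_mono J K : J `<=` K -> saturation J `<=` saturation K.
Proof. by move=> JK x [t tq h]; exists t => //; apply: JK. Qed.

(* Nakayama's lemma in the localization at q. *)
Lemma nakayama_saturation (M N : set R) : is_ideal M -> is_ideal N ->
  M `<=` saturation (ideal_add N (ideal_mul [set` q] M)) -> M `<=` saturation N.
Proof.
move=> hM hN h; apply: contrapT => MN.
have hNM := is_ideal_add hN hM.
pose L := saturation (ideal_add N M); have hL : is_ideal L := is_ideal_saturation hNM.
pose P K := [/\ is_ideal K, N `<=` K, K `<=` L, saturation K `<=` K & ~ M `<=` K].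
have [||K [[hK NK KL Ksat MK] Kmax]] := @noetherian_max P (saturation N).
- by move=> K [].
- split=> //.
  + exact: is_ideal_saturation.
  + exact: saturation_sub.
  + by apply: saturation_mono; apply: ideal_addl.
  + by move=> x [t tq]; apply: saturationM.
have qL a x : a \in q -> L x -> K (a * x).
  move=> aq Lx; apply: contrapT => nax.
  pose K' := saturation (ideal_add K (principal (a * x))).
  have hKa := is_ideal_add hK (is_ideal_principal (a * x)).
  have KK' : K `<=` K'.
    apply: subset_trans (@saturation_sub _); apply: ideal_addl; exact: is_ideal_principal.
  have K'L : K' `<=` L.
    move=> y [t tq hy]; apply: (saturationM tq); apply: (ideal_add_min hL KL _ hy).
    by apply: principal_sub => //; apply: ideal_Ml.
  have K'ax : K' (a * x).
    by apply: saturation_sub; apply: ideal_addr => //; exact: mem_principal.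
  have [MK'|MK'] := pselect (M `<=` K'); last first.
    have : K' = K.
      apply: Kmax => //; split=> //; first exact: is_ideal_saturation.
        exact: subset_trans NK KK'.
      by move=> y [t tq]; apply: saturationM.
    by move=> e; apply: nax; rewrite -e.
  have LK' : L `<=` K'.
    move=> y [t tq hy]; apply: (saturationM tq).
    apply: (ideal_add_min (is_ideal_saturation hKa) _ MK' hy).
    exact: subset_trans NK KK'.
  have [t tq [y Ky [c _ e]]] := LK' _ Lx; apply: nax; apply: (ideal_Ml hK).
  apply: Ksat; exists (t - c * a).
    by apply: contra tq => h'; rewrite -[t](subrK (c * a)) rpredD// idealMr.
  have -> : (t - c * a) * x = t * x - a * x * c by ring.
  by rewrite e subKr.
apply: MK => y My; apply: Ksat; have [t tq hy] := h _ My; exists t => //.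
apply: (ideal_add_min hK NK _ hy); apply: ideal_mul_min => // a x aq Mx.
by apply: qL => //; apply: saturation_sub; apply: ideal_addr.
Qed.

End Saturation.
End Noetherian.

Section NoetherianLocal.
Variable R : localRingType.
Hypothesis noeR : noetherian R.
Notation m := [set` maxid R].
Let hm := is_ideal_idealr (maxid R).

Lemma is_prime_maxid : is_prime m.
Proof.
split=> //; first by rewrite /= idealr1.
by move=> x y /=; rewrite maxid_prime => /orP.
Qed.

Lemma nakayama (M N : set R) : is_ideal M -> is_ideal N ->
  M `<=` ideal_add N (ideal_mul m M) -> M `<=` N.
Proof.
move=> hM hN h; have := @nakayama_saturation _ noeR (mkspec is_prime_maxid) M N hM hN.
rewrite mkspecE => hn y My; have [|t tm ty] := hn _ y My.
  by apply: subset_trans h _; exact: saturation_sub.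
have /maxid_unitE[s ts] : t \notin maxid R by apply: contra tm => h'; apply/mem_mkspec.
by rewrite -[y]mul1r -ts [t * s]mulrC -mulrA; apply: ideal_Ml.
Qed.

Definition dcc_over (J : set R) := forall C : nat -> set R,
  (forall n, is_ideal (C n)) -> (forall n, J `<=` C n) -> (forall n, C n.+1 `<=` C n) ->
  exists n0, forall n, (n0 <= n)%N -> C n = C n.+1.

Lemma primary_dcc n (J : set R) : is_ideal J -> ideal_exp m n `<=` J -> dcc_over J.
Proof.
move=> hJ mJ; apply: contrapT => nJ.
pose P K := [/\ is_ideal K, ideal_exp m n `<=` K & ~ dcc_over K].
have [||K [[hK mK nK] Kmax]] := @noetherian_max R noeR P J; first by move=> ? [].
  by [].
have K1 : ~ K 1.
  move=> K1; apply: nK => C hC KC _; exists 0%N => k _.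
  have CT k' : C k' = setT.
    by apply/seteqP; split=> // x _; rewrite -[x]mulr1; apply: (ideal_Ml (hC _));
      apply: KC.
  by rewrite !CT.
have [s Ks ms] : exists2 s, ~ K s & forall a, a \in maxid R -> K (a * s).
  have exi : exists i, `[< ideal_exp m i `<=` K >] by exists n; apply/asboolP.
  case: (ex_minnP exi) => -[|i] /asboolP iK imin; first by case: K1; apply: iK.
  have [s si Ks] : exists2 s, ideal_exp m i s & ~ K s.
    apply: contrapT => h; have := imin i; rewrite ltnn => hi.
    have : `[< ideal_exp m i `<=` K >].
      by apply/asboolP => s si; apply: contrapT => Ks; apply: h; exists s.
    by move=> /hi.
  by exists s => // a am; apply: iK; apply: ideal_mul_in.
pose K' := ideal_add K (principal s).
have hs := is_ideal_principal s.
have hK' : is_ideal K' by exact: is_ideal_add.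
have KK' : K `<=` K' by exact: ideal_addl.
have K's : K' s by apply: ideal_addr => //; exact: mem_principal.
have dK' : dcc_over K'.
  apply: contrapT => nK'; have e : K' = K.
    by apply: Kmax => //; split=> //; exact: subset_trans mK KK'.
  by apply: Ks; rewrite -e.
apply: nK => C hC KC Cd.
have Cle i k : C (i + k)%N `<=` C i.
  by elim: k => [|k IHk]; rewrite ?addn0// addnS; exact: subset_trans (Cd _) IHk.
have [sC|nsC] := pselect (forall k, C k s).
  apply: dK' => // k; apply: ideal_add_min => //; exact: principal_sub.
have [k1 Ck1] : exists k, ~ C k s by apply: contrapT => h; apply: nsC => k;
  apply: contrapT => h'; apply: h; exists k.
have [|||k0 hk0] := dK' (fun k => ideal_add (C k) K').
- by move=> k; exact: is_ideal_add.
- by move=> k; exact: ideal_addr.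
- move=> k; apply: ideal_add_min; first exact: is_ideal_add.
    by apply: subset_trans (Cd k) _; exact: ideal_addl.
  exact: ideal_addr.
exists (k0 + k1)%N => k hk; apply/seteqP; split=> // y Cy.
have kk0 : (k0 <= k)%N by apply: leq_trans hk; rewrite leq_addr.
have kk1 : (k1 <= k)%N by apply: leq_trans hk; rewrite leq_addl.
have : ideal_add (C k.+1) K' y by rewrite -hk0//; apply: ideal_addl.
case=> z Cz [w Kw [c _ e]].
have ywz : y - z = w + s * c by rewrite e; ring.
have Cyz : C k (w + s * c) by rewrite -ywz; apply: (ideal_B (hC k)) => //; exact: Cd.
have cm : c \in maxid R.
  apply: contraT => /maxid_unitE[d cd]; case: Ck1.
  have : C k (s * c).
    by apply: (ideal_subl (hC k) (y := - w));
      [rewrite opprK addrC|apply: (ideal_N (hC k)); apply: KC].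
  move=> /(ideal_Mr (hC k) d); rewrite -mulrA cd mulr1 -(subnKC kk1).
  exact: Cle.
rewrite -[y](subrK z); apply: (ideal_D (hC _)) => //; apply: KC; rewrite ywz.
by apply: (ideal_D hK) => //; rewrite mulrC; apply: ms.
Qed.

(* Krull's principal ideal theorem in R / p0: the symbolic powers of p1
   stabilize modulo x, and then vanish after localization at p1. *)
Lemma krull_principal (p0 p1 : spec R) (x : R) n :
  x \in maxid R -> ideal_exp m n `<=` ideal_add [set` p0] (principal x) ->
  [set` p0] `<` [set` p1] -> ~ [set` p1] `<` m.
Proof.
move=> xm mn [p01 p10] [p1m mp1].
have [hp0 p01' p0M] := is_prime_spec p0; have [hp1 p11 p1M] := is_prime_spec p1.
have prime_exp (p : spec R) y i : y ^+ i \in p -> y \in p.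
  elim: i => [|i IH]; first by rewrite expr0 idealr1.
  by rewrite exprS prime_idealrM => /orP[].
have xp1 : x \notin p1.
  apply/negP => xp1; apply: mp1 => y ym /=; apply: (@prime_exp p1 y n).
  have : ideal_add [set` p0] (principal x) (y ^+ n) by apply: mn; exact: ideal_expX.
  exact: (ideal_add_min hp1 p01 (principal_sub hp1 xp1)).
pose E i := ideal_add (ideal_exp [set` p1] i) [set` p0].
have hE i : is_ideal (E i) by apply: is_ideal_add => //; exact: is_ideal_exp.
pose Q i := saturation p1 (E i).
have hQ i : is_ideal (Q i) by exact: is_ideal_saturation.
have p0Q i : [set` p0] `<=` Q i.
  by apply: subset_trans (@saturation_sub _ _ _); apply: ideal_addr; exact: is_ideal_exp.
have Qd i : Q i.+1 `<=` Q i.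
  apply: saturation_mono; apply: ideal_add_min => //.
    apply: subset_trans (ideal_exp_le (leqnSn i)) _; exact: ideal_addl.
  by apply: ideal_addr; exact: is_ideal_exp.
have hx := is_ideal_principal x.
have [|||i hi] := @primary_dcc n _ (is_ideal_add hp0 hx) mn (fun i => ideal_add (Q i)
  (principal x)).
- by move=> i; exact: is_ideal_add.
- move=> i; apply: ideal_add_min; first exact: is_ideal_add.
    by apply: subset_trans (p0Q i) _; exact: ideal_addl.
  exact: ideal_addr.
- move=> i; apply: ideal_add_min; first exact: is_ideal_add.
    by apply: subset_trans (Qd i) _; exact: ideal_addl.
  exact: ideal_addr.
have {}hi := hi i (leqnn i).
have QQ : Q i `<=` Q i.+1.
  apply: nakayama => // y Qy.
  have : ideal_add (Q i.+1) (principal x) y by rewrite -hi; apply: ideal_addl.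
  case=> z Qz [b _ e]; exists z => //; rewrite -e; apply: ideal_mul_in => //.
  apply: (saturationM (t := x) xp1); rewrite e; apply: (ideal_B (hQ i)) => //; exact: Qd.
apply: p10 => y yp1; apply: (@prime_exp p0 y i).
have [|t tp1] := @nakayama_saturation _ noeR p1 (ideal_exp [set` p1] i) [set` p0]
  (is_ideal_exp _ _) hp0 _ _ (ideal_expX i yp1).
  move=> z zi; have [|t tp1 [w wi hw]] := QQ z.
    by apply: saturation_sub; apply: ideal_addl.
  exists t => //; apply: (ideal_subl _ (y := w)).
  - by apply: is_ideal_add => //; exact: is_ideal_mul.
  - by apply: ideal_addl => //; exact: is_ideal_mul.
  - exact: ideal_addr.
move=> /p0M[] // tp0; exfalso; move/negP: tp1; apply; exact: p01.
Qed.

End NoetherianLocal.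

Section NilpotentComplete.
Variables (D : localRingType) (N : nat).
Notation m := [set` maxid D].
Hypothesis mN : forall x, ideal_exp m N x -> x = 0.

Lemma nilpotent_complete : complete_filtered (fun n => ideal_exp m n.+1).
Proof.
have hm n := is_ideal_exp m n.
split=> //.
- by move=> n; apply: ideal_exp_le.
- by rewrite ideal_exp1//; exact: is_ideal_idealr.
- by move=> n a b am bn; apply: ideal_mul_in.
- by move=> z hz; apply: mN; apply: (@ideal_exp_le _ m N N.+1) (hz N).
move=> u hu; exists (u N) => n.
have jump k : ideal_exp m n.+1 (u (n + k)%N - u n).
  elim: k => [|k IHk]; first by rewrite addn0 subrr; apply: (ideal_0 (hm _)).
  have -> : u (n + k.+1)%N - u n = (u (n + k).+1 - u (n + k)%N) + (u (n + k)%N - u n).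
    by rewrite addnS; ring.
  apply: (ideal_D (hm _)) => //; apply: (ideal_exp_le _ (hu _)).
  by rewrite ltnS leq_addr.
have stat k : u (N + k)%N = u N.
  elim: k => [|k IHk]; first by rewrite addn0.
  rewrite addnS -IHk; apply/eqP; rewrite -subr_eq0; apply/eqP; apply: mN.
  by apply: (ideal_exp_le _ (hu _)); rewrite -addnS leq_addr.
case: (leqP n N) => [/subnKC <-|/ltnW/subnKC <-]; first exact: jump.
by rewrite stat subrr; apply: (ideal_0 (hm _)).
Qed.

End NilpotentComplete.

Lemma exists_nonnilpotent_mod (A : localRingType) (K : set A) : noetherian A ->
  is_ideal K -> (forall N, ~ ideal_exp [set` maxid A] N `<=` K) ->
  exists2 a, a \in maxid A & forall n, ~ K (a ^+ n).
Proof.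
move=> noeA hK Kn; set m := [set` maxid A] in Kn.
pose P (J : set A) := [/\ is_ideal J, K `<=` J & forall N, ~ ideal_exp m N `<=` J].
have [||Q [[hQ KQ Qn] Qmax]] := @noetherian_max A noeA P K; first by move=> ? [].
  by split.
have big x : ~ Q x -> exists N, ideal_exp m N `<=` ideal_add Q (principal x).
  move=> nx; apply: contrapT => h; have hx := is_ideal_principal x.
  have QQ : Q `<=` ideal_add Q (principal x) by exact: ideal_addl.
  have e : ideal_add Q (principal x) = Q.
    apply: Qmax => //; split; [exact: is_ideal_add|exact: subset_trans KQ QQ|].
    by move=> N hN; apply: h; exists N.
  by apply: nx; rewrite -e; apply: ideal_addr => //; exact: mem_principal.
have prime x y : Q (x * y) -> Q x \/ Q y.
  move=> Qxy; apply: contrapT => /not_orP[/big[i hi] /big[j hj]].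
  apply: (Qn (i + j)%N) => z /ideal_expD; apply: ideal_mul_min => // u v.
  move=> /hi[u1 Qu1 [a _ ea]] /hj[v1 Qv1 [b _ eb]].
  have -> : u * v = v * u1 + x * a * v1 + a * b * (x * y).
    have -> : u = u1 + x * a by rewrite ea; ring.
    have {1}-> : v = v1 + y * b by rewrite eb; ring.
    have -> : v = v1 + y * b by rewrite eb; ring.
    by ring.
  by apply: (ideal_D hQ); [apply: (ideal_D hQ)|]; apply: (ideal_Ml hQ).
have [a am Qa] : exists2 a, a \in maxid A & ~ Q a.
  apply: contrapT => h; apply: (Qn 1%N); rewrite ideal_exp1; last exact: is_ideal_idealr.
  by move=> x xm; apply: contrapT => Qx; apply: h; exists x.
exists a => // n /KQ; elim: n => [|n IHn]; last by rewrite exprS => /prime[].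
move=> Q1; apply: (Qn 0%N) => x _; rewrite -[x]mulr1; exact: (ideal_Ml hQ).
Qed.

Section DaggerDescent.
Variables (A : localRingType) (p : nat) (S : localRingType).
Variable f : localHom (completion A) S.
Hypotheses (noeA : noetherian A) (pp : prime p) (hf : is_strict_henselization f).
Notation m := [set` maxid A].
Notation T := (completion S).

Definition dagger_map : localHom A T := @to_completion S \o (f \o @to_completion A).

(* Modulo J + m^(N+1) the ring A embeds into a henselian ring with the residue
   field of S; this replaces the faithful flatness of A -> T. *)
Lemma dagger_descent (J : set A) N a : is_ideal J -> J `<=` m -> J p%:R ->
  ideal_span (dagger_map @` J) (dagger_map a) ->
  ideal_add J (ideal_exp m N.+1) a.
Proof.
move=> hJ Jm Jp ha; have hmN n := is_ideal_exp m n.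
set JN := ideal_add J (ideal_exp m N.+1).
have hJN : is_ideal JN by exact: is_ideal_add.
have m1 : ideal_exp m 1 = m by rewrite ideal_exp1//; exact: is_ideal_idealr.
have JNm : JN `<=` m.
  apply: ideal_add_min => //; first exact: is_ideal_idealr.
  by rewrite -[X in _ `<=` X]m1; apply: ideal_exp_le.
have JN1 : ~ JN 1 by move=> /JNm /=; rewrite idealr1.
pose I : idealr A := ipred hJN JN1.
have IE x : (x \in I) <-> JN x.
  by rewrite -[in X in _ <-> X](ipredE hJN JN1).
pose D : localRingType := {ideal_quot I}; pose pi : localHom A D := @local_quot A I.
have pi0 x : pi x = 0 <-> JN x by rewrite -IE; exact: local_quot_eq0.
have pisurj (y : D) : exists x, pi x = y by exists (repr y); exact: local_quot_repr.
have pim x : (pi x \in maxid D) = (x \in maxid A) by exact: local_quot_maxidE.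
have piexp n y : ideal_exp [set` maxid D] n y -> exists2 x, ideal_exp m n x & pi x = y.
  elim: n y => [|n IHn] y; first by move=> _; have [x <-] := pisurj y; exists x.
  move: y; apply: (@ideal_mul_min _ _ _ [set y | exists2 x,
    ideal_exp m n.+1 x & pi x = y]).
    split=> [|c u v [x hx <-] [z hz <-]]; first by exists 0; rewrite ?rmorph0//;
      apply: (ideal_0 (hmN _)).
    have [c' <-] := pisurj c; exists (c' * x + z); last by rewrite rmorphD rmorphM.
    by apply: (ideal_D (hmN _)) => //; apply: (ideal_Ml (hmN _)).
  move=> u v um /IHn[z hz <-]; have [x xu] := pisurj u.
  exists (x * z); last by rewrite -xu -rmorphM.
  by apply: ideal_mul_in => //; rewrite /= -pim xu.
have DN y : ideal_exp [set` maxid D] N.+1 y -> y = 0.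
  by move=> /piexp[x hx <-]; apply/pi0; apply: ideal_addr.
have hD := nilpotent_complete DN.
pose de : localHom (completion A) D := completion_exth hD pi.
have deE x : de (to_completion x) = pi x by exact: (completion_extE hD).
have Dp : p%:R = 0 :> D.
  by rewrite -(rmorph_nat pi); apply/pi0; apply: ideal_addl.
have nilD x : x \in maxid D -> frobr N.+1 pp Dp x = 0.
  move=> xm; rewrite frobrE; apply: DN; apply: (@ideal_exp_le _ _ _ (p ^ N.+1)).
    by apply: ltnW; apply: ltn_expl; exact: prime_gt1.
  exact: ideal_expX.
have desurj : forall y, exists x, residue_map de x = y.
  apply: residue_map_surj => y; have [x <-] := pisurj y.
  by exists (to_completion x); rewrite deE subrr rpred0.
have [di [dK diK]] := exists_field_inv desurj.
have [shS sepf univ] := hf.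
pose j : {rmorphism residue D -> residue S} := residue_map f \o di.
have sepj : separable_algebraic j.
  move=> y; have [h sh hy] := sepf y; exists (map_poly (residue_map de) h).
    by rewrite separable_map.
  rewrite -map_poly_comp (eq_map_poly (g := residue_map f))// => c.
  by rewrite -[LHS]/(residue_map f (di (residue_map de c))) dK.
have [W [g [al [hW alE alsurj ginj]]]] := exists_residue_extension nilD sepj.
have shW : strictly_henselian W.
  by split=> //; apply: separably_closed_surj alsurj _; case: shS.
have [|psi [[psiE _] _]] := univ W (g \o de) al shW.
  move=> c; rewrite residue_map_comp -alE.
  by rewrite -[RHS]/(al (residue_map f (di (residue_map de c)))) dK.
have {}psiE c : psi (f c) = g (de c) by exact: psiE.
have psim n s : ideal_exp [set` maxid S] n s ->
    ideal_span (g @` ideal_exp [set` maxid D] n) (psi s).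
  have hspan k := is_ideal_span (g @` ideal_exp [set` maxid D] k).
  elim: n s => [|n IHn] s.
    move=> _; rewrite -[psi s]mulr1; apply: (ideal_Ml (hspan 0%N)).
    by apply: sub_ideal_span; exists 1 => //; rewrite rmorph1.
  move: s; apply: (@ideal_mul_min _ _ _ [set s |
    ideal_span (g @` ideal_exp [set` maxid D] n.+1) (psi s)]).
    exact: (is_ideal_preim psi).
  move=> s t sm0 t0; have tn := IHn _ t0; rewrite /= rmorphM.
  have sm : ideal_span (f @` [set` maxid (completion A)]) s.
    by rewrite -(strict_henselization_maxid hf).
  move: s sm {sm0}.
  apply: (@ideal_span_min _ _ [set s | ideal_span (g @` ideal_exp [set` maxid D] n.+1)
    (psi s * psi t)]).
    exact: (is_ideal_preim psi (is_ideal_colonr (psi t) (hspan n.+1))).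
  move=> _ [c cm <-] /=; rewrite psiE; move: (psi t) tn.
  apply: (@ideal_span_min _ _ [set w | ideal_span (g @` ideal_exp [set` maxid D] n.+1)
    (g (de c) * w)]).
    exact: is_ideal_colon.
  move=> _ [d dn <-] /=; rewrite -rmorphM; apply: sub_ideal_span.
  by exists (de c * d) => //; apply: ideal_mul_in => //; exact: local_hom_maxid.
have psi0 s : ideal_exp [set` maxid S] N.+1 s -> psi s = 0.
  move=> /psim; apply: (@ideal_span_min _ _ [set 0]).
    by split=> // c u v -> ->; rewrite mulr0 addr0.
  by move=> _ [d /DN -> <-] /=; rewrite rmorph0.
have hT := completion_complete S; have hTN := cf_ideal hT N.
pose Y : set T := [set t | exists2 s, completion_filt N (t - to_completion s)
  & psi s = 0].
have hY : is_ideal Y.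
  split=> [|b u v [s hs s0] [t ht t0]].
    by exists 0; rewrite rmorph0 ?subr0//; apply: (ideal_0 hTN).
  have [s' hs'] := completion_dense N b.
  exists (s' * s + t); last by rewrite rmorphD rmorphM /= s0 t0 mulr0 addr0.
  have -> : b * u + v - to_completion (s' * s + t) = b * (u - to_completion s) +
     to_completion s * (b - to_completion s') + (v - to_completion t).
    by rewrite rmorphD rmorphM; ring.
  apply: (ideal_D hTN) => //; apply: (ideal_D hTN); exact: (ideal_Ml hTN).
have : Y (dagger_map a).
  move: ha; apply: ideal_span_min => // _ [b Jb <-].
  exists (f (to_completion b)); first by rewrite subrr; apply: (ideal_0 hTN).
  rewrite psiE deE; have -> : pi b = 0 by apply/pi0; exact: ideal_addl.
  by rewrite rmorph0.
case=> s hs s0; apply/pi0/ginj; rewrite -deE -psiE.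
have -> : f (to_completion a) = (f (to_completion a) - s) + s by rewrite subrK.
rewrite rmorphD /= s0 addr0; apply: psi0; apply/completion_filt_const.
by rewrite rmorphB.
Qed.

Lemma dagger_punctured_prime (I : idealr A) :
  p%:R \in maxid A -> (2%:E <= krull_dim {ideal_quot I})%E ->
  exists q : spec T, [/\ ideal_span (dagger_map @` [set` I]) `<=` [set` q],
    dagger_map p%:R \in q & ~ q =i maxid T].
Proof.
move=> pm /supremum_ge2[n [P hP] n2].
have hm := is_ideal_idealr (maxid A).
pose J := ideal_add [set` I] (principal p%:R).
have hI := is_ideal_idealr I; have hp := is_ideal_principal (p%:R : A).
have hJ : is_ideal J by exact: is_ideal_add.
have Jm : J `<=` m.
  apply: ideal_add_min => //; last exact: principal_sub.
  by move=> x; apply: sub_maxid.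
have Jp : J p%:R by apply: ideal_addr => //; exact: mem_principal.
pose K := dagger_map @^-1` ideal_span (dagger_map @` J).
have hK : is_ideal K by exact: (is_ideal_preim dagger_map (is_ideal_span _)).
have [|a am Ka] := exists_nonnilpotent_mod noeA hK.
  move=> N NK.
  have mJ : ideal_exp m N `<=` J.
    apply: (nakayama noeA) => //; first exact: is_ideal_exp.
    by move=> x /NK; exact: dagger_descent.
  pose pi : {rmorphism A -> {ideal_quot I}} := \pi_{ideal_quot I}.
  pose Pi k := spec_map pi (P k).
  have lt k : (k < n)%N -> [set` Pi k] `<` [set` Pi k.+1].
    move=> /hP[sub nsub]; split=> [x /=|h]; first by rewrite !mem_spec_map; apply: sub.
    apply: nsub => y; rewrite -[y]reprK => yP.
    have : [set` Pi k] (repr y) by apply: h; rewrite /= mem_spec_map.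
    by rewrite /= mem_spec_map.
  have lt01 := lt 0%N (ltnW n2); have lt12 := lt 1%N n2.
  apply: (krull_principal noeA pm _ lt01 (n := N)).
    apply: subset_trans mJ _; apply: ideal_add_min.
    - by apply: is_ideal_add => //; exact: is_ideal_idealr.
    - move=> x xI; apply: ideal_addl => //; rewrite /= mem_spec_map.
      have -> : pi x = 0 by rewrite -(rmorph0 pi); apply/quot_eqP; rewrite subr0.
      exact: idealr0.
    - by apply: ideal_addr; exact: is_ideal_idealr.
  case: lt12 => h1 h2; have h3 : [set` Pi 2%N] `<=` m by move=> x; apply: sub_maxid.
  by split; [exact: subset_trans h1 h3|move=> h; apply: h2; exact: subset_trans h3 h].
have [||||q [Jq aq]] := @exists_prime_avoiding _ (ideal_span (dagger_map @` J))
    [set y | exists n, y = dagger_map a ^+ n].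
- exact: is_ideal_span.
- by exists 0%N.
- by move=> _ _ [i ->] [k ->]; exists (i + k)%N; rewrite exprD.
- move=> x hx [i e]; apply: (Ka i); change (ideal_span (dagger_map @` J)
  (dagger_map (a ^+ i))).
  by have -> : dagger_map (a ^+ i) = x by rewrite e; exact: rmorphXn.
exists q; split.
- apply: subset_trans Jq; apply: ideal_span_mono; apply: image_subset.
  exact: ideal_addl.
- by apply: Jq; apply: sub_ideal_span; exists p%:R.
- move=> e; have : dagger_map a \in q by rewrite e; exact: local_hom_maxid.
  by move=> /aq; apply; exists 1%N.
Qed.

End DaggerDescent.

(** * Transfer from A to its quadratic extension *)

Lemma quot_spec (R : comNzRingType) (I : idealr R) (q : spec R) :
  [set` I] `<=` [set` q] ->
  exists q' : spec {ideal_quot I}, forall x, (\pi x \in q') = (x \in q).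
Proof.
move=> Iq; have [hq q1 qM] := is_prime_spec q.
have mem x : (repr (\pi_{ideal_quot I} x) \in q) = (x \in q).
  have h : repr (\pi_{ideal_quot I} x) - x \in q.
    by apply: Iq; apply/quot_eqP; rewrite reprK.
  by apply/idP/idP => h'; [rewrite -[x](subKr (repr (\pi_{ideal_quot I} x))) rpredB|
    rewrite -(subrK x (repr _)) rpredD].
have prime : is_prime [set y : {ideal_quot I} | repr y \in q].
  split.
  - split=> [|a u v]; first by rewrite /= -(rmorph0 (\pi_{ideal_quot I} : R -> _))
    mem rpred0.
    rewrite /= -[a]reprK -[u]reprK -[v]reprK -rmorphM -rmorphD !mem => hu hv.
    by rewrite rpredD// idealMr.
  - by rewrite /= -(rmorph1 (\pi_{ideal_quot I} : R -> _)) mem idealr1.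
  - by move=> x y; rewrite /= -[x]reprK -[y]reprK -rmorphM !mem prime_idealrM => /orP.
by exists (mkspec prime) => x; rewrite -mem; apply/idP/idP => [/mem_mkspec|h] //;
  apply/mem_mkspec.
Qed.

Section Transfer.
Variables (A : localRingType) (p : nat).
Hypotheses (noeA : noetherian A) (pp : prime p) (pm : p%:R \in maxid A).
Variable I : idealr A.
Notation B := (lquad pm).
Let inc : localHom A B := @lquad_inc A p%:R pm.
Let J : idealr B := extended_ideal inc I.

Lemma extended_ideal_set (R Z : localRingType) (g : localHom R Z) (K : idealr R) :
  [set` extended_ideal g K] = ideal_span (g @` [set` K]).
Proof. by apply/seteqP; split=> x /= => [/asboolP|h] //; apply/asboolP. Qed.

Lemma transfer_ideal : [set` J] = qext (inc : {rmorphism A -> B}) (lquad_root pm)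
  [set` I].
Proof.
by rewrite extended_ideal_set (qext_span (lquad_ext pm))//; exact: is_ideal_idealr.
Qed.

Lemma transfer_cd : cd I = cd J.
Proof. exact: (cd_quad transfer_ideal). Qed.

Lemma transfer_krull_dim : krull_dim {ideal_quot J} = krull_dim {ideal_quot I}.
Proof. exact: (quad_krull_dim (quad_ext_quot (lquad_ext pm) transfer_ideal)). Qed.

Let u : localHom (completion A) (completion B) := completion_inc pm.

Lemma residue_completion_inc_surj y : exists x, residue_map u x = y.
Proof.
apply: residue_map_surj => z; have [b hb] := completion_surj z.
have [a ha] := lquad_surj b; exists (to_completion a); rewrite completion_incE.
rewrite -[z](subrK (to_completion b)) -addrA rpredD//.
by have := to_completion_maxid ha; rewrite rmorphB.
Qed.

Section Connected.
Variables (S S' : localRingType).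
Variables (f : localHom (completion A) S) (f' : localHom (completion B) S').
Hypotheses (hf : is_strict_henselization f) (hf' : is_strict_henselization f').
Variables (al : {rmorphism residue S -> residue S'}).
Hypothesis alsurj : forall y, exists x, al x = y.
Hypothesis alE : al \o residue_map f =1 residue_map (f' \o u).
Let IT := extended_ideal (dagger_map f) I.
Let JT := extended_ideal (dagger_map f') J.

Lemma transfer_connected : (2%:E <= krull_dim {ideal_quot I})%E ->
  connected (@punctured_spec {ideal_quot IT}) <->
  connected (@punctured_spec {ideal_quot JT}).
Proof.
move=> dim2; have [be [alK beK]] := exists_field_inv alsurj.
have [g [t [ext gE]]] := dagger_quad_ext noeA hf hf' alK beK alE.
have JTE : [set` JT] = qext (g : {rmorphism _ -> _}) t [set` IT].
  rewrite (qext_span ext); last exact: is_ideal_idealr.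
  rewrite !extended_ideal_set; apply/seteqP; split.
    apply: ideal_span_min; first exact: is_ideal_span.
    move=> _ [b Jb <-]; move: b Jb.
    apply: (@ideal_span_min _ _ [set b | ideal_span _ (dagger_map f' b)]).
      exact: (is_ideal_preim (dagger_map f') (is_ideal_span _)).
    move=> _ [a Ia <-]; rewrite /=; apply: sub_ideal_span.
    exists (dagger_map f a); last exact: gE.
    by apply: sub_ideal_span; exists a.
  apply: ideal_span_min; first exact: is_ideal_span.
  move=> _ [y ITy <-]; move: y ITy.
  apply: (@ideal_span_min _ _ [set y | ideal_span _ (g y)]).
    exact: (is_ideal_preim g (is_ideal_span _)).
  move=> _ [a Ia <-]; rewrite /=; apply: sub_ideal_span.
  exists (inc a); last exact: esym (gE a).
  by apply: sub_ideal_span; exists a.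
have qe := quad_ext_quot ext JTE.
have rm : \pi_{ideal_quot IT} (dagger_map f p%:R) \in maxid {ideal_quot IT}.
  rewrite [_ \in _](quot_maxidE IT); exact: (local_hom_maxid (s := dagger_map f)).
split; last exact: (quad_connected_down qe rm).
have [q [Iq pq nq]] := dagger_punctured_prime noeA pp hf pm dim2.
have [|q' hq'] := @quot_spec _ IT q; first by rewrite extended_ideal_set.
apply: (quad_connected_up qe rm (p0 := q')); last by rewrite hq'.
by move=> e; apply: nq => x; rewrite -hq' e; exact: (quot_maxidE IT).
Qed.

End Connected.

Lemma transfer_dagger : (2%:E <= krull_dim {ideal_quot I})%E ->
  dagger_punctured_connected I <-> dagger_punctured_connected J.
Proof.
move=> dim2; have [v [uK vK]] := exists_field_inv residue_completion_inc_surj.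
split=> [[S [f [hf conn]]]|[S' [f' [hf' conn]]]].
  have [[_ sS] sepf _] := hf.
  pose i : {rmorphism residue (completion B) -> residue S} := residue_map f \o v.
  have sepi : separable_algebraic i.
    move=> y; have [h sh hy] := sepf y; exists (map_poly (residue_map u) h).
      by rewrite separable_map.
    rewrite -map_poly_comp (eq_map_poly (g := residue_map f))// => c.
    by rewrite -[LHS]/(residue_map f (v (residue_map u c))) uK.
  have [S' [f' [e [hf' esurj eE]]]] := exists_strict_henselization sepi sS.
  exists S', f'; split=> //.
  have [al [eK alK]] := exists_field_inv esurj.
  have alsurj y : exists x, al x = y by exists (e y).
  have alE : al \o residue_map f =1 residue_map (f' \o u).
    move=> x; rewrite residue_map_comp -[RHS]eK; congr (al _).
    have := eE (residue_map u x); rewrite -[LHS]/(e (residue_map f' _)) => ->.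
    by rewrite -[RHS]/(residue_map f (v (residue_map u x))) uK.
  exact/(transfer_connected hf hf' alsurj alE dim2).
have [[_ sS'] sepf' _] := hf'.
pose i : {rmorphism residue (completion A) -> residue S'} := residue_map (f' \o u).
have sepi : separable_algebraic i.
  move=> y; have [h sh hy] := sepf' y; exists (map_poly v h);
    first by rewrite separable_map.
  rewrite -map_poly_comp (eq_map_poly (g := residue_map f'))// => c.
  by rewrite -[LHS]/(residue_map (f' \o u) (v c)) residue_map_comp vK.
have [S [f [e [hf esurj eE]]]] := exists_strict_henselization sepi sS'.
exists S, f; split=> //.
exact/(transfer_connected hf hf' esurj eE dim2).
Qed.

End Transfer.

Theorem theorem7p1 :
  (forall (B : localRingType) (p : nat),
      regular_local B -> mixed_char B p -> ramified B p ->
      forall J : idealr B, SVT J) ->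
  forall (A : localRingType) (p : nat),
    regular_local A -> mixed_char A p -> ~ ramified A p ->
    forall I : idealr A, SVT I.
Proof.
move=> svt A p regA mixA nram I; have [noeA _] := regA; have [pp _ pm] := mixA.
have := svt (lquad pm) p (quad_regular pm nram regA) (quad_mixed_char pm mixA)
  (@quad_ramified _ _ pm p erefl) (extended_ideal (@lquad_inc A p%:R pm) I).
rewrite /SVT -transfer_cd transfer_krull_dim (quad_krull_dim (lquad_ext pm)) => ->.
by split=> -[dim2 h]; split=> //; apply/(transfer_dagger noeA pp pm dim2).
Qed.
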